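(* Let $D\subseteq\mathbb{C}^n$ be a domain and let $\mathcal{F}$ be a family of holomorphic functions $f:D\to\mathbb{C}$ with the property that for each compact subset $K\subset D$ there is a function $h_K:\overline{\mathbb{C}}\to[0,\infty]$, which is finite for at least three points on $\mathbb{C}$, such that $$|Df(z)|\le h_K(f(z))\quad\text{for all } f\in\mathcal{F}\text{ and } z\in K.$$ Then $\mathcal{F}$ is normal on $D$.
   Context: $\overline{\mathbb{C}}=\mathbb{C}\cup\{\infty\}$. For a holomorphic function $f$, $Df=\left(\frac{\partial f}{\partial z_1},\dots,\frac{\partial f}{\partial z_n}\right)$ and $|Df(z)|$ is the Euclidean norm of this vector in $\mathbb{C}^n$. A family $\mathcal{F}$ of holomorphic functions $f:D\to\mathbb{C}$ on a domain $D\subseteq\mathbb{C}^n$ is normal on $D$ if every sequence in $\mathcal{F}$ contains a subsequence that converges locally uniformly on $D$ to a limit function which is either holomorphic on $D$ or identically equal to $\infty$. *)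

(* Defs.v *)
From HB Require Import structures.
From mathcomp Require Import all_boot all_order all_algebra.
From mathcomp Require Import complex.
From mathcomp Require Import all_classical all_reals all_analysis.

Set Implicit Arguments.
Unset Strict Implicit.
Unset Printing Implicit Defensive.

Import Order.TTheory GRing.Theory Num.Theory.
Import numFieldNormedType.Exports.

Local Open Scope classical_set_scope.
Local Open Scope ring_scope.

(* The library puts the metric topology of the norm on [K^o] for every
   [K : numFieldType], but does not declare it on the concrete type [R[i]]. *)
HB.instance Definition _ (R : rcfType) := NormedModule.copy R[i] (R[i]^o).

Section NormalFamilies.
Context {R : realType} {n : nat}.
Implicit Types (D : set 'rV[R[i]]_n) (f g : 'rV[R[i]]_n -> R[i]).
Implicit Types (F : set ('rV[R[i]]_n -> R[i])) (u : nat -> 'rV[R[i]]_n -> R[i]).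

Definition domain D : Prop := [/\ D !=set0, open D & connected D].

(* Functions on [D] are represented by total functions of which only the
   values on the open set [D] matter.  The scalars are [R[i]], so
   [differentiable] is complex differentiability. *)
Definition holomorphic D f : Prop := forall z, D z -> differentiable f z.

Definition cgradient f (z : 'rV[R[i]]_n) : 'rV[R[i]]_n := \row_j 'D_('e_j) f z.

(* The library norm on ['rV[R[i]]_n] is the sup norm. *)
Definition euclidean_norm (v : 'rV[R[i]]_n) : R :=
  Num.sqrt (\sum_j ComplexField.Normc.normc (v ord0 j) ^+ 2).

Definition cvg_locally_uniformly D u g : Prop :=
  forall z, D z -> exists2 U, nbhs z U & {uniform U `&` D, u @ \oo --> g}.

Definition cvg_locally_uniformly_infty D u : Prop :=
  forall z, D z -> exists2 U, nbhs z U &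
    forall M : R, \forall k \near \oo,
      forall w, (U `&` D) w -> M < ComplexField.Normc.normc (u k w).

Definition normal_family D F : Prop :=
  forall u, (forall k, F (u k)) ->
  exists phi : nat -> nat, {homo phi : i j / (i < j)%N} /\
    ((exists g, holomorphic D g /\ cvg_locally_uniformly D (u \o phi) g) \/
     cvg_locally_uniformly_infty D (u \o phi)).

End NormalFamilies.

(* [Some w] is the finite point [w], [None] is the point at infinity. *)
Notation riemann_sphere R := (one_point_compactification R[i]).

(* Main.v *)
(** On complex lines through a small ball of [D] the hypothesis says that
    [|f'| <= M] at the points where [f] takes one of three values [a, b, c].
    The heart of the matter is a Schottky theorem for such functions on the
    disc: [|f 0| <= L] bounds [f] on a disc whose radius does not depend on [L]
    (lemma [abc_schottky]).  Given this, the set of points of [D] where a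
    sequence stays bounded is open and closed, which gives the alternative
    between a holomorphic limit and [oo].

    First, the spherical derivative is bounded ([marty_bound]).  Otherwise
    Zalcman's rescaling yields a nonconstant entire function [g] with bounded
    spherical derivative such that [g' = 0] whenever [g] is [a, b] or [c].  A
    Newton step at [0] shows that a function [G] bounded by [1] on the disc with
    no simple zero satisfies [|G' 0|^2 <= C |G 0|]; applied to [g - a], [g - b],
    [g - c] and [1 / g] this makes [g'^2 / ((g - a) (g - b) (g - c))] bounded,
    hence constant by Liouville.  So [|g'|^2 >= k |g|^3] where [|g|] is large, and
    picking points where [|g|] doubles produces a pole at finite distance unless
    [g] is bounded, that is, constant.  Second, once the spherical derivative is
    bounded, [1 / f] is bounded and zero free on a fixed disc around any point
    where [|f|] is large, and Hurwitz' theorem concludes.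

    Limits are taken along a nonprincipal ultrafilter on [nat]; this replaces all
    extractions of subsequences but the last one. *)

Require Import Defs.
From HB Require Import structures.
From mathcomp Require Import all_boot all_order all_algebra.
From mathcomp Require Import ring lra.
From mathcomp Require Import complex.
From mathcomp Require Import all_classical all_reals all_analysis.

Set Implicit Arguments.
Unset Strict Implicit.
Unset Printing Implicit Defensive.

Import Order.TTheory GRing.Theory Num.Theory.
Import numFieldNormedType.Exports.

Local Open Scope classical_set_scope.
Local Open Scope ring_scope.

(** The radius in [abc_schottky] must not depend on [L]: to show that the set of points where the
    sequence stays bounded is closed, a limit point has to be reached from a nearby point at which
    the bound is unknown. Why three values: a function all of whose [a]-points are multiple
    satisfies g'^2 = O(g - a) where it is bounded, so three such values together with the omitted
    value oo lead to g'^2 = k (g - a) (g - b) (g - c). This is the differential equation of the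
    Weierstrass elliptic function, whose nonconstant solutions have poles. With two values it would
    be g'^2 = k (g - a) (g - b), which is solved by cosines, and the functions cos (m z) do not form
    a normal family. The mean value property on circles is the only integral theorem. For difference
    quotients it yields the Cauchy estimates; for reciprocals it detects zeros, in place of the
    maximum and argument principles. Its bounds lose a factor 2, and the constants in the later
    comparisons leave room for it. *)

Local Notation nc := ComplexField.Normc.normc.
Local Notation Re := complex.Re.
Local Notation Im := complex.Im.

(** * The modulus of a complex number *)

Section Modulus.
Context {R : realType}.
Implicit Types (x y z : R[i]).

Lemma nc_ge0 z : 0 <= nc z.
Proof. by case: z => a b; exact: sqrtr_ge0. Qed.

Lemma nc0 : nc (0 : R[i]) = 0.
Proof. exact: ComplexField.Normc.normc0. Qed.

Lemma nc1 : nc (1 : R[i]) = 1.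
Proof. exact: ComplexField.Normc.normc1. Qed.

Lemma nc_eq0 z : (nc z == 0) = (z == 0).
Proof.
apply/eqP/eqP => [|->]; last exact: nc0.
exact: ComplexField.Normc.eq0_normc.
Qed.

Lemma nc_gt0 z : (0 < nc z) = (z != 0).
Proof. by rewrite lt_neqAle nc_ge0 andbT eq_sym nc_eq0. Qed.

Lemma ncM x y : nc (x * y) = nc x * nc y.
Proof. exact: ComplexField.Normc.normcM. Qed.

Lemma ncV x : nc x^-1 = (nc x)^-1.
Proof. exact: ComplexField.Normc.normcV. Qed.

Lemma ncf x y : nc (x / y) = nc x / nc y.
Proof. by rewrite ncM ncV. Qed.

Lemma ncN x : nc (- x) = nc x.
Proof. by case: x => a b /=; rewrite !sqrrN. Qed.

Lemma ncB x y : nc (x - y) = nc (y - x).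
Proof. by rewrite -ncN opprB. Qed.

Lemma ncD x y : nc (x + y) <= nc x + nc y.
Proof. by have /andP[] := ComplexField.lec_normD x y. Qed.

Lemma ncBD x y : nc (x - y) <= nc x + nc y.
Proof. by rewrite -(ncN y) ncD. Qed.

Lemma nc_tri y x z : nc (x - z) <= nc (x - y) + nc (y - z).
Proof. by rewrite (le_trans _ (ncD _ _))// addrA subrK. Qed.

Lemma nc_sub x y : nc x - nc y <= nc (x - y).
Proof. by rewrite lerBlDr (le_trans _ (ncD _ _))// subrK. Qed.

Lemma nc_subD x y : nc x - nc y <= nc (x + y).
Proof. by rewrite -{1}(ncN y) -{2}(opprK y) nc_sub. Qed.

Lemma ncX x n : nc (x ^+ n) = nc x ^+ n.
Proof. by elim: n => [|n IH]; rewrite ?expr0 ?nc1// !exprS ncM IH. Qed.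

Lemma nc_real (a : R) : nc (a%:C)%C = `|a|.
Proof. by rewrite /= expr0n /= addr0 sqrtr_sqr. Qed.

Lemma nc_Re z : `|Re z| <= nc z.
Proof.
case: z => a b /=; rewrite -sqrtr_sqr ler_sqrt ?lerDl ?sqr_ge0//.
by rewrite addr_ge0 ?sqr_ge0.
Qed.

Lemma nc_Im z : `|Im z| <= nc z.
Proof.
case: z => a b /=; rewrite -sqrtr_sqr ler_sqrt ?lerDr ?sqr_ge0//.
by rewrite addr_ge0 ?sqr_ge0.
Qed.

Lemma nc_ReIm z : nc z <= `|Re z| + `|Im z|.
Proof.
case: z => a b /=; rewrite -[leRHS]ger0_norm ?addr_ge0// -sqrtr_sqr.
rewrite ler_sqrt ?sqr_ge0// sqrrD -!normrX !(ger0_norm (sqr_ge0 _)).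
by rewrite lerD2r lerDl mulrn_wge0.
Qed.

Lemma ReD x y : Re (x + y) = Re x + Re y. Proof. by case: x y => ? ? []. Qed.
Lemma ImD x y : Im (x + y) = Im x + Im y. Proof. by case: x y => ? ? []. Qed.
Lemma ReB x y : Re (x - y) = Re x - Re y. Proof. by case: x y => ? ? []. Qed.
Lemma ImB x y : Im (x - y) = Im x - Im y. Proof. by case: x y => ? ? []. Qed.

End Modulus.

(** * Limits along an ultrafilter *)

Section UltraLimits.
Context {R : realType} {T : Type} (U : set_system T) (UU : UltraFilter U).

Let UF : ProperFilter U := ultra_proper.

Definition uconv (x : T -> R[i]) (l : R[i]) :=
  forall e : R, 0 < e -> U [set t | nc (x t - l) < e].

(** The limit is the supremum of the levels that [x] exceeds on a set of [U]. An ultrafilter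
    contains the complement of each set that it does not contain, so [x] stays below each higher
    level on a set of [U]. *)
Lemma ulimR_ex (x : T -> R) (B : R) : U [set t | `|x t| <= B] ->
  exists l, forall e : R, 0 < e -> U [set t | `|x t - l| < e].
Proof.
move=> xB; pose E := [set r : R | U [set t | r <= x t]].
have E0 : E (- B) by apply: filterS xB => t /=; rewrite ler_norml => /andP[].
have EB : ubound E B.
  move=> r Er; have [t /= [+ rt]] := filter_ex (filterI xB Er).
  by rewrite ler_norml => /andP[_]; exact: le_trans.
have supE : has_sup E by split; [exists (- B)|exists B].
exists (sup E) => e e0.
have [r Er ltr] := sup_adherent e0 supE.
have nH : ~ U [set t | sup E + e <= x t].
  move=> /(ub_le_sup supE.2); lra.
have H : U (~` [set t | sup E + e <= x t]).
  by case: (in_ultra_setVsetC [set t | sup E + e <= x t] UU).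
apply: filterS (filterI Er H) => t /= [rx /negP]; rewrite -ltNge => xl.
by rewrite ltr_norml; apply/andP; split; lra.
Qed.

Lemma ulim_ex (x : T -> R[i]) (B : R) : U [set t | nc (x t) <= B] ->
  exists l, uconv x l.
Proof.
move=> xB.
have [a ha] : exists l, forall e : R, 0 < e -> U [set t | `|Re (x t) - l| < e].
  apply: (@ulimR_ex _ B); apply: filterS xB => t /=.
  exact: le_trans (nc_Re _).
have [b hb] : exists l, forall e : R, 0 < e -> U [set t | `|Im (x t) - l| < e].
  apply: (@ulimR_ex _ B); apply: filterS xB => t /=.
  exact: le_trans (nc_Im _).
exists (Complex a b) => e e0; have e20 : 0 < e / 2 by lra.
apply: filterS (filterI (ha _ e20) (hb _ e20)) => t [/= h1 h2].
by apply: le_lt_trans (nc_ReIm _) _; rewrite ReB ImB /=; lra.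
Qed.

Lemma ultraVC (A : set T) : U A \/ U (~` A).
Proof. exact: in_ultra_setVsetC. Qed.

Lemma uconv_const (c : R[i]) : uconv (fun=> c) c.
Proof. by move=> e e0; apply: filterE => t /=; rewrite subrr nc0. Qed.

Lemma uconvD x y a b : uconv x a -> uconv y b -> uconv (x \+ y) (a + b).
Proof.
move=> xa yb e e0; have e20 : 0 < e / 2 by lra.
apply: filterS (filterI (xa _ e20) (yb _ e20)) => t /= [h1 h2].
have -> : x t + y t - (a + b) = (x t - a) + (y t - b) by ring.
apply: le_lt_trans (ncD _ _) _; lra.
Qed.

Lemma uconvM x y a b : uconv x a -> uconv y b ->
  uconv (fun t => x t * y t) (a * b).
Proof.
move=> xa yb e e0; have a0 := nc_ge0 a; have b0 := nc_ge0 b.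
pose d := Num.min 1 (e / (2 * (1 + nc a + nc b))).
have d0 : 0 < d by rewrite lt_min ltr01 divr_gt0// mulr_gt0//; lra.
have d1 : d <= 1 by rewrite /d ge_min lexx.
have de : d * (1 + nc a + nc b) < e.
  apply: (@le_lt_trans _ _ (e / 2)); last lra.
  rewrite -ler_pdivlMr; last lra.
  by rewrite /d ge_min invfM mulrA lexx orbT.
apply: filterS (filterI (xa _ d0) (yb _ d0)) => t /= [h1 h2].
have -> : x t * y t - a * b = (x t - a) * (y t - b) + a * (y t - b) + b * (x t - a)
  by ring.
apply: le_lt_trans (ncD _ _) _.
apply: le_lt_trans (lerD (ncD _ _) (lexx _)) _.
rewrite !ncM; apply: le_lt_trans de.
have e1 : nc (x t - a) * nc (y t - b) <= d * 1.
  apply: ler_pM; rewrite ?nc_ge0 ?(ltW h1)//; exact: le_trans (ltW h2) d1.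
have e2 : nc a * nc (y t - b) <= nc a * d by rewrite ler_wpM2l// ltW.
have e3 : nc b * nc (x t - a) <= nc b * d by rewrite ler_wpM2l// ltW.
lra.
Qed.

Lemma uconv_le x a (B : R) : uconv x a -> U [set t | nc (x t) <= B] -> nc a <= B.
Proof.
move=> xa xB; rewrite leNgt; apply/negP => Ba.
have e0 : 0 < nc a - B by lra.
have [t /= [h1 h2]] := filter_ex (filterI (xa _ e0) xB).
have := nc_sub a (x t); rewrite ncB; lra.
Qed.

Lemma uconv_uniq x a b : uconv x a -> uconv x b -> a = b.
Proof.
move=> xa xb; apply/eqP; rewrite -subr_eq0 -nc_eq0 eq_le nc_ge0 andbT.
apply/ler_addgt0Pr => e e0; rewrite add0r.
have e20 : 0 < e / 2 by lra.
have [t /= [h1 h2]] := filter_ex (filterI (xa _ e20) (xb _ e20)).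
have := nc_tri (x t) a b; rewrite (ncB a (x t)); lra.
Qed.

Lemma uconvN x a : uconv x a -> uconv (fun t => - x t) (- a).
Proof.
move=> xa e e0; apply: filterS (xa _ e0) => t /=.
by rewrite -opprD ncN.
Qed.

Lemma uconvB x y a b : uconv x a -> uconv y b ->
  uconv (fun t => x t - y t) (a - b).
Proof. by move=> xa /uconvN; exact: uconvD. Qed.

Lemma uconv_ext x y a : U [set t | x t = y t] -> uconv x a -> uconv y a.
Proof.
by move=> xy xa e e0; apply: filterS (filterI xy (xa _ e0)) => t /= [->].
Qed.

End UltraLimits.

Lemma nat_ultra : exists U : set_system nat,
  UltraFilter U /\ (forall N, U [set k | (N <= k)%N]).
Proof.
have [U [UU sU]] := ultraFilterLemma (eventually_filter : ProperFilter \oo).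
exists U; split=> // N; apply: sU; exists N => // k /=.
Qed.

(** * Bisection arguments *)

Section Bisection.
Context {R : realType}.

Lemma nested_point (x w : nat -> R) : (forall n, 0 <= w n) ->
  (forall n, x n <= x n.+1) -> (forall n, x n.+1 + w n.+1 <= x n + w n) ->
  exists p, forall n, x n <= p <= x n + w n.
Proof.
move=> w0 xle wle.
have xm n m : x n <= x (n + m)%N.
  by elim: m => [|m IH]; rewrite ?addn0 ?addnS// (le_trans IH).
have wm n m : x (n + m)%N + w (n + m)%N <= x n + w n.
  by elim: m => [|m IH]; rewrite ?addn0 ?addnS// (le_trans _ IH).
have xw n m : x n <= x m + w m.
  apply: le_trans (xm n m) _; rewrite addnC; apply: le_trans (wm m n).
  by rewrite lerDl.
have xS : has_sup (range x).
  split; first by exists (x 0%N), 0%N.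
  by exists (x 0%N + w 0%N) => _ [n _ <-].
exists (sup (range x)) => n; apply/andP; split.
  by apply: ub_le_sup; [exact: xS.2|exists n].
by apply: ge_sup; [exact: xS.1|move=> _ [m _ <-]].
Qed.

Lemma half_pow_lt (d : R) : 0 < d -> exists n, (2^-1) ^+ n < d.
Proof.
move=> d0; have [n] := ltr_add_invr (d0 : 0 < d); rewrite add0r => nd.
exists n; apply: le_lt_trans nd; rewrite exprVn lef_pV2 ?posrE ?exprn_gt0//.
by rewrite -natrX ler_nat ltn_expl.
Qed.

Definition subcell (W H x0 y0 x y s : R) : Prop :=
  [/\ x0 <= x, x + s * W <= x0 + W, y0 <= y & y + s * H <= y0 + H].

(** If [P] failed on the whole rectangle it would fail on a nested sequence of quarters, which
    shrinks to a point and contradicts the local hypothesis there. Cells keep the shape of the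
    rectangle, so one scale [s] describes them; [H = 0] gives the bisection of an interval. *)
Lemma bisection (W H x0 y0 : R) (P : R -> R -> R -> Prop) :
  0 <= W -> 0 <= H ->
  (forall x y s, 0 < s -> subcell W H x0 y0 x y s ->
    P x y (s / 2) -> P (x + s / 2 * W) y (s / 2) ->
    P x (y + s / 2 * H) (s / 2) -> P (x + s / 2 * W) (y + s / 2 * H) (s / 2) ->
    P x y s) ->
  (forall p q, x0 <= p <= x0 + W -> y0 <= q <= y0 + H ->
    exists2 d, 0 < d & forall x y s, 0 < s -> s < d ->
      subcell W H x0 y0 x y s ->
      x <= p <= x + s * W -> y <= q <= y + s * H -> P x y s) ->
  P x0 y0 1.
Proof.
move=> W0 H0 Pstep Ploc; apply: contrapT => nP.
pose bad (c : R * R * nat) := subcell W H x0 y0 c.1.1 c.1.2 ((2^-1) ^+ c.2) /\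
  ~ P c.1.1 c.1.2 ((2^-1) ^+ c.2).
pose nxt (c c' : R * R * nat) := [/\ bad c', c'.2 = c.2.+1,
  c.1.1 <= c'.1.1, c'.1.1 + (2^-1) ^+ c'.2 * W <= c.1.1 + (2^-1) ^+ c.2 * W &
  c.1.2 <= c'.1.2 /\ c'.1.2 + (2^-1) ^+ c'.2 * H <= c.1.2 + (2^-1) ^+ c.2 * H].
have [f hf] : {f : R * R * nat -> R * R * nat & forall c, bad c -> nxt c (f c)}.
  apply: (@choice _ _ (fun c c' => bad c -> nxt c c')) => -[[x y] n].
  have [bc|] := EM (bad (x, y, n)); last by exists (x, y, n).
  have [sc /= nPc] := bc; rewrite /= in sc nPc.
  have s0 : 0 < (2^-1 : R) ^+ n by rewrite exprn_gt0.
  have sW : 0 <= (2^-1 : R) ^+ n * W by rewrite mulr_ge0// ltW.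
  have sH : 0 <= (2^-1 : R) ^+ n * H by rewrite mulr_ge0// ltW.
  have e : (2^-1 : R) ^+ n.+1 = (2^-1) ^+ n / 2 by rewrite exprSr.
  apply: contrapT => /forallNP nex; case: sc => sc1 sc2 sc3 sc4.
  have key x' y' : x <= x' ->
      x' + (2^-1) ^+ n / 2 * W <= x + (2^-1) ^+ n * W -> y <= y' ->
      y' + (2^-1) ^+ n / 2 * H <= y + (2^-1) ^+ n * H ->
      P x' y' ((2^-1) ^+ n / 2).
    move=> h1 h2 h3 h4; apply: contrapT => nP'.
    apply: (nex (x', y', n.+1)) => _; rewrite /nxt /bad /= e.
    by split=> //; split=> //; split; lra.
  by apply: nPc; apply: Pstep => //; apply: key; lra.
pose c n := iter n f (x0, y0, 0%N).
have c0 : bad (c 0%N).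
  by split; rewrite /= expr0//; split; rewrite ?mul1r.
have cb n : bad (c n) by elim: n => [|n IH] //; have [] := hf _ IH.
have cs n : nxt (c n) (c n.+1) := hf _ (cb n).
have cn n : (c n).2 = n by elim: n => [|n IH] //; have [_ -> _ _ _] := cs n; rewrite IH.
have cx n : (c n).1.1 <= (c n.+1).1.1 by have [] := cs n.
have cy n : (c n).1.2 <= (c n.+1).1.2 by have [_ _ _ _ []] := cs n.
have cxw n : (c n.+1).1.1 + (2^-1) ^+ n.+1 * W <= (c n).1.1 + (2^-1) ^+ n * W.
  by have [_ _ _ + _] := cs n; rewrite !cn.
have cyw n : (c n.+1).1.2 + (2^-1) ^+ n.+1 * H <= (c n).1.2 + (2^-1) ^+ n * H.
  by have [_ _ _ _ [_]] := cs n; rewrite !cn.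
have h0 n : 0 <= (2^-1 : R) ^+ n by rewrite exprn_ge0// invr_ge0.
have [p hp] := nested_point (fun n => mulr_ge0 (h0 n) W0) cx cxw.
have [q hq] := nested_point (fun n => mulr_ge0 (h0 n) H0) cy cyw.
have [||d d0 hd] := Ploc p q.
- by have := hp 0%N; rewrite /= expr0 mul1r.
- by have := hq 0%N; rewrite /= expr0 mul1r.
have [n nd] := half_pow_lt d0.
have [sc nPn] := cb n; rewrite cn in sc nPn; apply: nPn; apply: hd => //.
Qed.

(* [phi] need not be differentiable: a bound [K] on its local dilatation suffices,
   by bisection. *)
Lemma lip_of_local (phi : R -> R[i]) (K : R) : 0 <= K ->
  (forall t, 0 <= t <= 1 -> forall e, 0 < e -> exists2 d, 0 < d &
    forall t', 0 <= t' <= 1 -> `|t' - t| < d ->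
      nc (phi t' - phi t) <= (K + e) * `|t' - t|) ->
  nc (phi 1 - phi 0) <= K.
Proof.
move=> K0 hphi; apply/ler_addgt0Pr => e e0.
have : nc (phi (0 + 1 * 1) - phi 0) <= (K + e) * 1; last first.
  by rewrite add0r !mul1r !mulr1.
apply: (@bisection 1 0 0 0 (fun x y s => nc (phi (x + s * 1) - phi x) <= (K + e) * s))
  => //.
  move=> x _ s s0 _ h1 h2 _ _.
  have -> : x + s * 1 = x + s / 2 * 1 + s / 2 * 1 by lra.
  apply: le_trans (nc_tri (phi (x + s / 2 * 1)) _ _) _.
  by apply: le_trans (lerD h2 h1) _; rewrite -mulrDr -splitr.
move=> p q; rewrite add0r => /(hphi p) /(_ e e0)[d d0 hd] _; exists d => // x y s s0 sd.
rewrite /subcell !add0r !mulr1 => -[x0 x1 _ _] /andP[xp px] _.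
apply: le_trans (nc_tri (phi p) _ _) _.
have h1 : nc (phi (x + s) - phi p) <= (K + e) * `|x + s - p|.
  by apply: hd; [apply/andP; split; lra|rewrite ger0_norm; lra].
have h2 : nc (phi x - phi p) <= (K + e) * `|x - p|.
  by apply: hd; [apply/andP; split; lra|rewrite ler0_norm; lra].
rewrite (ncB (phi p)); apply: le_trans (lerD h1 h2) _.
rewrite -mulrDr ler_wpM2l//; first lra.
by rewrite ger0_norm ?ler0_norm; lra.
Qed.

End Bisection.

(** * Cauchy's theory on discs *)

Section ComplexDerivative.
Context {R : realType}.
Implicit Types (f g : R[i] -> R[i]) (z d : R[i]).

(* Stated with the real-valued modulus [nc]: the library norm of [R[i]] takes its
   values in [R[i]]. *)
Definition cdiff f z d := forall e : R, 0 < e -> exists2 r : R, 0 < r &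
  forall h, nc h < r -> nc (f (z + h) - f z - d * h) <= e * nc h.

Definition ccont f z := forall e : R, 0 < e -> exists2 r : R, 0 < r &
  forall h, nc h < r -> nc (f (z + h) - f z) < e.

Lemma cdiff_lip f z d : cdiff f z d -> exists2 r : R, 0 < r &
  forall h, nc h < r -> nc (f (z + h) - f z) <= (nc d + 1) * nc h.
Proof.
move=> /(_ 1 ltr01)[r r0 hr]; exists r => // h /hr hh.
have -> : f (z + h) - f z = d * h + (f (z + h) - f z - d * h) by ring.
by apply: le_trans (ncD _ _) _; rewrite mulrDl -ncM lerD2l.
Qed.

Lemma cdiff_ccont f z d : cdiff f z d -> ccont f z.
Proof.
move=> /cdiff_lip[r r0 hr] e e0.
have d0 : 0 < nc d + 1 by have := nc_ge0 d; lra.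
exists (Num.min r (e / (nc d + 1))); first by rewrite lt_min r0 divr_gt0.
move=> h; rewrite lt_min => /andP[/hr + he].
by move=> /le_lt_trans; apply; rewrite mulrC -ltr_pdivlMr.
Qed.

Lemma cdiff_cst (c z : R[i]) : cdiff (fun=> c) z 0.
Proof.
move=> e e0; exists 1 => // h _; rewrite subrr mul0r subr0 nc0.
by rewrite mulr_ge0 ?nc_ge0 ?ltW.
Qed.

Lemma cdiff_id z : cdiff id z 1.
Proof.
move=> e e0; exists 1 => // h _; rewrite mul1r addrAC addrK subrr nc0.
by rewrite mulr_ge0 ?nc_ge0 ?ltW.
Qed.

Lemma cdiffD f g z a b : cdiff f z a -> cdiff g z b ->
  cdiff (fun x => f x + g x) z (a + b).
Proof.
move=> fa gb e e0; have e20 : 0 < e / 2 by lra.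
have [r r0 hr] := fa _ e20; have [s s0 hs] := gb _ e20.
exists (Num.min r s); first by rewrite lt_min r0.
move=> h; rewrite lt_min => /andP[/hr h1 /hs h2].
have -> : f (z + h) + g (z + h) - (f z + g z) - (a + b) * h =
  (f (z + h) - f z - a * h) + (g (z + h) - g z - b * h) by ring.
apply: le_trans (ncD _ _) _; apply: le_trans (lerD h1 h2) _.
by rewrite -mulrDl -splitr.
Qed.

Lemma cdiffM f g z a b : cdiff f z a -> cdiff g z b ->
  cdiff (fun x => f x * g x) z (a * g z + f z * b).
Proof.
move=> fa gb e e0.
have A0 := nc_ge0 a; have F0 := nc_ge0 (f z); have G0 := nc_ge0 (g z).
pose k := e / (nc a + nc (f z) + nc (g z) + 1).
have k0 : 0 < k by rewrite divr_gt0//; lra.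
have kE : k * (nc a + nc (f z) + nc (g z) + 1) = e.
  by rewrite divfK//; apply/eqP; lra.
have [r r0 hr] := fa _ k0; have [s s0 hs] := gb _ k0.
have [t t0 ht] := cdiff_ccont gb k0; have [u u0 hu] := cdiff_ccont gb ltr01.
exists (Num.min (Num.min r s) (Num.min t u)); first by rewrite !lt_min r0 s0 t0.
move=> h; rewrite !lt_min => /andP[/andP[/hr h1 /hs h2] /andP[/ht h3 /hu h4]].
have -> : f (z + h) * g (z + h) - f z * g z - (a * g z + f z * b) * h =
  (f (z + h) - f z - a * h) * g (z + h) + f z * (g (z + h) - g z - b * h)
  + a * h * (g (z + h) - g z) by ring.
apply: le_trans (ncD _ _) _; apply: le_trans (lerD (ncD _ _) (lexx _)) _.
rewrite !ncM.
have h5 : nc (g (z + h)) <= nc (g z) + 1 by have := nc_sub (g (z + h)) (g z); lra.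
have h0 := nc_ge0 h.
have p1 := ler_pM (nc_ge0 _) (nc_ge0 _) h1 h5.
have p2 := ler_wpM2l F0 h2.
have p3 := ler_wpM2l (mulr_ge0 A0 h0) (ltW h3).
apply: le_trans (lerD (lerD p1 p2) p3) _.
by rewrite -kE le_eqVlt; apply/orP; left; apply/eqP; ring.
Qed.

Lemma cdiff_comp f g z a b : cdiff f z a -> cdiff g (f z) b ->
  cdiff (fun x => g (f x)) z (b * a).
Proof.
move=> fa gb e e0.
have A0 := nc_ge0 a; have B0 := nc_ge0 b.
pose k := e / (nc a + nc b + 1).
have k0 : 0 < k by rewrite divr_gt0//; lra.
have kE : k * (nc a + nc b + 1) = e by rewrite divfK//; apply/eqP; lra.
have [r r0 hr] := fa _ k0; have [s s0 hs] := gb _ k0.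
have [t t0 ht] := cdiff_lip fa; have [u u0 hu] := cdiff_ccont fa s0.
exists (Num.min r (Num.min t u)); first by rewrite !lt_min r0 t0.
move=> h; rewrite !lt_min => /andP[/hr h1 /andP[/ht h3 /hu h4]].
set w := f (z + h) - f z in h1 h3 h4.
have -> : f (z + h) = f z + w by rewrite /w; ring.
have -> : g (f z + w) - g (f z) - b * a * h =
  (g (f z + w) - g (f z) - b * w) + b * (w - a * h) by ring.
apply: le_trans (ncD _ _) _; rewrite ncM.
have p1 := hs _ h4.
have p2 := ler_wpM2l B0 h1.
have p3 := ler_wpM2l (ltW k0) h3.
apply: le_trans (lerD (le_trans p1 p3) p2) _.
by rewrite -kE le_eqVlt; apply/orP; left; apply/eqP; ring.
Qed.

Lemma cdiff_inv z : z != 0 -> cdiff (fun x => x^-1) z (- z ^- 2).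
Proof.
move=> z0 e e0; have Z0 : 0 < nc z by rewrite nc_gt0.
pose r := Num.min (nc z / 2) (e * nc z ^+ 3 / 2).
have r0 : 0 < r by rewrite lt_min !divr_gt0// mulr_gt0// exprn_gt0.
exists r => // h; rewrite lt_min => /andP[h1 h2].
have zh : nc z / 2 <= nc (z + h) by have := nc_subD z h; lra.
have zh0 : z + h != 0 by rewrite -nc_gt0; lra.
have -> : (z + h)^-1 - z^-1 - - z ^- 2 * h = h ^+ 2 / (z ^+ 2 * (z + h)).
  by field; rewrite zh0 z0.
rewrite ncf ncM !ncX expr2 mulrAC ler_wpM2r ?nc_ge0//.
rewrite ler_pdivrMr; last by rewrite mulr_gt0 ?exprn_gt0//; lra.
apply: le_trans (ltW h2) _; rewrite -!mulrA ler_wpM2l ?(ltW e0)//.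
by rewrite !(ler_wpM2l (ltW Z0)).
Qed.

Lemma cdiffN f z a : cdiff f z a -> cdiff (fun x => - f x) z (- a).
Proof.
move=> fa e /fa[r r0 hr]; exists r => // h /hr.
by rewrite -ncN; congr (nc _ <= _); ring.
Qed.

Lemma cdiffB f g z a b : cdiff f z a -> cdiff g z b ->
  cdiff (fun x => f x - g x) z (a - b).
Proof. by move=> fa /cdiffN; exact: cdiffD. Qed.

Lemma cdiffV f z a : f z != 0 -> cdiff f z a ->
  cdiff (fun x => (f x)^-1) z (- a / f z ^+ 2).
Proof.
move=> fz fa; have := cdiff_comp fa (cdiff_inv fz).
by congr cdiff; rewrite mulrC !mulNr mulrN.
Qed.

Lemma cdiffX f z a n : cdiff f z a ->
  cdiff (fun x => f x ^+ n) z (n%:R * f z ^+ n.-1 * a).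
Proof.
move=> fa; elim: n => [|n IH].
  by rewrite !mul0r; exact: (cdiff_cst 1).
have := cdiffM fa IH; congr cdiff.
  by apply: funext => x; rewrite exprS.
case: n {IH} => [|n] /=; first by rewrite expr0; ring.
by rewrite (exprS _ n) -(natr1 n.+1); ring.
Qed.

Lemma cdiff_local f g z a : (exists2 r : R, 0 < r &
    forall h, nc h < r -> f (z + h) = g (z + h)) -> cdiff f z a -> cdiff g z a.
Proof.
move=> [r r0 fg] fa e e0; have [s s0 hs] := fa e e0.
exists (Num.min r s); first by rewrite lt_min r0.
move=> h; rewrite lt_min => /andP[h1 /hs]; rewrite fg//.
by have := fg 0; rewrite addr0 nc0 => ->.
Qed.

Lemma cdiff_uniq f z a b : cdiff f z a -> cdiff f z b -> a = b.
Proof.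
move=> fa fb; apply/eqP; rewrite -subr_eq0 -nc_eq0 eq_le nc_ge0 andbT.
apply/ler_addgt0Pr => e e0; rewrite add0r; have e20 : 0 < e / 2 by lra.
have [r r0 hr] := fa _ e20; have [s s0 hs] := fb _ e20.
pose t := Num.min r s / 2.
have m0 : 0 < Num.min r s by rewrite lt_min r0.
have t0 : 0 < t by rewrite divr_gt0.
have tE : nc (t%:C)%C = t by rewrite nc_real gtr0_norm.
have tr : nc (t%:C)%C < Num.min r s by rewrite tE /t; lra.
move: tr; rewrite lt_min => /andP[/hr h1 /hs h2].
rewrite -(ler_pM2r t0) -[in leLHS]tE -ncM.
have -> : (a - b) * (t%:C)%C = (f (z + (t%:C)%C) - f z - b * (t%:C)%C) -
  (f (z + (t%:C)%C) - f z - a * (t%:C)%C) by ring.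
apply: le_trans (ncBD _ _) _; apply: le_trans (lerD h2 h1) _.
by rewrite -mulrDl -splitr tE.
Qed.

Lemma cdiff_affine f (a b z d : R[i]) : cdiff f (a + b * z) d ->
  cdiff (fun x => f (a + b * x)) z (b * d).
Proof.
move=> fd; rewrite mulrC; apply: (@cdiff_comp (fun x => a + b * x) f) => //.
rewrite -[X in cdiff _ _ X]add0r -[X in cdiff _ _ (_ + X)](mulr1 b).
apply: cdiffD; first exact: cdiff_cst.
have := cdiffM (cdiff_cst b z) (cdiff_id z).
by rewrite mul0r add0r.
Qed.

End ComplexDerivative.

(** * The complex exponential *)

Section ComplexExponential.
Context {R : realType}.

Lemma is_derive_eps (f : R -> R) (x d : R) : is_derive x 1 f d ->
  forall e : R, 0 < e -> exists2 r : R, 0 < r &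
    forall h, `|h| < r -> `|f (x + h) - f x - d * h| <= e * `|h|.
Proof.
move=> [df dE] e e0.
have /cvgrPdist_lt/(_ e e0) : h^-1 *: (f (h *: 1 + x) - f x) @[h --> 0^'] --> d.
  by rewrite -dE; exact: df.
rewrite /= near_withinE => /nbhs_ballP[r /= r0 hr].
exists r => // h hl; have [->|h0] := eqVneq h 0.
  by rewrite addr0 subrr mulr0 subrr !normr0 mulr0.
have : `|d - h^-1 *: (f (h *: 1 + x) - f x)| < e.
  by apply: hr => //; rewrite /ball /= sub0r normrN.
rewrite -[h *: 1]/(h * 1) mulr1 -[_ *: (_ - _)]/(h^-1 * (_ - _)) => /ltW H.
have -> : f (x + h) - f x - d * h = - h * (d - h^-1 * (f (h + x) - f x)).
  by rewrite (addrC h); field.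
by rewrite normrM normrN mulrC ler_wpM2r.
Qed.

Definition cexp (z : R[i]) : R[i] :=
  Complex (expR (Re z) * cos (Im z)) (expR (Re z) * sin (Im z)).

Definition circ (t : R) : R[i] := Complex (cos t) (sin t).

Lemma nc_circ t : nc (circ t) = 1.
Proof. by rewrite /= cos2Dsin2 sqrtr1. Qed.

Lemma circ_neq0 t : circ t != 0.
Proof. by rewrite -nc_gt0 nc_circ. Qed.

Lemma cexpE x t : cexp (Complex x t) = (expR x)%:C%C * circ t.
Proof. by apply/eqP; rewrite eq_complex /=; apply/andP; split; apply/eqP; ring. Qed.

Lemma cexpD x y : cexp (x + y) = cexp x * cexp y.
Proof.
case: x y => a b [c d]; rewrite /cexp /= expRD cosD sinD.
by apply/eqP; rewrite eq_complex /=; apply/andP; split; apply/eqP; ring.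
Qed.

Lemma nc_cexp z : nc (cexp z) = expR (Re z).
Proof. by case: z => a b; rewrite cexpE ncM nc_circ mulr1 nc_real gtr0_norm ?expR_gt0. Qed.

Lemma cexp0 : cexp 0 = 1.
Proof. by rewrite /cexp /= expR0 cos0 sin0 mulr1 mulr0. Qed.

Lemma cdiff_cexp0 : cdiff cexp (0 : R[i]) 1.
Proof.
(* The error terms below add up to at most [9 * k * nc h], four in the real part and five in the
   imaginary part. *)
move=> e e0; pose k := Num.min 1 (e / 10).
have k0 : 0 < k by rewrite lt_min ltr01 divr_gt0.
have k1 : k <= 1 by rewrite ge_min lexx.
have ke : k <= e / 10 by rewrite ge_min lexx orbT.
clearbody k.
have [r r0 hr] := is_derive_eps (is_derive_expR (0 : R)) k0.
have [s s0 hs] := is_derive_eps (is_derive_sin (0 : R)) k0.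
have [t t0 ht] := is_derive_eps (is_derive_cos (0 : R)) k0.
exists (Num.min (Num.min r s) (Num.min t k)); first by rewrite !lt_min r0 s0 t0.
move=> h; rewrite add0r cexp0 mul1r !lt_min => /andP[/andP[h1 h2] /andP[h3 h4]].
have lR := nc_Re h; have lI := nc_Im h.
have := hr _ (le_lt_trans lR h1); have := hs _ (le_lt_trans lI h2).
have := ht _ (le_lt_trans lI h3).
rewrite !add0r expR0 sin0 cos0 mul1r subr0 oppr0 mul0r subr0 mul1r.
move=> Hc Hs He; apply: le_trans (nc_ReIm _) _; rewrite !ReB !ImB /= subr0.
set a := Re h in h1 lR He *; set b := Im h in lI Hc Hs *.
have n0 := nc_ge0 h; set n := nc h in h1 h2 h3 h4 lR lI n0 *.
set ea := expR a in He *; set cb := cos b in Hc *; set sb := sin b in Hs *.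
have ka : k * `|a| <= k * n by rewrite ler_wpM2l// ltW.
have kb : k * `|b| <= k * n by rewrite ler_wpM2l// ltW.
have kn : k * n <= n by rewrite ler_piMl.
have n1 : n <= 1 by lra.
have ea2 : `|ea| <= 3.
  have -> : ea = (ea - 1 - a) + a + 1 by ring.
  apply: le_trans (ler_normD _ _) _; rewrite normr1.
  apply: le_trans (lerD (ler_normD _ _) (lexx _)) _; lra.
have eb2 : `|ea - 1| <= 2 * n.
  have -> : ea - 1 = (ea - 1 - a) + a by ring.
  apply: le_trans (ler_normD _ _) _; lra.
have -> : ea * cb - 1 - a = (ea - 1 - a) + ea * (cb - 1) by ring.
have -> : ea * sb - b = ea * (sb - b) + (ea - 1) * b by ring.
have p1 : `|ea * (cb - 1)| <= 3 * (k * n).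
  by rewrite normrM ler_pM// (le_trans Hc).
have p2 : `|ea * (sb - b)| <= 3 * (k * n).
  by rewrite normrM ler_pM// (le_trans Hs).
have p3 : `|(ea - 1) * b| <= 2 * n * k.
  by rewrite normrM ler_pM// (le_trans lI)// ltW.
have := ler_normD (ea - 1 - a) (ea * (cb - 1)).
have := ler_normD (ea * (sb - b)) ((ea - 1) * b).
have : k * n <= e / 10 * n by rewrite ler_wpM2r.
have : 0 <= n * e by rewrite mulr_ge0// ltW.
lra.
Qed.

Lemma cdiff_cexp z : cdiff cexp z (cexp z).
Proof.
move=> e e0; have Z0 : 0 < nc (cexp z) by rewrite nc_cexp expR_gt0.
have [r r0 hr] := cdiff_cexp0 (divr_gt0 e0 Z0); exists r => // h /hr.
rewrite add0r cexp0 cexpD mul1r => H.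
have -> : cexp z * cexp h - cexp z - cexp z * h = cexp z * (cexp h - 1 - h) by ring.
rewrite ncM; apply: le_trans (ler_wpM2l (ltW Z0) H) _.
by rewrite mulrA (mulrC (nc _)) divfK// gt_eqF.
Qed.

End ComplexExponential.

(** * Integrals of continuous complex functions on an interval *)

Section ComplexIntegral.
Context {R : realType}.
Implicit Types (phi psi : R -> R[i]) (a b m t : R).

Let mu := @lebesgue_measure R.

Definition rcont phi t := forall e : R, 0 < e -> exists2 r : R, 0 < r &
  forall t', `|t' - t| < r -> nc (phi t' - phi t) < e.

Definition rconts a b phi := forall t, a <= t <= b -> rcont phi t.

Definition cint a b phi : R[i] := Complex
  (\int[mu]_(t in `[a, b]) Re (phi t)) (\int[mu]_(t in `[a, b]) Im (phi t)).

Lemma rcontD phi psi t : rcont phi t -> rcont psi t -> rcont (phi \+ psi) t.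
Proof.
move=> hp hq e e0; have e20 : 0 < e / 2 by lra.
have [r r0 hr] := hp _ e20; have [s s0 hs] := hq _ e20.
exists (Num.min r s) => [|t']; first by rewrite lt_min r0.
rewrite lt_min => /andP[/hr h1 /hs h2] /=.
have -> : phi t' + psi t' - (phi t + psi t) = (phi t' - phi t) + (psi t' - psi t) by ring.
by apply: le_lt_trans (ncD _ _) _; lra.
Qed.

Lemma rcontN phi t : rcont phi t -> rcont (fun x => - phi x) t.
Proof.
move=> hp e /hp[r r0 hr]; exists r => // t' /hr.
by rewrite -opprD ncN.
Qed.

Lemma rcontB phi psi t : rcont phi t -> rcont psi t ->
  rcont (fun x => phi x - psi x) t.
Proof. by move=> hp /rcontN; exact: rcontD. Qed.

Lemma rcont_cst (c : R[i]) t : rcont (fun=> c) t.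
Proof. by move=> e e0; exists 1 => // t' _; rewrite subrr nc0. Qed.

(** [p] stands for the real part, the imaginary part and their real multiples, which appear when a
    complex constant is taken out of an integral. *)
Lemma integrable_part (p : R[i] -> R) C a b phi :
  (forall z, `|p z| <= C * nc z) -> {morph p : x y / x - y} -> rconts a b phi ->
  mu.-integrable `[a, b] (EFin \o (fun t => p (phi t))).
Proof.
move=> pn pB hphi; apply: continuous_compact_integrable.
  exact: segment_compact.
have C0 : 0 <= C by have := pn 1; rewrite nc1 mulr1; exact: le_trans.
have C1 : 0 < C + 1 by lra.
apply: continuous_in_subspaceT => t; rewrite inE/= in_itv/= => tab.
apply/cvgrPdist_lt => e e0; have [r r0 hr] := hphi _ tab _ (divr_gt0 e0 C1).
apply/nbhs_ballP; exists r => // t' /=; rewrite /ball/= distrC => /hr.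
rewrite ltr_pdivlMr// distrC -pB => h; apply: le_lt_trans (pn _) _.
have := nc_ge0 (phi t' - phi t); lra.
Qed.

Lemma integrable_Re a b phi : rconts a b phi ->
  mu.-integrable `[a, b] (EFin \o (fun t => Re (phi t))).
Proof.
by apply: (@integrable_part _ 1); [move=> z; rewrite mul1r nc_Re|exact: ReB].
Qed.

Lemma integrable_Im a b phi : rconts a b phi ->
  mu.-integrable `[a, b] (EFin \o (fun t => Im (phi t))).
Proof.
by apply: (@integrable_part _ 1); [move=> z; rewrite mul1r nc_Im|exact: ImB].
Qed.

Lemma cintD a b phi psi : rconts a b phi -> rconts a b psi ->
  cint a b (fun t => phi t + psi t) = cint a b phi + cint a b psi.
Proof.
move=> hp hq; rewrite /cint; apply/eqP; rewrite eq_complex /=.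
rewrite -!RintegralD ?integrable_Re ?integrable_Im//.
apply/andP; split; apply/eqP; apply: eq_Rintegral => t _.
- exact: ReD.
- exact: ImD.
Qed.

Lemma cintB a b phi psi : rconts a b phi -> rconts a b psi ->
  cint a b (fun t => phi t - psi t) = cint a b phi - cint a b psi.
Proof.
move=> hp hq; rewrite /cint; apply/eqP; rewrite eq_complex /=.
rewrite -!RintegralB ?integrable_Re ?integrable_Im//.
apply/andP; split; apply/eqP; apply: eq_Rintegral => t _.
- exact: ReB.
- exact: ImB.
Qed.

Lemma rcontZ (c : R[i]) phi t : rcont phi t -> rcont (fun x => c * phi x) t.
Proof.
move=> hp e e0; have C0 := nc_ge0 c; have c0 : 0 < nc c + 1 by lra.
have [r r0 hr] := hp _ (divr_gt0 e0 c0); exists r => // t' /hr.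
rewrite ltr_pdivlMr// -mulrBr ncM.
by have := nc_ge0 (phi t' - phi t); set n := nc (_ - _); lra.
Qed.

Lemma cintZ a b (c : R[i]) phi : rconts a b phi ->
  cint a b (fun t => c * phi t) = c * cint a b phi.
Proof.
move=> hp; case: c => u v; rewrite /cint; apply/eqP; rewrite eq_complex /=.
rewrite -!RintegralZl ?integrable_Re ?integrable_Im//.
have iR k : mu.-integrable `[a, b] (EFin \o (fun t => k * Re (phi t))).
  apply: (@integrable_part (fun z => k * Re z) `|k|) => //.
    by move=> z; rewrite normrM ler_wpM2l// nc_Re.
  by move=> x y; rewrite ReB mulrBr.
have iI k : mu.-integrable `[a, b] (EFin \o (fun t => k * Im (phi t))).
  apply: (@integrable_part (fun z => k * Im z) `|k|) => //.
    by move=> z; rewrite normrM ler_wpM2l// nc_Im.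
  by move=> x y; rewrite ImB mulrBr.
rewrite -RintegralB// -RintegralD//.
by apply/andP; split; apply/eqP; apply: eq_Rintegral => t _; case: (phi t).
Qed.

Lemma eq_cint a b phi psi : (forall t, a <= t <= b -> phi t = psi t) ->
  cint a b phi = cint a b psi.
Proof.
move=> h; rewrite /cint; congr Complex; apply: eq_Rintegral => t;
  by rewrite inE/= in_itv/= => /h ->.
Qed.

Lemma itv_length a b : a <= b -> fine (mu `[a, b]) = b - a.
Proof.
rewrite /mu lebesgue_measure_itv /= lte_fin; case: ltgtP => //= -> _.
by rewrite subrr.
Qed.

Lemma cint_cst a b (c : R[i]) : a <= b -> cint a b (fun=> c) = (b - a)%:C%C * c.
Proof.
move=> ab; rewrite /cint !Rintegral_cst// itv_length//; case: c => c d.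
by apply/eqP; rewrite eq_complex /=; apply/andP; split; apply/eqP; ring.
Qed.

Lemma Rint_bound (f : R -> R) a b K : a <= b ->
  mu.-integrable `[a, b] (EFin \o f) -> (forall t, a <= t <= b -> `|f t| <= K) ->
  `|\int[mu]_(t in `[a, b]) f t| <= K * (b - a).
Proof.
move=> ab fi fK; apply: le_trans (le_normr_Rintegral _ fi) _ => //.
rewrite -itv_length// -Rintegral_cst//; apply: le_Rintegral => //.
- exact: integrable_norm.
- apply: continuous_compact_integrable; first exact: segment_compact.
  by apply: continuous_subspaceT => x; exact: cvg_cst.
Qed.

Lemma cint_bound a b phi K : a <= b -> rconts a b phi ->
  (forall t, a <= t <= b -> nc (phi t) <= K) -> nc (cint a b phi) <= 2 * K * (b - a).
Proof.
move=> ab hp hK; apply: le_trans (nc_ReIm _) _ => /=.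
rewrite -mulrA mulrDl mul1r; apply: lerD; apply: Rint_bound => //.
- exact: integrable_Re.
- by move=> t /hK; apply: le_trans; exact: nc_Re.
- exact: integrable_Im.
- by move=> t /hK; apply: le_trans; exact: nc_Im.
Qed.

Lemma Rint_chasles (f : R -> R) a m b : a <= m <= b ->
  mu.-integrable `[a, b] (EFin \o f) ->
  \int[mu]_(t in `[a, b]) f t =
    \int[mu]_(t in `[a, m]) f t + \int[mu]_(t in `[m, b]) f t.
Proof.
move=> /andP[am mb] fi; apply/eqP; rewrite addrC -subr_eq; apply/eqP.
rewrite Rintegral_itvB ?bnd_simp//; apply: Rintegral_itv_obnd_cbnd.
by apply: integrableS fi => //; apply: subset_itvr; rewrite bnd_simp.
Qed.

Lemma cint_chasles a m b phi : a <= m <= b -> rconts a b phi ->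
  cint a b phi = cint a m phi + cint m b phi.
Proof.
move=> amb hp; apply/eqP; rewrite eq_complex /=.
by rewrite !(Rint_chasles amb) ?integrable_Re ?integrable_Im// !eqxx.
Qed.

End ComplexIntegral.

(** * Goursat's theorem and the mean value property *)

Section Goursat.
Context {R : realType}.
Implicit Types (F : R[i] -> R[i]) (x y w h : R).

Definition rect_ccont F x y w h := forall p q, x <= p <= x + w ->
  y <= q <= y + h -> ccont F (Complex p q).

(* The integral of [F dz] along the boundary, opposite sides being paired: on an
   affine [F] each integrand is then constant. *)
Definition rect F x y w h : R[i] :=
  cint x (x + w) (fun t => F (Complex t y) - F (Complex t (y + h))) +
  'i%C * cint y (y + h) (fun t => F (Complex (x + w) t) - F (Complex x t)).

Lemma rcont_row F p q : ccont F (Complex p q) -> rcont (fun t => F (Complex t q)) p.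
Proof.
move=> Fc e /Fc[r r0 hr]; exists r => // t ht.
have -> : Complex t q = Complex p q + Complex (t - p) 0.
  by apply/eqP; rewrite eq_complex /=; apply/andP; split; apply/eqP; ring.
by apply: hr; rewrite nc_real.
Qed.

Lemma rcont_col F p q : ccont F (Complex p q) -> rcont (fun t => F (Complex p t)) q.
Proof.
move=> Fc e /Fc[r r0 hr]; exists r => // t ht.
have -> : Complex p t = Complex p q + Complex 0 (t - q).
  by apply/eqP; rewrite eq_complex /=; apply/andP; split; apply/eqP; ring.
by apply: hr; apply: le_lt_trans (nc_ReIm _) _; rewrite /= normr0 add0r.
Qed.

Lemma rect_splitx F x y w1 w2 h : 0 <= w1 -> 0 <= w2 -> 0 <= h ->
  rect_ccont F x y (w1 + w2) h ->
  rect F x y (w1 + w2) h = rect F x y w1 h + rect F (x + w1) y w2 h.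
Proof.
move=> w10 w20 h0 Fc; rewrite /rect.
rewrite (@cint_chasles _ x (x + w1)); last 2 first.
- by apply/andP; split; lra.
- move=> t tx; apply: rcontB; apply: rcont_row; apply: Fc => //;
    by apply/andP; split; lra.
rewrite -(addrA x w1 w2).
rewrite (@eq_cint _ y (y + h) (fun t => F (Complex (x + (w1 + w2)) t) - F (Complex x t))
  (fun t => (F (Complex (x + w1) t) - F (Complex x t)) +
    (F (Complex (x + (w1 + w2)) t) - F (Complex (x + w1) t)))); last by move=> t _; ring.
rewrite (@cintD _ y (y + h) (fun t => F (Complex (x + w1) t) - F (Complex x t))
  (fun t => F (Complex (x + (w1 + w2)) t) - F (Complex (x + w1) t)));
  [ring| |] => t ty; apply: rcontB; apply: rcont_col; apply: Fc => //;
  by apply/andP; split; lra.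
Qed.

Lemma rect_splity F x y w h1 h2 : 0 <= w -> 0 <= h1 -> 0 <= h2 ->
  rect_ccont F x y w (h1 + h2) ->
  rect F x y w (h1 + h2) = rect F x y w h1 + rect F x (y + h1) w h2.
Proof.
move=> w0 h10 h20 Fc; rewrite /rect.
rewrite (@cint_chasles _ y (y + h1) _ (fun t => F (Complex (x + w) t) - _)); last 2 first.
- by apply/andP; split; lra.
- move=> t ty; apply: rcontB; apply: rcont_col; apply: Fc => //;
    by apply/andP; split; lra.
rewrite -(addrA y h1 h2).
rewrite (@eq_cint _ x (x + w)
  (fun t => F (Complex t y) - F (Complex t (y + (h1 + h2))))
  (fun t => (F (Complex t y) - F (Complex t (y + h1))) +
    (F (Complex t (y + h1)) - F (Complex t (y + (h1 + h2)))))); last by move=> t _; ring.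
rewrite (@cintD _ x (x + w) (fun t => F (Complex t y) - F (Complex t (y + h1)))
  (fun t => F (Complex t (y + h1)) - F (Complex t (y + (h1 + h2)))));
  [ring| |] => t tx; apply: rcontB; apply: rcont_row; apply: Fc => //;
  by apply/andP; split; lra.
Qed.

Lemma rect_ccont_sub F x y w h x' y' w' h' : x <= x' -> x' + w' <= x + w ->
  y <= y' -> y' + h' <= y + h -> rect_ccont F x y w h -> rect_ccont F x' y' w' h'.
Proof.
move=> xx xw yy yh Fc p q /andP[p1 p2] /andP[q1 q2]; apply: Fc.
  by rewrite (le_trans xx p1) (le_trans p2 xw).
by rewrite (le_trans yy q1) (le_trans q2 yh).
Qed.

Lemma rect_quarters F x y w h : 0 <= w -> 0 <= h ->
  rect_ccont F x y (w + w) (h + h) ->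
  rect F x y (w + w) (h + h) = rect F x y w h + rect F x (y + h) w h +
    (rect F (x + w) y w h + rect F (x + w) (y + h) w h).
Proof.
move=> w0 h0 Fc; have hh : 0 <= h + h by rewrite addr_ge0.
rewrite rect_splitx// !rect_splity//.
- by apply: rect_ccont_sub Fc => //; [rewrite lerDl|rewrite addrA].
- by apply: rect_ccont_sub Fc => //; rewrite lerD2l lerDl.
Qed.

Lemma cint_near_cst (phi : R -> R[i]) a b c K : a <= b -> rconts a b phi ->
  (forall t, a <= t <= b -> nc (phi t - c) <= K) ->
  nc (cint a b phi - (b - a)%:C%C * c) <= 2 * K * (b - a).
Proof.
move=> ab hp hK; rewrite -cint_cst// -cintB//; last by move=> t _; exact: rcont_cst.
by apply: cint_bound => // t tab; apply: rcontB; [exact: hp|exact: rcont_cst].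
Qed.

(** The affine part contributes [w * (d * (- 'i * h)) + 'i * (h * (d * w)) = 0]. Differences across
    the rectangle deviate from the affine ones by at most [2 * e], and componentwise integration
    doubles this. *)
Lemma rect_small F x y w h p q d e : 0 <= w -> 0 <= h ->
  x <= p <= x + w -> y <= q <= y + h -> rect_ccont F x y w h ->
  (forall p' q', x <= p' <= x + w -> y <= q' <= y + h ->
    nc (F (Complex p' q') - F (Complex p q) - d * Complex (p' - p) (q' - q)) <= e) ->
  nc (rect F x y w h) <= 4 * e * (w + h).
Proof.
move=> w0 h0 xp yq Fc Fe.
have xx : x <= x <= x + w by apply/andP; split; lra.
have xw : x <= x + w <= x + w by apply/andP; split; lra.
have yy : y <= y <= y + h by apply/andP; split; lra.
have yh : y <= y + h <= y + h by apply/andP; split; lra.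
have near u v u' v' : x <= u <= x + w -> y <= v <= y + h -> x <= u' <= x + w ->
    y <= v' <= y + h ->
    nc (F (Complex u v) - F (Complex u' v') - d * Complex (u - u') (v - v')) <= 2 * e.
  move=> hu hv hu' hv'.
  have -> : F (Complex u v) - F (Complex u' v') - d * Complex (u - u') (v - v') =
    (F (Complex u v) - F (Complex p q) - d * Complex (u - p) (v - q)) -
    (F (Complex u' v') - F (Complex p q) - d * Complex (u' - p) (v' - q)).
    have -> : Complex (u - u') (v - v') = Complex (u - p) (v - q) - Complex (u' - p) (v' - q).
      by apply/eqP; rewrite eq_complex /=; apply/andP; split; apply/eqP; ring.
    by ring.
  have h1 := Fe _ _ hu hv; have h2 := Fe _ _ hu' hv'.
  by apply: le_trans (ncBD _ _) _; lra.
have A := @cint_near_cst (fun t => F (Complex t y) - F (Complex t (y + h))) x (x + w)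
  (d * Complex 0 (- h)) (2 * e).
have B := @cint_near_cst (fun t => F (Complex (x + w) t) - F (Complex x t)) y (y + h)
  (d * Complex w 0) (2 * e).
rewrite /rect; set a := cint _ _ _ in A *; set b := cint _ _ _ in B *.
have {}A : nc (a - (x + w - x)%:C%C * (d * Complex 0 (- h))) <= 2 * (2 * e) * (x + w - x).
  apply: A; first lra.
    by move=> t tx; apply: rcontB; apply: rcont_row; exact: Fc.
  move=> t tx; have := near t y t (y + h) tx yy tx yh.
  by congr (nc (_ - d * Complex _ _) <= _); ring.
have {}B : nc (b - (y + h - y)%:C%C * (d * Complex w 0)) <= 2 * (2 * e) * (y + h - y).
  apply: B; first lra.
    by move=> t tx; apply: rcontB; apply: rcont_col; exact: Fc.
  move=> t tx; have := near (x + w) t x t xw tx xx tx.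
  by congr (nc (_ - d * Complex _ _) <= _); ring.
have -> : a + 'i%C * b = (a - (x + w - x)%:C%C * (d * Complex 0 (- h))) +
    'i%C * (b - (y + h - y)%:C%C * (d * Complex w 0)).
  have -> : (x + w - x)%:C%C = w%:C%C by congr (_%:C%C); ring.
  have -> : (y + h - y)%:C%C = h%:C%C by congr (_%:C%C); ring.
  have -> : Complex 0 (- h) = - 'i%C * h%:C%C.
    by apply/eqP; rewrite eq_complex /=; apply/andP; split; apply/eqP; ring.
  by rewrite -[Complex w 0]/(w%:C%C); ring.
have i1 : nc ('i%C : R[i]) = 1 by rewrite /= expr0n expr1n add0r sqrtr1.
apply: le_trans (ncD _ _) _; rewrite ncM i1 mul1r; lra.
Qed.

(** The bound [e * s ^+ 2] scales like the area, so it passes from four quarters to their union; on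
    a small cell around a point it holds because the error of the affine approximation and the
    perimeter are each of order [s]. *)
Lemma goursat F x0 y0 W H : 0 <= W -> 0 <= H ->
  (forall p q, x0 <= p <= x0 + W -> y0 <= q <= y0 + H ->
    exists d, cdiff F (Complex p q) d) ->
  rect F x0 y0 W H = 0.
Proof.
move=> W0 H0 Fd.
have Fc p q : x0 <= p <= x0 + W -> y0 <= q <= y0 + H -> ccont F (Complex p q).
  by move=> hp hq; have [d /cdiff_ccont] := Fd p q hp hq.
apply/eqP; rewrite -nc_eq0 eq_le nc_ge0 andbT; apply/ler_addgt0Pr => e e0.
rewrite add0r.
suff : nc (rect F x0 y0 (1 * W) (1 * H)) <= e * 1 ^+ 2.
  by rewrite !mul1r expr1n mulr1.
apply: (@bisection _ W H x0 y0
  (fun x y s => nc (rect F x y (s * W) (s * H)) <= e * s ^+ 2)) => //.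
  move=> x y s s0 [c1 c2 c3 c4].
  have sW : 0 <= s / 2 * W by rewrite mulr_ge0//; lra.
  have sH : 0 <= s / 2 * H by rewrite mulr_ge0//; lra.
  have eW : s * W = s / 2 * W + s / 2 * W by lra.
  have eH : s * H = s / 2 * H + s / 2 * H by lra.
  move=> h1 h2 h3 h4; rewrite eW eH rect_quarters//; last first.
    apply: rect_ccont_sub Fc; rewrite -?eW -?eH //.
  apply: le_trans (ncD _ _) _; apply: le_trans (lerD (ncD _ _) (ncD _ _)) _.
  by apply: le_trans (lerD (lerD h1 h3) (lerD h2 h4)) _; lra.
move=> p q hp hq; have [d hd] := Fd p q hp hq.
(* Chosen so that [4 * k * (W + H) ^+ 2 <= e], the 4 being that of [rect_small]. *)
pose k := e / (4 * (W + H + 1) ^+ 2).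
have WH : 0 < (W + H + 1) ^+ 2 by rewrite exprn_gt0//; lra.
have k0 : 0 < k by rewrite divr_gt0// mulr_gt0.
have [r r0 hr] := hd _ k0.
exists (r / (W + H + 1)); first by rewrite divr_gt0//; lra.
move=> x y s s0 sr [c1 c2 c3 c4] xp yq.
have sW : 0 <= s * W by rewrite mulr_ge0//; lra.
have sH : 0 <= s * H by rewrite mulr_ge0//; lra.
move: sr; rewrite ltr_pdivlMr; last lra.
move=> sr.
apply: (@le_trans _ _ (4 * (k * (s * W + s * H)) * (s * W + s * H))).
  apply: (rect_small (d := d) sW sH xp yq).
    by move=> u v hu hv; apply: Fc; apply/andP; split; lra.
  move=> u v hu hv.
  have -> : Complex u v = Complex p q + Complex (u - p) (v - q).
    by apply/eqP; rewrite eq_complex /=; apply/andP; split; apply/eqP; ring.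
  have n1 : nc (Complex (u - p) (v - q)) <= s * W + s * H.
    apply: le_trans (nc_ReIm _) _ => /=; apply: lerD; rewrite ler_norml;
      by apply/andP; split; lra.
  apply: le_trans (hr _ _) _; last by rewrite ler_wpM2l// ltW.
  by apply: le_lt_trans n1 _; lra.
have -> : 4 * (k * (s * W + s * H)) * (s * W + s * H) =
  (4 * k * (W + H) ^+ 2) * s ^+ 2 by ring.
rewrite ler_wpM2r ?sqr_ge0//.
have -> : e = 4 * k * (W + H + 1) ^+ 2.
  by rewrite /k; field; apply/eqP; lra.
rewrite ler_wpM2l//; first by lra.
by rewrite lerXn2r ?nnegrE; lra.
Qed.

(* Goursat's theorem for [zeta |-> f (w + exp zeta)] on the rectangle
   [[x, ln r] x [0, 2 pi]]: the horizontal sides cancel by periodicity, and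
   [x --> -oo].  Only continuity is asked at [w], so that difference quotients
   are allowed. *)
Lemma mean_value f (w : R[i]) (r : R) : 0 < r ->
  (forall z, 0 < nc (z - w) <= r -> exists d, cdiff f z d) -> ccont f w ->
  cint 0 (2 * pi) (fun t => f (w + r%:C%C * circ t)) = (2 * pi)%:C%C * f w.
Proof.
move=> r0 fd fw.
pose F z := f (w + cexp z).
have Fd z : Re z <= ln r -> exists d, cdiff F z d.
  move=> zr; have [] := fd (w + cexp z).
    rewrite [w + _]addrC addrK nc_cexp expR_gt0 /=.
    by rewrite -[leRHS]lnK ?posrE// ler_expR.
  move=> d hd; exists (d * cexp z); apply: (@cdiff_comp _ (fun z => w + cexp z)) => //.
  by rewrite -[cexp z in X in cdiff _ _ X]add0r; apply: cdiffD; [exact: cdiff_cst|exact: cdiff_cexp].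
have Fc z : Re z <= ln r -> ccont F z by move=> /Fd[d /cdiff_ccont].
have pi0 : 0 < pi :> R by exact: pi_gt0.
have col x : x <= ln r -> rconts 0 (2 * pi) (fun t => F (Complex x t)).
  by move=> xr t _; apply: rcont_col; exact: Fc.
(* The circles of radius [r] and [expR x] around [w] have the same mean. *)
have const x : x <= ln r ->
    cint 0 (2 * pi) (fun t => F (Complex (ln r) t)) =
    cint 0 (2 * pi) (fun t => F (Complex x t)).
  move=> xr; have : rect F x 0 (ln r - x) (2 * pi) = 0.
    apply: goursat; [lra|lra|move=> p q hp hq; apply: Fd => /=; lra].
  rewrite /rect addrC (@eq_cint _ x _ _ (fun=> 0)); last first.
    move=> t _; rewrite /F !cexpE.
    have -> : circ (0 + 2 * pi) = circ 0 :> R[i].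
      by rewrite /circ add0r mulr_natl cos2pi sin2pi cos0 sin0.
    by rewrite subrr.
  rewrite cint_cst; last by lra.
  have i0 : 'i%C != 0 :> R[i] by rewrite eq_complex /= oner_eq0 andbF.
  rewrite mulr0 addr0 add0r addrC subrK => /eqP; rewrite mulf_eq0 (negbTE i0) /=.
  by rewrite cintB ?subr_eq0; [move/eqP|exact: col|exact: col].
transitivity (cint 0 (2 * pi) (fun t => F (Complex (ln r) t))).
  by apply: eq_cint => t _; rewrite /F cexpE lnK.
apply/eqP; rewrite -subr_eq0 -nc_eq0 eq_le nc_ge0 andbT.
apply/ler_addgt0Pr => e e0; rewrite add0r.
have [s s0 hs] := fw _ (divr_gt0 e0 (mulr_gt0 (mulr_gt0 (ltr0n _ 2) (ltr0n _ 2)) pi0)).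
pose x := Num.min (ln r) (ln (s / 2)).
have xr : x <= ln r by rewrite ge_min lexx.
have ex : expR x < s.
  apply: (@le_lt_trans _ _ (s / 2)); last lra.
  by rewrite -[leRHS]lnK ?posrE ?ler_expR ?ge_min ?lexx ?orbT//; lra.
rewrite (const _ xr) -{2}[2 * pi]subr0.
apply: le_trans (@cint_near_cst _ _ _ _ (e / (2 * 2 * pi)) _ (col _ xr) _) _.
- by lra.
- by move=> t _; apply: ltW; apply: hs; rewrite nc_cexp.
- by rewrite subr0 le_eqVlt; apply/orP; left; apply/eqP; field; apply/eqP; lra.
Qed.

End Goursat.

(** * Cauchy estimates *)

Section CauchyEstimates.
Context {R : realType}.
Implicit Types (f g : R[i] -> R[i]) (w z x y h : R[i]) (r S K : R).

(* Junk value [0] where [f] is not differentiable. *)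
Definition cderiv f z : R[i] := xget 0 [set d | cdiff f z d].

Definition chol f w r := forall z, nc (z - w) < r -> exists d, cdiff f z d.

Definition cbdd f w r S := forall z, nc (z - w) < r -> nc (f z) <= S.

Lemma cderivE f z d : cdiff f z d -> cderiv f z = d.
Proof.
move=> fd; apply: (@cdiff_uniq _ f z) => //.
rewrite /cderiv; case: xgetP => [y _ //|].
by move=> /(_ d).
Qed.

Lemma cdiff_deriv f z : (exists d, cdiff f z d) -> cdiff f z (cderiv f z).
Proof. by move=> [d fd]; rewrite (cderivE fd). Qed.

Lemma chol_cdiff f w r z : chol f w r -> nc (z - w) < r -> cdiff f z (cderiv f z).
Proof. by move=> fh /fh /cdiff_deriv. Qed.

Lemma chol_sub f w r w' r' : nc (w' - w) + r' <= r -> chol f w r -> chol f w' r'.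
Proof.
by move=> hr fh z zw; apply: fh; apply: le_lt_trans (nc_tri w' _ _) _; lra.
Qed.

Lemma cbdd_sub f w r w' r' S : nc (w' - w) + r' <= r -> cbdd f w r S -> cbdd f w' r' S.
Proof.
by move=> hr fh z zw; apply: fh; apply: le_lt_trans (nc_tri w' _ _) _; lra.
Qed.

Lemma rcont_circle f w r t : 0 < r -> ccont f (w + r%:C%C * circ t) ->
  rcont (fun t => f (w + r%:C%C * circ t)) t.
Proof.
move=> r0 fc.
have E s : r%:C%C * circ s = cexp (Complex (ln r) s) by rewrite cexpE lnK.
have : rcont (fun s => f (w + cexp (Complex (ln r) s))) t.
  apply: (@rcont_col _ (fun z => f (w + cexp z))).
  move=> e e0; rewrite E in fc; have [s s0 hs] := fc _ e0.
  have [u u0 hu] := cdiff_ccont (cdiff_cexp (Complex (ln r) t)) s0.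
  exists u => // h /hu /hs; congr (nc (f _ - _) < _); ring.
by move=> H e /H[s s0 hs]; exists s => // t'; rewrite !E; exact: hs.
Qed.

Lemma nc_on_circle w r t : 0 < r -> nc (w + r%:C%C * circ t - w) = r.
Proof. by move=> r0; rewrite addrC addKr ncM nc_circ nc_real mulr1 gtr0_norm. Qed.

Lemma nc_scalar r : 0 < r -> nc (r%:C%C : R[i]) = r.
Proof. by move=> r0; rewrite nc_real gtr0_norm. Qed.

Lemma two_pi_gt0 : 0 < 2 * pi :> R.
Proof. by rewrite mulr_gt0 ?pi_gt0. Qed.

(* The factor 2 comes from bounding real and imaginary parts separately. *)
Lemma mean_bound f w r K : 0 < r ->
  (forall z, 0 < nc (z - w) <= r -> exists d, cdiff f z d) -> ccont f w ->
  (forall z, nc (z - w) = r -> nc (f z) <= K) -> nc (f w) <= 2 * K.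
Proof.
move=> r0 fd fc fK; have p0 := two_pi_gt0.
rewrite -(ler_pM2l p0) -{1}(nc_scalar p0) -ncM -(mean_value r0 fd fc).
rewrite [leRHS]mulrC -[X in _ <= _ * X]subr0; apply: cint_bound; first exact: ltW.
  move=> t _; apply: rcont_circle => //.
  have [|d /cdiff_ccont//] := fd (w + r%:C%C * circ t).
  by rewrite nc_on_circle// r0 lexx.
by move=> t _; apply: fK; rewrite nc_on_circle.
Qed.

(** The derivative as value at [w] makes the quotient continuous there, which is all that
    [mean_value] asks at the centre. *)
Definition dquot f w z := if z == w then cderiv f w else (f z - f w) / (z - w).

Lemma dquot_ccont f w : (exists d, cdiff f w d) -> ccont (dquot f w) w.
Proof.
move=> /cdiff_deriv fd e e0; have e20 : 0 < e / 2 by lra.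
have [r r0 hr] := fd _ e20; exists r => // h /hr hh.
rewrite /dquot eqxx; case: eqP => [_|/eqP wh]; first by rewrite subrr nc0.
have h0 : h != 0 by apply: contra_neq wh => ->; rewrite addr0.
have -> : (f (w + h) - f w) / (w + h - w) - cderiv f w =
    (f (w + h) - f w - cderiv f w * h) / h.
  by field; rewrite h0.
rewrite ncf ltr_pdivrMr ?nc_gt0//; apply: le_lt_trans hh _.
by rewrite ltr_pM2r ?nc_gt0//; lra.
Qed.

Lemma dquot_cdiff f w z : z != w -> (exists d, cdiff f z d) ->
  exists d, cdiff (dquot f w) z d.
Proof.
move=> zw [d fd].
have zw0 : z - w != 0 by rewrite subr_eq0.
eexists; apply: (@cdiff_local _ (fun x => (f x - f w) * (x - w)^-1)); last first.
  apply: cdiffM; first by apply: cdiffB; [exact: fd|exact: cdiff_cst].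
  apply: (@cdiffV _ (fun x => x - w)) => //.
  by apply: cdiffB; [exact: cdiff_id|exact: cdiff_cst].
exists (nc (z - w)); first by rewrite nc_gt0.
move=> h hz; rewrite /dquot; case: eqP => // E.
by move: hz; rewrite -E opprD addNKr ncN ltxx.
Qed.

(* The mean value property of the difference quotient of [f] at [z]. *)
Lemma cauchy_dquot f z r : 0 < r ->
  (forall x, nc (x - z) <= r -> exists d, cdiff f x d) ->
  cint 0 (2 * pi) (fun t => (f (z + r%:C%C * circ t) - f z) / (r%:C%C * circ t)) =
  (2 * pi)%:C%C * cderiv f z.
Proof.
move=> r0 fd.
have fz : exists d, cdiff f z d by apply: fd; rewrite subrr nc0 ltW.
have -> : cderiv f z = dquot f z z by rewrite /dquot eqxx.
rewrite -(@mean_value _ (dquot f z) z r)//; last exact: dquot_ccont.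
  apply: eq_cint => t _; rewrite /dquot; case: eqP => [E|_].
    by have := nc_on_circle z t r0; rewrite E subrr nc0 => E0; move: r0; rewrite -E0 ltxx.
  by congr (_ / _); ring.
move=> x /andP[xz0 xz]; apply: dquot_cdiff; last exact: fd.
by rewrite -subr_eq0 -nc_gt0.
Qed.

Lemma circle_quot_rcont (g : R -> R[i]) r t : 0 < r -> rcont g t ->
  rcont (fun t => g t / (r%:C%C * circ t)) t.
Proof.
move=> r0 gc.
have H : rcont (fun t => (0 + r%:C%C * circ t)^-1) t.
  apply: rcont_circle => //; apply: cdiff_ccont; apply: cdiff_inv.
  by rewrite add0r mulf_neq0 ?circ_neq0// -nc_gt0 nc_scalar.
move=> e e0; have G0 := nc_ge0 (g t).
have ir0 : 0 < r^-1 by rewrite invr_gt0.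
pose k := Num.min (e / 2 * r) (e / 2 / (nc (g t) + 1)).
have e20 : 0 < e / 2 by lra.
have k1 : 0 < e / 2 * r by rewrite mulr_gt0.
have k2 : 0 < e / 2 / (nc (g t) + 1) by rewrite divr_gt0//; lra.
have [s s0 hs] := gc _ k1; have [u u0 hu] := H _ k2.
exists (Num.min s u); first by rewrite lt_min s0.
move=> t'; rewrite lt_min => /andP[/hs h1 /hu]; rewrite !add0r => h2.
have -> : g t' / (r%:C%C * circ t') - g t / (r%:C%C * circ t) =
  (g t' - g t) / (r%:C%C * circ t') +
  g t * ((r%:C%C * circ t')^-1 - (r%:C%C * circ t)^-1) by ring.
apply: le_lt_trans (ncD _ _) _; rewrite ncf !ncM nc_circ nc_scalar// mulr1.
have p1 : nc (g t' - g t) / r < e / 2 by rewrite ltr_pdivrMr.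
have p2 : nc (g t) * nc ((r%:C%C * circ t')^-1 - (r%:C%C * circ t)^-1) <= e / 2.
  move: h2; rewrite ltr_pdivlMr; last lra.
  have := nc_ge0 ((r%:C%C * circ t')^-1 - (r%:C%C * circ t)^-1).
  by set n := nc (_^-1 - _); move=> n0 h2; lra.
lra.
Qed.

Lemma cauchy_kernel_bound (g : R -> R[i]) r K : 0 < r ->
  rconts 0 (2 * pi) g -> (forall t, nc (g t) <= K) ->
  nc (cint 0 (2 * pi) (fun t => g t / (r%:C%C * circ t))) <= (2 * pi) * (2 * K / r).
Proof.
move=> r0 gc gK; rewrite [leRHS]mulrC -[X in _ <= _ * X]subr0 -[2 * K / r]mulrA; apply: cint_bound.
- exact: ltW two_pi_gt0.
- by move=> t /gc; exact: circle_quot_rcont.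
- move=> t _; rewrite ncf ncM nc_circ nc_scalar// mulr1.
  by rewrite ler_pM2r ?invr_gt0.
Qed.

Lemma rcont_circle_quot f z r : 0 < r ->
  (forall x, nc (x - z) <= r -> exists d, cdiff f x d) ->
  rconts 0 (2 * pi) (fun t => f (z + r%:C%C * circ t) - f z).
Proof.
move=> r0 fd t _; apply: rcontB; last exact: rcont_cst.
apply: rcont_circle => //.
by have [|d /cdiff_ccont] := fd (z + r%:C%C * circ t); rewrite ?nc_on_circle.
Qed.

(** The 4 is a factor 2 from componentwise integration times a factor 2 from
    [nc (f x - f z) <= 2 * S]. *)
Lemma cauchy_estimate f z r S : 0 < r ->
  (forall x, nc (x - z) <= r -> exists d, cdiff f x d) ->
  (forall x, nc (x - z) <= r -> nc (f x) <= S) -> nc (cderiv f z) <= 4 * S / r.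
Proof.
move=> r0 fd fS; have p0 := two_pi_gt0.
rewrite -(ler_pM2l p0) -{1}(nc_scalar p0) -ncM -(cauchy_dquot r0 fd).
have -> : 4 * S / r = 2 * (2 * S) / r by rewrite mulrA -natrM.
apply: cauchy_kernel_bound => //; first exact: rcont_circle_quot.
move=> t; apply: le_trans (ncBD _ _) _.
have := fS (z + r%:C%C * circ t); rewrite nc_on_circle// lexx => /(_ isT).
by have := fS z; rewrite subrr nc0 (ltW r0) => /(_ isT); lra.
Qed.

(** Bisection of the segment replaces the integration of the derivative, so that no continuity of
    the derivative is assumed; at this stage it is not yet available. *)
Lemma lip_segment f x y K : 0 <= K ->
  (forall t : R, 0 <= t <= 1 ->
    exists2 d, cdiff f (y + t%:C%C * (x - y)) d & nc d <= K) ->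
  nc (f x - f y) <= K * nc (x - y).
Proof.
move=> K0 fd.
have := @lip_of_local _ (fun t => f (y + t%:C%C * (x - y))) (K * nc (x - y)).
rewrite mul1r addrCA subrr addr0 mul0r addr0; apply.
  by rewrite mulr_ge0 ?nc_ge0.
move=> t t01 e e0; have [d fdd dK] := fd t t01; have N0 := nc_ge0 (x - y).
have k0 : 0 < e / (nc (x - y) + 1) by rewrite divr_gt0//; lra.
have [r r0 hr] := fdd _ k0.
exists (r / (nc (x - y) + 1)); first by rewrite divr_gt0//; lra.
move=> t' t'01; rewrite ltr_pdivlMr; last lra.
move=> tt.
pose h := (t' - t)%:C%C * (x - y).
have hE : nc h = `|t' - t| * nc (x - y) by rewrite ncM nc_real.
have A0 := normr_ge0 (t' - t).
have hlt : nc h < r by rewrite hE; apply: le_lt_trans tt; rewrite ler_wpM2l//; lra.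
have -> : y + t'%:C%C * (x - y) = y + t%:C%C * (x - y) + h.
  rewrite /h; have -> : (t' - t)%:C%C = t'%:C%C - t%:C%C :> R[i] by rewrite raddfB.
  by ring.
have -> : f (y + t%:C%C * (x - y) + h) - f (y + t%:C%C * (x - y)) =
  d * h + (f (y + t%:C%C * (x - y) + h) - f (y + t%:C%C * (x - y)) - d * h) by ring.
apply: le_trans (ncD _ _) _; apply: le_trans (lerD (lexx _) (hr _ hlt)) _.
rewrite ncM hE mulrDl; apply: lerD.
  by rewrite (mulrC `|t' - t|) mulrA ler_wpM2r// ler_wpM2r.
have -> : e / (nc (x - y) + 1) * (`|t' - t| * nc (x - y)) =
  e * `|t' - t| * (nc (x - y) / (nc (x - y) + 1)) by ring.
rewrite ler_piMr//; first by rewrite mulr_ge0// ltW.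
by rewrite ler_pdivrMr; lra.
Qed.

Lemma segment_disc x y w r (t : R) : 0 <= t <= 1 -> nc (x - w) < r -> nc (y - w) < r ->
  nc (y + t%:C%C * (x - y) - w) < r.
Proof.
move=> /andP[t0 t1] xr yr.
have -> : y + t%:C%C * (x - y) - w = (1 - t)%:C%C * (y - w) + t%:C%C * (x - w).
  have -> : (1 - t)%:C%C = 1 - t%:C%C :> R[i] by rewrite raddfB.
  by ring.
apply: le_lt_trans (ncD _ _) _; rewrite !ncM !nc_real !ger0_norm//; last lra.
have := nc_ge0 (x - w); have := nc_ge0 (y - w).
have [t2|t2] := leP t 2^-1.
  have : t * nc (x - w) <= t * r by rewrite ler_wpM2l// ltW.
  have : (1 - t) * nc (y - w) < (1 - t) * r by rewrite ltr_pM2l//; lra.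
  lra.
have : t * nc (x - w) < t * r by rewrite ltr_pM2l//; lra.
have : (1 - t) * nc (y - w) <= (1 - t) * r by rewrite ler_wpM2l ?(ltW yr)//; lra.
lra.
Qed.

Lemma lip_disc f w r K x y : 0 <= K -> chol f w r ->
  (forall z, nc (z - w) < r -> nc (cderiv f z) <= K) ->
  nc (x - w) < r -> nc (y - w) < r -> nc (f x - f y) <= K * nc (x - y).
Proof.
move=> K0 fh fK xr yr; apply: lip_segment => // t t01.
have h := segment_disc t01 xr yr.
by exists (cderiv f (y + t%:C%C * (x - y))); [exact: chol_cdiff h|exact: fK].
Qed.

End CauchyEstimates.

(** * Second derivatives and Taylor estimates *)

Section SecondOrder.
Context {R : realType}.
Implicit Types (f g : R[i] -> R[i]) (w z x y h : R[i]) (r S K : R).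

Lemma cbdd_ge0 f w r S : 0 < r -> cbdd f w r S -> 0 <= S.
Proof. by move=> r0 fS; apply: le_trans (nc_ge0 _) (fS w _); rewrite subrr nc0. Qed.

Lemma deriv_bdd f w r S z : 0 < r -> chol f w r -> cbdd f w r S ->
  nc (z - w) <= r / 2 -> nc (cderiv f z) <= 16 * S / r.
Proof.
move=> r0 fh fS zw; have r40 : 0 < r / 4 by lra.
have -> : 16 * S / r = 4 * S / (r / 4) by field; rewrite gt_eqF.
apply: cauchy_estimate => // x xz; [apply: fh|apply: fS];
  by apply: le_lt_trans (nc_tri z _ _) _; lra.
Qed.

(** Subtract the Cauchy formulas at [x] and [y] on circles of radius [r / 8]: the integrand is a
    difference of values of [f] at points that differ by [x - y], so the Lipschitz constant
    [16 * S / r] of [f] itself suffices. *)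
Lemma deriv_lip f w r S x y : 0 < r -> chol f w r -> cbdd f w r S ->
  nc (x - w) < r / 4 -> nc (y - w) < r / 4 ->
  nc (cderiv f x - cderiv f y) <= 16 * 32 * S / r ^+ 2 * nc (x - y).
Proof.
move=> r0 fh fS xw yw; have p0 := two_pi_gt0 (R := R); have S0 := cbdd_ge0 r0 fS.
have r80 : 0 < r / 8 by lra.
pose K1 := 16 * S / r.
have K10 : 0 <= K1 by rewrite divr_ge0 ?mulr_ge0// ltW.
have lip u v : nc (u - w) < r / 2 -> nc (v - w) < r / 2 ->
    nc (f u - f v) <= K1 * nc (u - v).
  apply: lip_disc => //; first by apply: chol_sub fh; rewrite subrr nc0; lra.
  by move=> z /ltW; exact: deriv_bdd.
have disc z : nc (z - w) < r / 4 -> forall u, nc (u - z) <= r / 8 -> exists d, cdiff f u d.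
  by move=> zw u uz; apply: fh; apply: le_lt_trans (nc_tri z _ _) _; lra.
rewrite -(ler_pM2l p0) -{1}(nc_scalar p0) -ncM mulrBr.
rewrite -(cauchy_dquot r80 (disc x xw)) -(cauchy_dquot r80 (disc y yw)) -cintB;
  [|by move=> t tp; apply: circle_quot_rcont => //; apply: rcont_circle_quot => //; exact: disc..].
under [cint _ _ _]eq_cint => t _ do rewrite -mulrBl.
apply: le_trans (@cauchy_kernel_bound _ (fun t => _ - _ - (_ - _)) _ (2 * K1 * nc (x - y)) r80 _ _) _.
- by move=> t tp; apply: rcontB; apply: rcont_circle_quot => //; exact: disc.
- move=> t; set c := _ * circ t.
  have -> : f (x + c) - f x - (f (y + c) - f y) =
    (f (x + c) - f (y + c)) - (f x - f y) by ring.
  have cE : nc c = r / 8 by rewrite ncM nc_circ nc_scalar// mulr1.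
  apply: le_trans (ncBD _ _) _.
  have -> : 2 * K1 * nc (x - y) = K1 * nc (x + c - (y + c)) + K1 * nc (x - y).
    by rewrite (_ : x + c - (y + c) = x - y); ring.
  apply: lerD; apply: lip; try lra.
  + have -> : x + c - w = c + (x - w) by ring.
    by apply: le_lt_trans (ncD _ _) _; lra.
  + have -> : y + c - w = c + (y - w) by ring.
    by apply: le_lt_trans (ncD _ _) _; lra.
- rewrite ler_pM2l// le_eqVlt; apply/orP; left; apply/eqP; rewrite /K1; field.
  by rewrite gt_eqF.
Qed.

Lemma cdiff_linear_poly (a b z w : R[i]) :
  cdiff (fun u => a * u + b / 2 * (u - w) ^+ 2) z (a + b * (z - w)).
Proof.
have -> : a + b * (z - w) = (0 * z + a * 1) + (0 * (z - w) ^+ 2 +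
  b / 2 * (2%:R * (z - w) ^+ 1 * (1 - 0))) by field.
apply: cdiffD; apply: cdiffM; [exact: cdiff_cst|exact: cdiff_id|exact: cdiff_cst|].
apply: (@cdiffX _ (fun u => u - w) _ _ 2).
by apply: cdiffB; [exact: cdiff_id|exact: cdiff_cst].
Qed.

(** The mean value inequality for [f] minus a quadratic polynomial. It serves for first order with
    [b = 0] and for second order with [b] the second derivative. *)
Lemma taylor_gen f w h (a b : R[i]) K : 0 <= K ->
  (forall t : R, 0 <= t <= 1 -> exists d, cdiff f (w + t%:C%C * h) d) ->
  (forall t : R, 0 <= t <= 1 ->
    nc (cderiv f (w + t%:C%C * h) - a - b * (t%:C%C * h)) <= K) ->
  nc (f (w + h) - f w - a * h - b / 2 * h ^+ 2) <= K * nc h.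
Proof.
move=> K0 fd fK.
pose g u := f u - (a * u + b / 2 * (u - w) ^+ 2).
have -> : f (w + h) - f w - a * h - b / 2 * h ^+ 2 = g (w + h) - g w.
  by rewrite /g; ring.
have E : w + h - w = h by ring.
rewrite -[X in _ <= K * nc X]E; apply: lip_segment => // t t01; rewrite E.
exists (cderiv f (w + t%:C%C * h) - (a + b * (w + t%:C%C * h - w))).
  by apply: cdiffB; [apply: cdiff_deriv; exact: fd|exact: cdiff_linear_poly].
have := fK t t01; congr (nc _ <= _); ring.
Qed.

Lemma taylor1 f w r S x h : 0 < r -> chol f w r -> cbdd f w r S ->
  nc (x - w) < r / 4 -> nc (x + h - w) < r / 4 ->
  nc (f (x + h) - f x - cderiv f x * h) <= 16 * 32 * S / r ^+ 2 * nc h ^+ 2.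
Proof.
move=> r0 fh fS xw xhw; have S0 := cbdd_ge0 r0 fS.
have K0 : 0 <= 16 * 32 * S / r ^+ 2 by rewrite divr_ge0 ?mulr_ge0 ?exprn_ge0// ltW.
have inside (t : R) : 0 <= t <= 1 -> nc (x + t%:C%C * h - w) < r / 4.
  by move=> t01; have := segment_disc t01 xhw xw; rewrite (addrC x h) addrK.
have := @taylor_gen f x h (cderiv f x) 0 (16 * 32 * S / r ^+ 2 * nc h).
rewrite !mul0r subr0 (_ : 16 * 32 * S / r ^+ 2 * nc h * nc h = 16 * 32 * S / r ^+ 2 * nc h ^+ 2); last by ring.
apply; first by rewrite mulr_ge0 ?nc_ge0.
  by move=> t /inside xr; apply: fh; lra.
move=> t t01; rewrite mul0r subr0; apply: le_trans (deriv_lip r0 fh fS (inside t t01) xw) _.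
rewrite ler_wpM2l// (addrC x) addrK ncM nc_real.
by case/andP: t01 => t0 t1; rewrite ger0_norm// ler_piMl ?nc_ge0.
Qed.

(** Differentiating the Cauchy formula of [cauchy_dquot] in its centre suggests the second
    derivative: [I / (2 * pi)], the same formula applied to the derivative of [f]. *)
Lemma deriv_cdiff_quant f w r S : 0 < r -> chol f w r -> cbdd f w r S ->
  exists d K, 0 <= K /\ forall h, nc h < r / 8 ->
    nc (cderiv f (w + h) - cderiv f w - d * h) <= K * nc h ^+ 2.
Proof.
move=> r0 fh fS; have p0 := two_pi_gt0 (R := R); have S0 := cbdd_ge0 r0 fS.
have r80 : 0 < r / 8 by lra.
have pC : (2 * pi)%:C%C != 0 :> R[i] by rewrite -nc_gt0 nc_scalar.
pose K2 := 16 * 32 * S / r ^+ 2.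
have K20 : 0 <= K2 by rewrite divr_ge0 ?mulr_ge0 ?exprn_ge0// ltW.
pose c t : R[i] := (r / 8)%:C%C * circ t.
have cE t : nc (c t) = r / 8 by rewrite ncM nc_circ nc_scalar// mulr1.
have ww : nc (w - w) < r / 4 by rewrite subrr nc0; lra.
have cw t : nc (w + c t - w) < r / 4 by rewrite addrC addKr cE; lra.
have derc : rconts 0 (2 * pi) (fun t => cderiv f (w + c t) - cderiv f w).
  move=> t _; apply: rcontB; last exact: rcont_cst.
  apply: rcont_circle => // e e0.
  have k0 : 0 < K2 + 1 by lra.
  exists (Num.min (r / 8) (e / (K2 + 1))); first by rewrite lt_min r80 divr_gt0.
  move=> h; rewrite lt_min => /andP[h1]; rewrite ltr_pdivlMr// => h2.
  apply: le_lt_trans (deriv_lip r0 fh fS _ _) _; last 1 first.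
  - rewrite -/(c t) (_ : w + c t + h - (w + c t) = h); last by ring.
    by rewrite -/K2; have := nc_ge0 h; lra.
  - have -> : w + c t + h - w = c t + h by ring.
    by apply: le_lt_trans (ncD _ _) _; rewrite cE; lra.
  - exact: cw.
pose I := cint 0 (2 * pi) (fun t => (cderiv f (w + c t) - cderiv f w) / c t).
exists (I / (2 * pi)%:C%C), (K2 * (32 / r)).
split=> [|h hr]; first by rewrite mulr_ge0// divr_ge0// ltW.
have hw : nc (w + h - w) < r / 4 by rewrite addrC addKr; lra.
have disc z : nc (z - w) < r / 4 -> forall u, nc (u - z) <= r / 8 -> exists d, cdiff f u d.
  by move=> zw u uz; apply: fh; apply: le_lt_trans (nc_tri z _ _) _; lra.
rewrite -(ler_pM2l p0) -{1}(nc_scalar p0) -ncM.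
have -> : (2 * pi)%:C%C * (cderiv f (w + h) - cderiv f w - I / (2 * pi)%:C%C * h) =
  (2 * pi)%:C%C * cderiv f (w + h) - (2 * pi)%:C%C * cderiv f w - h * I.
  by move: pC; move: ((2 * pi)%:C%C : R[i]) => P pC; field.
have c1 := rcont_circle_quot r80 (disc _ hw).
have c2 := rcont_circle_quot r80 (disc _ ww).
rewrite -(cauchy_dquot r80 (disc _ hw)) -(cauchy_dquot r80 (disc _ ww)).
rewrite -cintZ; last by move=> t /derc; exact: circle_quot_rcont.
rewrite -cintB; [|by move=> t tp; apply: circle_quot_rcont; auto..].
rewrite -cintB; last 2 first.
- by move=> t tp; apply: rcontB; apply: circle_quot_rcont; auto.
- by move=> t /derc tp; apply: rcontZ; exact: circle_quot_rcont.
(* The integrand left over is a difference of two first-order Taylor remainders, each quadratic in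
   [h] by [taylor1]. *)
pose T z := f (z + h) - f z - cderiv f z * h.
rewrite (@eq_cint _ _ _ _ (fun t => (T (w + c t) - T w) / c t)); last first.
  move=> t _; rewrite -/(c t) /T; have -> : w + h + c t = w + c t + h by ring.
  by ring.
apply: le_trans (@cauchy_kernel_bound _ (fun t => T (w + c t) - T w) _
  (2 * (K2 * nc h ^+ 2)) r80 _ _) _.
- move=> t tp; rewrite (_ : (fun t => _) = (fun t => ((f (w + h + c t) - f (w + h)) -
    (f (w + c t) - f w)) - h * (cderiv f (w + c t) - cderiv f w))).
    by apply: rcontB; [apply: rcontB; auto|apply: rcontZ; auto].
  apply: funext => s; rewrite /T; have -> : w + h + c s = w + c s + h by ring.
  by ring.
- move=> t; apply: le_trans (ncBD _ _) _; rewrite mulr2n mulrDl mul1r.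
  apply: lerD; apply: (taylor1 r0 fh fS) => //; rewrite -/(c t).
  have -> : w + c t + h - w = c t + h by ring.
  by apply: le_lt_trans (ncD _ _) _; rewrite cE; lra.
- rewrite ler_pM2l// le_eqVlt; apply/orP; left; apply/eqP; field.
  by rewrite gt_eqF.
Qed.

Lemma chol_bounded f w r : 0 < r -> chol f w r ->
  exists r' S, [/\ 0 < r', r' <= r, chol f w r' & cbdd f w r' S].
Proof.
move=> r0 fh; have [|d /cdiff_ccont fc] := fh w; first by rewrite subrr nc0.
have [s s0 hs] := fc _ ltr01; exists (Num.min s r), (nc (f w) + 1).
split; first by rewrite lt_min s0.
- by rewrite ge_min lexx orbT.
- by apply: chol_sub fh; rewrite subrr nc0 add0r ge_min lexx orbT.
- move=> z; rewrite lt_min => /andP[/hs]; rewrite (addrC w) subrK => h1 _.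
  by have := nc_sub (f z) (f w); lra.
Qed.

Lemma cdiff_of_quadratic g z (d : R[i]) r K : 0 < r ->
  (forall h, nc h < r -> nc (g (z + h) - g z - d * h) <= K * nc h ^+ 2) ->
  cdiff g z d.
Proof.
move=> r0 hg e e0; have K0 := normr_ge0 K.
have k0 : 0 < `|K| + 1 by lra.
exists (Num.min r (e / (`|K| + 1))); first by rewrite lt_min r0 divr_gt0.
move=> h; rewrite lt_min => /andP[/hg hh]; rewrite ltr_pdivlMr// => he.
apply: le_trans hh _; rewrite expr2 mulrA ler_wpM2r ?nc_ge0//.
have := ler_wpM2r (nc_ge0 h) (ler_norm K); have := nc_ge0 h; lra.
Qed.

Lemma chol_deriv f w r : chol f w r -> chol (cderiv f) w r.
Proof.
move=> fh z zw; have r0 : 0 < r - nc (z - w) by lra.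
have fz : chol f z (r - nc (z - w)) by apply: chol_sub fh; lra.
have [r' [S [r'0 _ fz' fS]]] := chol_bounded r0 fz.
have [d [K [_ hd]]] := deriv_cdiff_quant r'0 fz' fS.
by exists d; apply: (@cdiff_of_quadratic _ _ _ (r' / 8)) hd; lra.
Qed.

(** The second-order Taylor formula divided by [h]. Difference quotients thus stay holomorphic at
    the centre, so that zeros can be divided out repeatedly. *)
Lemma dquot_cdiff_center f w r : 0 < r -> chol f w r ->
  cdiff (dquot f w) w (cderiv (cderiv f) w / 2).
Proof.
move=> r0 fh0.
have [r' [S [r'0 _ fh fS]]] := chol_bounded r0 fh0.
have S0 := cbdd_ge0 r'0 fS.
have [d [K [K0 hd]]] := deriv_cdiff_quant r'0 fh fS.
have r80 : 0 < r' / 8 by lra.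
have -> : cderiv (cderiv f) w = d.
  exact: cderivE (cdiff_of_quadratic r80 hd).
apply: (@cdiff_of_quadratic _ _ _ (r' / 8) K) => // h hr.
have [->|h0] := eqVneq h 0.
  by rewrite addr0 mulr0 subrr subr0 nc0 expr0n mulr0.
have wh : w + h != w by rewrite -subr_eq0 addrC addKr.
rewrite /dquot eqxx (negbTE wh).
have -> : (f (w + h) - f w) / (w + h - w) - cderiv f w - d / 2 * h =
    (f (w + h) - f w - cderiv f w * h - d / 2 * h ^+ 2) / h.
  by field; rewrite h0.
rewrite ncf ler_pdivrMr ?nc_gt0//.
have ins (t : R) : 0 <= t <= 1 -> nc (t%:C%C * h) <= nc h.
  by case/andP=> t0 t1; rewrite ncM nc_real ger0_norm// ler_piMl ?nc_ge0.
apply: taylor_gen => [|t t01|t t01].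
- by rewrite mulr_ge0 ?exprn_ge0 ?nc_ge0.
- apply: fh; rewrite (addrC w) addrK; apply: le_lt_trans (ins t t01) _.
  by apply: lt_trans hr _; rewrite ltr_pdivrMr// ltr_pMr// ltr1n.
- apply: le_trans (hd _ _) _; first by apply: le_lt_trans (ins t t01) _.
  by rewrite ler_wpM2l// lerXn2r ?nnegrE ?nc_ge0// ins.
Qed.

Lemma chol_dquot f w r : 0 < r -> chol f w r -> chol (dquot f w) w r.
Proof.
move=> r0 fh z zw; have [->|wz] := eqVneq z w.
  by exists (cderiv (cderiv f) w / 2); exact: dquot_cdiff_center r0 fh.
by apply: dquot_cdiff => //; exact: fh.
Qed.

End SecondOrder.

(** * Zeros and limits of holomorphic functions *)

Section Zeros.
Context {R : realType}.
Implicit Types (f g : R[i] -> R[i]) (w z x y h : R[i]) (r S K : R).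

Lemma lip_bdd f w r S x y : 0 < r -> chol f w r -> cbdd f w r S ->
  nc (x - w) < r / 2 -> nc (y - w) < r / 2 ->
  nc (f x - f y) <= 16 * S / r * nc (x - y).
Proof.
move=> r0 fh fS; have S0 := cbdd_ge0 r0 fS.
apply: lip_disc; first by rewrite divr_ge0 ?mulr_ge0// ltW.
  by apply: chol_sub fh; rewrite subrr nc0; lra.
by move=> z /ltW; exact: deriv_bdd.
Qed.

(** The Lipschitz bound covers the inner half of the disc; on the outer half
    [16 / r * nc (z - w) >= 8]. The maximum principle would give [S / r]; what matters is that the
    disc does not shrink and that the factor stays the same under iteration. *)
Lemma dquot_bdd f w r S : 0 < r -> chol f w r -> cbdd f w r S -> f w = 0 ->
  cbdd (dquot f w) w r (16 * S / r).
Proof.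
move=> r0 fh fS f0 z zw; have S0 := cbdd_ge0 r0 fS; rewrite /dquot.
have ww : nc (w - w) < r / 2 by rewrite subrr nc0; lra.
case: eqP => [_|/eqP zw0]; first by apply: deriv_bdd fh fS (ltW ww).
have zw1 : 0 < nc (z - w) by rewrite nc_gt0 subr_eq0.
rewrite ncf ler_pdivrMr//.
have [zs|zb] := ltP (nc (z - w)) (r / 2); first exact: lip_bdd fh fS _ _.
rewrite f0 subr0; apply: le_trans (fS _ zw) _.
have -> : 16 * S / r * nc (z - w) = S * (16 / r * nc (z - w)) by ring.
rewrite ler_peMr// mulrC mulrA ler_pdivlMr//; lra.
Qed.

(* Dividing a zero at [w] out costs a factor [16 / r] in the bound; if this never
   stops, [f] vanishes to infinite order. *)
Lemma zero_factor f w r S : 0 < r -> chol f w r -> cbdd f w r S ->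
  (forall z, nc (z - w) < r / 32 -> f z = 0) \/
  exists m g, [/\ chol g w r, g w != 0 &
    forall z, nc (z - w) < r -> f z = (z - w) ^+ m * g z].
Proof.
move=> r0 fh fS; apply: contrapT => /not_orP[nf nU]; apply: nf => z zw.
have S0 := cbdd_ge0 r0 fS.
have k0 : 0 < 16 / r by rewrite divr_gt0.
have H m : exists g, [/\ chol g w r, cbdd g w r (S * (16 / r) ^+ m) &
    forall z, nc (z - w) < r -> f z = (z - w) ^+ m * g z].
  elim: m => [|m [g [gh gS fg]]].
    by exists f; split=> // [|x _]; rewrite expr0 ?mulr1 ?mul1r.
  have g0 : g w = 0.
    by apply: contrapT => /eqP gw; apply: nU; exists m, g.
  exists (dquot g w); split; first exact: chol_dquot.
    move=> x /(dquot_bdd r0 gh gS g0); rewrite exprS; congr (_ <= _); ring.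
  move=> x xw; rewrite fg// /dquot; case: eqP => [->|/eqP xw0].
    by rewrite g0 subrr exprS mul0r mulr0 mul0r.
  by rewrite g0 subr0 exprSr; field; rewrite subr_eq0.
apply/eqP; rewrite -nc_eq0 eq_le nc_ge0 andbT; apply/ler_addgt0Pr => e e0.
have S1 : 0 < S + 1 by lra.
have [m hm] := half_pow_lt (divr_gt0 e0 S1).
have [g [_ gS fg]] := H m.
rewrite add0r fg; last by lra.
rewrite ncM ncX; apply: le_trans (ler_wpM2l (exprn_ge0 _ (nc_ge0 _)) (gS z _)) _; first lra.
have -> : nc (z - w) ^+ m * (S * (16 / r) ^+ m) = (nc (z - w) * (16 / r)) ^+ m * S.
  by rewrite (exprMn _ (nc (z - w))); ring.
(* On [nc (z - w) < r / 32] each division gains a factor 1/2 over its cost. *)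
have q1 : (nc (z - w) * (16 / r)) ^+ m <= 2^-1 ^+ m.
  have q0 : 0 <= nc (z - w) * (16 / r) by apply: mulr_ge0; rewrite ?nc_ge0 ?ltW.
  rewrite lerXn2r ?nnegrE ?q0 ?invr_ge0//.
  by rewrite mulrA ler_pdivrMr//; lra.
move: hm; rewrite ltr_pdivlMr// => hm.
have : 0 <= 2^-1 ^+ m :> R by rewrite exprn_ge0// invr_ge0.
by have := ler_wpM2r S0 q1; lra.
Qed.

End Zeros.

Section UltraHolomorphic.
Context {R : realType} {T : Type} (U : set_system T) (UU : UltraFilter U).
Implicit Types (g : R[i] -> R[i]) (G : T -> R[i] -> R[i]) (w z : R[i]) (r S : R).

Let UF : ProperFilter U := ultra_proper.

(** The Cauchy estimate bounds the derivatives, so they converge along [U], and the Taylor remainder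
    of [taylor1], uniform in [k], passes to the limit. *)
Lemma ulim_cdiff G g w r S : 0 < r ->
  U [set k | chol (G k) w r] -> U [set k | cbdd (G k) w r S] ->
  (forall z, nc (z - w) < r -> uconv U (G^~ z) (g z)) ->
  exists2 d, cdiff g w d & uconv U (fun k => cderiv (G k) w) d.
Proof.
move=> r0 Gh GS Gg.
have ww : nc (w - w) < r / 4 by rewrite subrr nc0; lra.
have S0 : 0 <= S by have [k /= kS] := filter_ex GS; exact: cbdd_ge0 r0 kS.
have [|d hd] := @ulim_ex _ _ U UU (fun k => cderiv (G k) w) (16 * S / r).
  by apply: filterS (filterI Gh GS) => k /= [h1 h2]; apply: deriv_bdd h1 h2 _ => //; lra.
exists d => //; apply: (@cdiff_of_quadratic _ _ _ _ (r / 4) (16 * 32 * S / r ^+ 2)).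
  by lra.
move=> h hr; have wh : nc (w + h - w) < r / 4 by rewrite (addrC w) addrK.
apply: (@uconv_le _ _ U UU (fun k => G k (w + h) - G k w - cderiv (G k) w * h)).
  apply: uconvB; first by apply: uconvB; apply: Gg; lra.
  by apply: uconvM => //; exact: uconv_const.
by apply: filterS (filterI Gh GS) => k /= [h1 h2]; exact: taylor1 h1 h2 _ _.
Qed.

(** A common bound makes the [G k] Lipschitz with a common constant, so the point of evaluation may
    move with [k]. *)
Lemma ulim_moving G g w r S (x : T -> R[i]) (a : R[i]) : 0 < r ->
  U [set k | chol (G k) w r] -> U [set k | cbdd (G k) w r S] ->
  (forall z, nc (z - w) < r -> uconv U (G^~ z) (g z)) ->
  U [set k | nc (x k - w) < r / 2] -> nc (a - w) < r / 2 -> uconv U x a ->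
  uconv U (fun k => G k (x k)) (g a).
Proof.
move=> r0 Gh GS Gg xr ar xa e e0.
have S0 : 0 <= S by have [k /= kS] := filter_ex GS; exact: cbdd_ge0 r0 kS.
have K0 : 0 <= 16 * S / r by rewrite divr_ge0 ?mulr_ge0// ltW.
pose K := 16 * S / r; rewrite -/K in K0.
have k0 : 0 < e / 2 / (K + 1) by rewrite divr_gt0//; lra.
have e20 : 0 < e / 2 by lra.
have ar' : nc (a - w) < r by lra.
apply: filterS (filterI (filterI Gh GS) (filterI xr (filterI (xa _ k0) (Gg a ar' _ e20)))).
move=> k /= [[h1 h2] [h3 [h4 h5]]].
have := lip_bdd r0 h1 h2 h3 ar; rewrite -/K => h6.
apply: le_lt_trans (nc_tri (G k a) _ _) _.
move: h4; rewrite ltr_pdivlMr; last lra.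
by have := nc_ge0 (x k - a); lra.
Qed.

(* If [G k w --> 0], the mean value property of [1 / G k] gives points of the
   circle where [G k] is at most [3 |G k w|]. *)
Lemma hurwitz G g w r S rho : 0 < rho -> rho <= r / 4 ->
  U [set k | chol (G k) w r] -> U [set k | cbdd (G k) w r S] ->
  (forall z, nc (z - w) < r -> uconv U (G^~ z) (g z)) ->
  U [set k | forall z, nc (z - w) <= rho -> G k z != 0] ->
  (forall z, nc (z - w) = rho -> g z != 0) -> g w != 0.
Proof.
move=> rho0 rhor Gh GS Gg Gn gn; apply/negP => /eqP gw.
have r0 : 0 < r by lra.
have [x hx] : {x : T -> R[i] & forall k, chol (G k) w r ->
    (forall z, nc (z - w) <= rho -> G k z != 0) ->
    nc (x k - w) = rho /\ nc (G k (x k)) <= 3 * nc (G k w)}.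
  apply: (@choice _ _ (fun k x => chol (G k) w r ->
    (forall z, nc (z - w) <= rho -> G k z != 0) ->
    nc (x - w) = rho /\ nc (G k x) <= 3 * nc (G k w))) => k.
  apply: contrapT => /forallNP nx.
  have [kh kn] : chol (G k) w r /\ (forall z, nc (z - w) <= rho -> G k z != 0).
    by split; apply: contrapT => h; apply: (nx w); [move=> /h|move=> _ /h].
  have Gw : G k w != 0 by apply: kn; rewrite subrr nc0 ltW.
  have Gw0 : 0 < nc (G k w) by rewrite nc_gt0.
  have cd z : nc (z - w) <= rho -> exists d, cdiff (fun z => (G k z)^-1) z d.
    move=> zr; have [|d hd] := kh z; first by lra.
    by exists (- d / (G k z) ^+ 2); apply: cdiffV hd; exact: kn.
  (* If the modulus exceeded [3 * nc (G k w)] on the whole circle, [mean_bound] would give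
     [1 <= 2 / 3]. *)
  have : nc (G k w)^-1 <= 2 * (3 * nc (G k w))^-1.
    apply: (@mean_bound _ (fun z => (G k z)^-1) _ rho) => //.
    - by move=> z /andP[_]; exact: cd.
    - by have [|d /cdiff_ccont] := cd w; rewrite ?subrr ?nc0 ?ltW.
    - move=> z zr; rewrite ncV lef_pV2 ?posrE ?nc_gt0 ?kn ?zr ?lexx ?mulr_gt0//.
      by rewrite leNgt; apply/negP => H; apply: (nx z) => _ _; split=> //; exact: ltW.
  rewrite ncV invfM mulrA -[leLHS]mul1r ler_pM2r ?invr_gt0//; lra.
have xr : U [set k | nc (x k - w) = rho /\ nc (G k (x k)) <= 3 * nc (G k w)].
  by apply: filterS (filterI Gh Gn) => k /= [h1 h2]; exact: hx.
have [|a xa] := @ulim_ex _ _ U UU x (rho + nc w).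
  by apply: filterS xr => k /= [<- _]; rewrite -lerBlDr nc_sub.
have aw : nc (a - w) = rho.
  have h := uconvB UU xa (uconv_const UU w).
  apply/eqP; rewrite eq_le; apply/andP; split.
    by apply: (uconv_le UU h); apply: filterS xr => k /= [-> _].
  apply/ler_addgt0Pr => e e0; have [k /= [h1 [h2 _]]] := filter_ex (filterI (h e e0) xr).
  have := nc_sub (x k - w) (a - w); lra.
have := gn a aw; suff -> : g a = 0 by rewrite eqxx.
have h1 : uconv U (fun k => G k (x k)) (g a).
  apply: (ulim_moving r0 Gh GS Gg _ _ xa); last by lra.
  by apply: filterS xr => k /= [-> _]; lra.
have h2 : uconv U (G^~ w) (g w) by apply: Gg; rewrite subrr nc0.
apply/eqP; rewrite -nc_eq0 eq_le nc_ge0 andbT; apply/ler_addgt0Pr => e e0.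
have e60 : 0 < e / 6 by lra.
have e20 : 0 < e / 2 by lra.
have [k /= [[h3 h4] [_ h5]]] := filter_ex (filterI (filterI (h1 _ e20) (h2 _ e60)) xr).
move: h4; rewrite gw subr0 => h4.
by have := nc_sub (g a) (G k (x k)); rewrite ncB; lra.
Qed.

End UltraHolomorphic.

(** * Rescaling and the spherical derivative *)

Section NormalityTools.
Context {R : realType}.
Implicit Types (f g : R[i] -> R[i]) (w z x y h : R[i]) (r S K A L : R).

Lemma natr_inv_lt (e : R) : 0 < e -> exists n, forall k, (n <= k)%N -> k.+1%:R^-1 < e.
Proof.
move=> e0; have [n] := ltr_add_invr e0; rewrite add0r => ne; exists n => k nk.
by apply: le_lt_trans ne; rewrite lef_pV2 ?posrE ?ltr0n// ler_nat.
Qed.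

(** A compactness argument in place of Harnack's inequality for the logarithm of the modulus. The
    disc is the same for every [e], and this is what later frees the Schottky radius from [L]. *)
Lemma zero_free_small (e : R) : 0 < e -> exists2 d : R, 0 < d &
  forall f, chol f 0 1 -> cbdd f 0 1 1 -> (forall z, nc z < 1 -> f z != 0) ->
    nc (f 0) < d -> forall z, nc z < 64^-1 -> nc (f z) <= e.
Proof.
move=> e0; apply: contrapT => nd.
have [fx hfx] : {fx : nat -> (R[i] -> R[i]) * R[i] & forall k,
    [/\ chol (fx k).1 0 1, cbdd (fx k).1 0 1 1,
    forall z, nc z < 1 -> (fx k).1 z != 0, nc ((fx k).1 0) < k.+1%:R^-1 &
    nc (fx k).2 < 64^-1 /\ e < nc ((fx k).1 (fx k).2)]}.
  apply: (@choice _ _ (fun k fx => [/\ chol fx.1 0 1, cbdd fx.1 0 1 1,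
    forall z, nc z < 1 -> fx.1 z != 0, nc (fx.1 0) < k.+1%:R^-1 &
    nc fx.2 < 64^-1 /\ e < nc (fx.1 fx.2)])) => k.
  apply: contrapT => /forallNP nfx; apply: nd; exists k.+1%:R^-1 => //.
  move=> f fh f1 fn f0 z zr; rewrite leNgt; apply/negP => ez.
  by apply: (nfx (f, z)).
have [U [UU Uinf]] := @nat_ultra; have UF : ProperFilter U := ultra_proper.
pose G k := (fx k).1; pose x k := (fx k).2.
have Gh : U [set k | chol (G k) 0 1] by apply: filterE => k; have [] := hfx k.
have G1 : U [set k | cbdd (G k) 0 1 1] by apply: filterE => k; have [] := hfx k.
have [g Gg] : {g : R[i] -> R[i] & forall z, nc (z - 0) < 1 -> uconv U (G^~ z) (g z)}.
  apply: (@choice _ _ (fun z l => nc (z - 0) < 1 -> uconv U (G^~ z) l)) => z.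
  have [z1|] := ltP (nc (z - 0)) 1; last by exists 0.
  have [|l] := @ulim_ex _ _ U UU (G^~ z) 1; last by exists l.
  by apply: filterE => k; have [_ h _ _ _] := hfx k; exact: h.
have g0 : g 0 = 0.
  apply: (uconv_uniq UU (Gg 0 _)); first by rewrite subrr nc0.
  move=> d d0; have [n hn] := natr_inv_lt d0.
  apply: filterS (Uinf n) => k /= nk; rewrite subr0.
  by have [_ _ _ h _] := hfx k; apply: lt_trans h (hn _ nk).
have gh : chol g 0 1.
  move=> z z1; have [||||d hd _] := @ulim_cdiff _ _ U UU G g z (1 - nc (z - 0)) 1.
  - by lra.
  - by apply: filterS Gh => k /=; apply: chol_sub; lra.
  - by apply: filterS G1 => k /=; apply: cbdd_sub; lra.
  - by move=> y yz; apply: Gg; apply: le_lt_trans (nc_tri z _ _) _; lra.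
  by exists d.
have gb : cbdd g 0 1 1.
  move=> z z1; apply: (uconv_le UU (Gg z z1)).
  by apply: filterS G1 => k /=; apply.
(* If [g] vanishes on the disc of radius 1/32, it vanishes at the limit of the points [x k], against
   [e < nc (G k (x k))]. Otherwise 0 is an isolated zero of [g], which Hurwitz' theorem forbids. *)
have [gz|[m [V [Vh V0 gV]]]] := zero_factor ltr01 gh gb.
  have xb k : nc (x k) <= 64^-1 by have [_ _ _ _ [h _]] := hfx k; rewrite ltW.
  have [|a xa] := @ulim_ex _ _ U UU x 64^-1; first by apply: filterE => k; exact: xb.
  have a1 : nc a <= 64^-1 by apply: (uconv_le UU xa); apply: filterE => k; exact: xb.
  have : uconv U (fun k => G k (x k)) (g a).
    apply: (ulim_moving UU ltr01 Gh G1 Gg _ _ xa); last by rewrite subr0; lra.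
    by apply: filterE => k /=; rewrite subr0; have := xb k; lra.
  rewrite gz ?subr0; last by lra.
  move=> /(_ e e0) H; have [k /=] := filter_ex H; rewrite subr0.
  by have [_ _ _ _ [_]] := hfx k; rewrite /G /x; lra.
have [|d /cdiff_ccont Vc] := Vh 0; first by rewrite subrr nc0.
have V0' : 0 < nc (V 0) by rewrite nc_gt0.
have [s s0 hs] := Vc _ V0'.
pose rho := Num.min (s / 2) 8^-1.
have rho0 : 0 < rho by rewrite lt_min; apply/andP; split; lra.
have rs : rho <= s / 2 by rewrite ge_min lexx.
have r8 : rho <= 8^-1 by rewrite ge_min lexx orbT.
clearbody rho.
have r4 : rho <= 1 / 4 by lra.
have := hurwitz UU rho0 r4 Gh G1 Gg.
rewrite g0 eqxx => H; suff : false by []; apply: H.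
  apply: filterE => k /= z; rewrite subr0 => zr; have [_ _ h _ _] := hfx k.
  by apply: h; lra.
move=> z zr; rewrite gV; last by lra.
rewrite mulf_neq0// ?expf_neq0//; first by rewrite -nc_gt0 zr.
move: zr; rewrite subr0 => zr.
have : nc (V (0 + z) - V 0) < nc (V 0) by apply: hs; lra.
by rewrite add0r; apply: contraTneq => ->; rewrite sub0r ncN ltxx.
Qed.

(* A bound [A (1 + |f|^2)] on [|f'|] makes this function [A]-Lipschitz, and it is
   small exactly where [|f|] is large. *)
Definition sph f z : R := (1 + nc (f z) ^+ 2)^-1.

(** The derivative of 1 / (1 + t^2) is at most 1 / (1 + t^2) in modulus because
    [2 * t <= 1 + t ^+ 2]; this factor cancels the one in the hypothesis. The proof does this with
    finite differences and bisection along the segment. *)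
Lemma sph_lip f x z A : 0 <= A ->
  (forall t : R, 0 <= t <= 1 -> exists2 d, cdiff f (x + t%:C%C * (z - x)) d &
    nc d <= A * (1 + nc (f (x + t%:C%C * (z - x))) ^+ 2)) ->
  `|sph f z - sph f x| <= A * nc (z - x).
Proof.
move=> A0 fd.
have := @lip_of_local _ (fun t => (sph f (x + t%:C%C * (z - x)))%:C%C) (A * nc (z - x)).
rewrite mul1r mul0r addr0 (addrC x) subrK -raddfB nc_real; apply.
  by rewrite mulr_ge0 ?nc_ge0.
move=> t t01 e e0; have [d fdd dA] := fd t t01; have N0 := nc_ge0 (z - x).
set p := x + t%:C%C * (z - x) in fdd dA *.
have N1 : 0 < nc (z - x) + 1 by lra.
pose e' := e / (nc (z - x) + 1).
have e'0 : 0 < e' by rewrite divr_gt0.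
have e'E : e' * (nc (z - x) + 1) = e by rewrite divfK// gt_eqF.
have e40 : 0 < e' / 4 by lra.
pose eta := Num.min 1 (e' / (4 * (A + 1))).
have eta0 : 0 < eta by rewrite lt_min ltr01 divr_gt0// mulr_gt0//; lra.
have eta1 : eta <= 1 by rewrite ge_min lexx.
have etaA : A * eta <= e' / 4.
  have : eta <= e' / (4 * (A + 1)) by rewrite ge_min lexx orbT.
  rewrite ler_pdivlMr; last lra.
  by move=> h; lra.
clearbody eta; clearbody e'.
have [r r0 hr] := fdd _ e40; have [s s0 hs] := cdiff_ccont fdd eta0.
have m0 : 0 < Num.min r s by rewrite lt_min r0.
exists (Num.min r s / (nc (z - x) + 1)); first by rewrite divr_gt0.
move=> t' t'01; rewrite ltr_pdivlMr// => tt.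
pose h := (t' - t)%:C%C * (z - x).
have hE : nc h = `|t' - t| * nc (z - x) by rewrite ncM nc_real.
have T0 := normr_ge0 (t' - t).
have : nc h < Num.min r s by rewrite hE; lra.
rewrite lt_min => /andP[/hr h1 /hs h2].
have -> : x + t'%:C%C * (z - x) = p + h.
  rewrite /h /p; have -> : (t' - t)%:C%C = t'%:C%C - t%:C%C :> R[i] by rewrite raddfB.
  by ring.
rewrite -raddfB nc_real /sph; set a := nc (f p) in dA *; set b := nc (f (p + h)).
have a0 : 0 <= a := nc_ge0 _; have b0 : 0 <= b := nc_ge0 _.
have ab1 : `|b - a| <= nc (f (p + h) - f p).
  by rewrite ler_norml; apply/andP; split; have := nc_sub (f (p + h)) (f p);
    have := nc_sub (f p) (f (p + h)); rewrite (ncB (f p)) -/a -/b; lra.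
have ab2 : nc (f (p + h) - f p) <= (A * (1 + a ^+ 2) + e' / 4) * nc h.
  have -> : f (p + h) - f p = d * h + (f (p + h) - f p - d * h) by ring.
  apply: le_trans (ncD _ _) _; rewrite ncM mulrDl; apply: lerD => //.
  by rewrite ler_wpM2r ?nc_ge0.
have qa : 1 <= 1 + a ^+ 2 by rewrite lerDl sqr_ge0.
have qb : 1 <= 1 + b ^+ 2 by rewrite lerDl sqr_ge0.
have qa0 : 0 < 1 + a ^+ 2 by lra.
have qb0 : 0 < 1 + b ^+ 2 by lra.
have -> : (1 + b ^+ 2)^-1 - (1 + a ^+ 2)^-1 =
    (a - b) * ((a + b) / (1 + b ^+ 2)) / (1 + a ^+ 2).
  by field; rewrite !gt_eqF.
have ia0 : 0 <= (1 + a ^+ 2)^-1 by rewrite invr_ge0 ltW.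
rewrite normrM (ger0_norm ia0) ler_pdivrMr// normrM (distrC a).
have c1 : `|(a + b) / (1 + b ^+ 2)| <= 1 + eta.
  rewrite ger0_norm; last by apply: divr_ge0; lra.
  rewrite ler_pdivrMr//.
  have : `|b - a| < eta by apply: le_lt_trans ab1 h2.
  rewrite ltr_norml => /andP[l1 l2].
  have : 0 <= (b - 1) ^+ 2 by rewrite sqr_ge0.
  have : 0 <= eta * b ^+ 2 by rewrite mulr_ge0 ?sqr_ge0 ?ltW.
  by rewrite sqrrB expr1n; lra.
have H0 := nc_ge0 h.
have B0 : 0 <= (A * (1 + a ^+ 2) + e' / 4) * nc h.
  by apply: le_trans ab2; exact: nc_ge0.
apply: le_trans (ler_pM _ _ (le_trans ab1 ab2) c1) _ => //.
have -> : (A * nc (z - x) + e) * `|t' - t| * (1 + a ^+ 2) =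
   (A * nc h + e * `|t' - t|) * (1 + a ^+ 2) by rewrite hE; ring.
have k1 : (e' * nc h) * (1 + a ^+ 2) <= e * `|t' - t| * (1 + a ^+ 2).
  rewrite ler_wpM2r ?(ltW qa0)// hE -e'E.
  have : 0 <= e' * `|t' - t| by rewrite mulr_ge0// ltW.
  lra.
apply: (@le_trans _ _ ((A + e') * nc h * (1 + a ^+ 2))); last by lra.
have e1 : (A * (1 + a ^+ 2) + e' / 4) * (1 + eta) <= (A + e') * (1 + a ^+ 2).
  have f1 : A * eta * (1 + a ^+ 2) <= e' / 4 * (1 + a ^+ 2) by rewrite ler_wpM2r// ltW.
  have f2 : e' / 4 * eta <= e' / 4 * 1 by rewrite ler_wpM2l// ltW.
  have f3 : e' * 1 <= e' * (1 + a ^+ 2) by rewrite ler_wpM2l// ltW.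
  lra.
by have := ler_wpM2r H0 e1; lra.
Qed.

End NormalityTools.

Section Rescaling.
Context {R : realType}.
Implicit Types (f g G : R[i] -> R[i]) (w z x y h : R[i]) (r S K A L : R).

Definition sph_bdd f w r A := forall z, nc (z - w) < r ->
  nc (cderiv f z) <= A * (1 + nc (f z) ^+ 2).

Lemma rescale_chol f w r s : 0 < s -> chol f w (s * r) ->
  chol (fun u => f (w + s%:C%C * u)) 0 r.
Proof.
move=> s0 fh u; rewrite subr0 => ur.
have [|d hd] := fh (w + s%:C%C * u).
  by rewrite addrC addKr ncM nc_scalar// ltr_pM2l.
by exists (s%:C%C * d); exact: cdiff_affine.
Qed.

Lemma rescale_deriv f w s u : (exists d, cdiff f (w + s%:C%C * u) d) ->
  cderiv (fun u => f (w + s%:C%C * u)) u = s%:C%C * cderiv f (w + s%:C%C * u).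
Proof. by move=> /cdiff_deriv hd; apply: cderivE; exact: cdiff_affine. Qed.

(** At modulus 3 [sph] is 1/10, at modulus 1 it is 1/2, and [1 / 10 + 2 / 5 = 1 / 2]. *)
Lemma sph_away f z w r A : 0 < r -> 0 <= A -> A * r <= 2 / 5 ->
  chol f z r -> sph_bdd f z r A -> 3 <= nc (f z) -> nc (w - z) < r -> 1 <= nc (f w).
Proof.
move=> r0 A0 Ar fh fA fz wr.
have : `|sph f w - sph f z| <= A * nc (w - z).
  apply: sph_lip => // t t01.
  have h : nc (z + t%:C%C * (w - z) - z) < r.
    by apply: segment_disc => //; rewrite subrr nc0.
  by exists (cderiv f (z + t%:C%C * (w - z))); [exact: chol_cdiff h|exact: fA].
have : A * nc (w - z) <= A * r by rewrite ler_wpM2l// ltW.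
move=> h1 h2; have {h2}h3 : `|sph f w - sph f z| <= 2 / 5 by lra.
have h4 : sph f z <= 10^-1.
  rewrite /sph lef_pV2 ?posrE//; last by rewrite ltr_wpDr ?sqr_ge0.
  have : 3 * 3 <= nc (f z) * nc (f z) by rewrite ler_pM.
  by rewrite expr2; lra.
have h5 : sph f w <= 2^-1 by move: h3; rewrite ler_norml => /andP[_]; lra.
move: h5; rewrite /sph lef_pV2 ?posrE//; last by rewrite ltr_wpDr ?sqr_ge0.
move=> h5; have : 1 ^+ 2 <= nc (f w) ^+ 2 by rewrite expr1n; lra.
by rewrite ler_pXn2r ?nnegrE ?nc_ge0.
Qed.

Lemma chol_inv f w r : chol f w r -> (forall z, nc (z - w) < r -> f z != 0) ->
  chol (fun z => (f z)^-1) w r.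
Proof.
move=> fh fn z zw; have [d hd] := fh z zw.
by exists (- d / f z ^+ 2); apply: cdiffV hd; exact: fn.
Qed.

(** Suppose [f] is very large at a point [z] near [w]. On a disc around [z] whose radius depends on
    [A] only, [1 / f] has no zero and is bounded by 1, so its smallness at [z] spreads to [w] by
    [zero_free_small], against [nc (f w) <= L]. *)
Lemma spherical_schottky A : 0 <= A -> exists2 s : R, 0 < s <= 1 &
  forall L, exists L', forall f w, chol f w 1 -> sph_bdd f w 1 A ->
    nc (f w) <= L -> cbdd f w s L'.
Proof.
move=> A0; have A1 : 0 < A + 1 by lra.
pose r := Num.min 2^-1 (2 / 5 / (A + 1)).
have r0 : 0 < r by rewrite lt_min invr_gt0 ltr0n divr_gt0.
have r2 : r <= 2^-1 by rewrite ge_min lexx.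
have rA : r * (A + 1) <= 2 / 5 by rewrite -ler_pdivlMr// ge_min lexx orbT.
clearbody r; exists (r / 64) => [|L]; first by apply/andP; split; lra.
have l1 : 0 < `|L| + 1 by rewrite ltr_wpDl.
have e0 : 0 < (2 * (`|L| + 1))^-1 by rewrite invr_gt0 mulr_gt0.
have [d d0 hd] := zero_free_small e0.
exists (Num.max 3 (d^-1 + 1)) => f w fh fA fw z zr; rewrite leNgt; apply/negP.
rewrite gt_max => /andP[fz3 fzd].
have sub y : nc (y - z) < r -> nc (y - w) < 1.
  by move=> yz; apply: le_lt_trans (nc_tri z _ _) _; lra.
have f1 y : nc (y - z) < r -> 1 <= nc (f y).
  apply: sph_away A0 _ _ _ (ltW fz3) => //; first by lra.
    by move=> u /sub /fh.
  by move=> u /sub /fA.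
have f0 y : nc (y - z) < r -> f y != 0 by move=> /f1; rewrite -nc_gt0; lra.
have fzr : chol (fun y => (f y)^-1) z r.
  by apply: chol_inv => //; move=> u /sub /fh.
pose W u := (f (z + r%:C%C * u))^-1.
have in1 u : nc u < 1 -> nc (z + r%:C%C * u - z) < r.
  by move=> u1; rewrite addrC addKr ncM nc_scalar// gtr_pMr.
have rC : r%:C%C != 0 :> R[i] by rewrite -nc_gt0 nc_scalar.
have : nc (W ((w - z) / r%:C%C)) <= (2 * (`|L| + 1))^-1.
  apply: hd.
  - by apply: (@rescale_chol (fun y => (f y)^-1)) => //; rewrite mulr1.
  - by move=> u; rewrite subr0 => /in1/f1 h; rewrite ncV invf_le1//; lra.
  - by move=> u /in1/f0 h; rewrite invr_eq0.
  - rewrite /W mulr0 addr0 ncV -[ltRHS]invrK ltf_pV2 ?posrE ?invr_gt0//; lra.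
  - by rewrite ncf nc_scalar// ltr_pdivrMr// ncB mulrC.
rewrite /W mulrC divfK// addrC subrK ncV lef_pV2 ?posrE ?mulr_gt0//.
  by have := ler_norm L; lra.
by rewrite nc_gt0 f0// ncB; lra.
Qed.

(* If [|G' 0|^2] dominates [|G 0|], there is a zero near [- G 0 / G' 0], where [G']
   is still comparable with [G' 0]: otherwise the mean value property of [1 / G]
   on the circle around that point through [0] would fail. *)
Lemma multiple_zeros_bound : exists2 C : R, 0 < C & forall (eta : R) G, 0 <= eta ->
  chol G 0 1 -> cbdd G 0 1 1 ->
  (forall z, nc z < 1 -> G z = 0 -> nc (cderiv G z) <= eta) ->
  nc (cderiv G 0) ^+ 2 <= C * nc (G 0) \/ nc (cderiv G 0) <= 2 * eta.
Proof.
have [K K64 hK] : exists2 K, 64 <= K & forall G, chol G 0 1 -> cbdd G 0 1 1 ->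
    forall z, nc z < 1 / 4 -> nc (cderiv G z - cderiv G 0) <= K * nc z /\
      nc (G z - G 0 - cderiv G 0 * z) <= K * nc z ^+ 2.
  exists (16 * 32 * 1 / 1 ^+ 2) => [|G Gh G1 z z4].
    by rewrite expr1n divr1 mulr1; lra.
  have o4 : nc (0 - 0 : R[i]) < 1 / 4 by rewrite subrr nc0; lra.
  have z4' : nc (z - 0) < 1 / 4 by rewrite subr0.
  have z4'' : nc (0 + z - 0) < 1 / 4 by rewrite add0r.
  split; first by have := deriv_lip ltr01 Gh G1 z4' o4; rewrite subr0.
  by have := taylor1 ltr01 Gh G1 o4 z4''; rewrite add0r.
exists (16 * K) => [|eta G eta0 Gh G1 Gn]; first by lra.
apply: contrapT => /not_orP[/negP n1 /negP n2].
move: n1 n2; rewrite -!ltNge => n1 n2.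
have {}hK := hK G Gh G1.
have d16 : nc (cderiv G 0) <= 16.
  have := @deriv_bdd _ G 0 1 1 0 ltr01 Gh G1; rewrite subrr nc0 !divr1 mulr1.
  by apply; lra.
have d0 : 0 < nc (cderiv G 0) by lra.
have a0 : 0 < nc (G 0).
  rewrite nc_gt0; apply/eqP => G0; have := Gn 0; rewrite nc0 => /(_ ltr01 G0); lra.
set d := cderiv G 0 in n1 n2 d16 d0 hK *; set a := G 0 in n1 a0 hK *.
(* [x] is the Newton step. Since [nc d ^+ 2 > 16 * K * nc a], on the disc of radius [t] around [x],
   where [nc z <= 2 * t], the Taylor error [K * (2 * t) ^+ 2] is at most [nc a / 4]. *)
have dn0 : d != 0 by rewrite -nc_gt0.
pose x := - a / d; pose t := nc x.
have tE : t * nc d = nc a by rewrite /t /x ncf ncN divfK// gt_eqF.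
have t0 : 0 < t by rewrite -(pmulr_lgt0 _ d0) tE.
have td : 16 * K * t < nc d.
  by rewrite -(ltr_pM2r d0) -[_ * nc d]mulrA tE -expr2.
have tK : 16 * K * t < 16 by lra.
have t8 : 2 * t < 1 / 4.
  have : 64 * t <= K * t by rewrite ler_wpM2r// ltW.
  lra.
have near z : nc (z - x) <= t -> nc z <= 2 * t.
  by move=> zx; have := ncD (z - x) x; rewrite subrK -/t; lra.
have [[z zx Gz]|nz] := EM (exists2 z, nc (z - x) <= t & G z = 0).
  have z2 := near z zx.
  have [|h1 _] := hK z; first by lra.
  have h2 := Gn z ltac:(lra) Gz.
  have h3 : K * nc z <= K * (2 * t) by rewrite ler_wpM2l//; lra.
  by have := nc_sub d (cderiv G z); rewrite ncB; lra.
have Gnz z : nc (z - x) <= t -> G z != 0.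
  by move=> zx; apply/eqP => Gz; apply: nz; exists z.
have quad z : nc (z - x) <= t -> nc (G z - d * (z - x)) <= nc a / 4.
  move=> /near z2; have [|_ h1] := hK z; first by lra.
  have -> : G z - d * (z - x) = G z - a - d * z by rewrite /x; field.
  apply: le_trans h1 _.
  have : nc z ^+ 2 <= (2 * t) ^+ 2 by rewrite lerXn2r ?nnegrE ?nc_ge0//; lra.
  have : 16 * K * t * t <= nc d * t by rewrite ler_wpM2r// ltW.
  rewrite (mulrC (nc d)) tE exprMn !expr2 => h2 h3.
  have : K * (nc z * nc z) <= K * (2 * 2 * (t * t)) by rewrite ler_wpM2l//; lra.
  lra.
have cd z : nc (z - x) <= t -> exists d, cdiff (fun z => (G z)^-1) z d.
  move=> zx; have [|d' hd] := Gh z; first by rewrite subr0; have := near z zx; lra.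
  by exists (- d' / (G z) ^+ 2); apply: cdiffV hd; exact: Gnz.
(* On the circle [nc (G z) >= 3 / 4 * nc a], while [nc (G x) <= nc a / 4] at the centre: the
   inequality would read [4 <= 8 / 3] after multiplication by [nc a]. *)
have : nc (G x)^-1 <= 2 * (3 / 4 * nc a)^-1.
  apply: (@mean_bound _ (fun z => (G z)^-1) _ t) => //.
  - by move=> z /andP[_]; exact: cd.
  - by have [|d' /cdiff_ccont] := cd x; rewrite ?subrr ?nc0 ?ltW.
  - move=> z zx; have zx' : nc (z - x) <= t by rewrite zx.
    rewrite ncV lef_pV2 ?posrE ?nc_gt0 ?Gnz// ?mulr_gt0//.
    have := quad z zx'; have := nc_sub (d * (z - x)) (G z).
    by rewrite ncB ncM zx mulrC tE; lra.
have xx : nc (x - x) <= t by rewrite subrr nc0 ltW.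
have := quad x xx; rewrite subrr mulr0 subr0 => h1.
have gx0 : 0 < nc (G x) by rewrite nc_gt0 Gnz.
rewrite ncV invfM -(ler_pM2r gx0) mulVf ?gt_eqF//.
have : (nc a)^-1 * nc (G x) <= 4^-1 by rewrite mulrC ler_pdivrMr//; lra.
have : 0 <= (nc a)^-1 * nc (G x) by rewrite mulr_ge0 ?invr_ge0 ?ltW.
rewrite invfM invrK; lra.
Qed.

(* Otherwise iterate: the points [z] with doubling values of [N] accumulate at a
   point where [N] is not locally bounded. *)
Lemma doubling (N : R[i] -> R) (z0 : R[i]) (rho : R) : 0 < rho -> 0 < N z0 ->
  (forall z, nc (z - z0) <= 2 * rho / N z0 -> exists2 d : R, 0 < d &
    exists B, forall z', nc (z' - z) < d -> N z' <= B) ->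
  exists z, [/\ nc (z - z0) <= 2 * rho / N z0, N z0 <= N z &
    forall z', nc (z' - z) <= rho / N z -> N z' <= 2 * N z].
Proof.
move=> rho0 N0 Nb; apply: contrapT => nz.
have [f hf] : {f : R[i] -> R[i] & forall z, nc (z - z0) <= 2 * rho / N z0 ->
    N z0 <= N z -> nc (f z - z) <= rho / N z /\ 2 * N z < N (f z)}.
  apply: (@choice _ _ (fun z z' => nc (z - z0) <= 2 * rho / N z0 ->
    N z0 <= N z -> nc (z' - z) <= rho / N z /\ 2 * N z < N z')) => z.
  have [zz|?] := EM (nc (z - z0) <= 2 * rho / N z0); last by exists z.
  have [Nz|?] := EM (N z0 <= N z); last by exists z.
  apply: contrapT => /forallNP nz'; apply: nz; exists z; split=> // z' h.
  by rewrite leNgt; apply/negP => h'; apply: (nz' z').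
pose x n := iter n f z0.
pose c := rho / N z0; have c0 : 0 < c by rewrite divr_gt0.
have cE : 2 * rho / N z0 = 2 * c by rewrite /c mulrA.
rewrite cE in hf Nb.
(* Step number [n] has length at most [c * 2^-1 ^+ n], a geometric series with sum [2 * c]. *)
have H n : nc (x n - z0) <= 2 * c - 2 * c * 2^-1 ^+ n /\ N z0 * 2 ^+ n <= N (x n).
  elim: n => [|n [IH1 IH2]]; first by rewrite !expr0 subrr nc0 !mulr1 subrr.
  have p0 : 0 < (2 : R) ^+ n by rewrite exprn_gt0.
  have q0 : 0 < (2^-1 : R) ^+ n by rewrite exprn_gt0// invr_gt0.
  have cq : 0 < c * 2^-1 ^+ n by rewrite mulr_gt0.
  have Nx : N z0 <= N (x n).
    by apply: le_trans IH2; rewrite ler_peMr ?(ltW N0)// exprn_ege1// ler1n.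
  have [|//|h1 h2] := hf (x n); first by lra.
  rewrite -/(x n.+1) in h1 h2; split; last by rewrite exprSr; lra.
  apply: le_trans (nc_tri (x n) _ _) _.
  have : rho / N (x n) <= c * 2^-1 ^+ n.
    rewrite /c -mulrA ler_wpM2l ?(ltW rho0)// exprVn -invfM lef_pV2 ?posrE ?mulr_gt0//.
    by apply: lt_le_trans Nx.
  by rewrite exprSr; lra.
have [U [UU Uinf]] := @nat_ultra; have UF : ProperFilter U := ultra_proper.
have xb n : nc (x n - z0) <= 2 * c.
  have [h _] := H n; have : 0 <= c * 2^-1 ^+ n by rewrite mulr_ge0 ?exprn_ge0 ?invr_ge0 ?ltW.
  by lra.
have [|a xa] := @ulim_ex _ _ U UU x (2 * c + nc z0).
  by apply: filterE => n /=; have := nc_sub (x n) z0; have := xb n; lra.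
have az : nc (a - z0) <= 2 * c.
  by apply: (uconv_le UU (uconvB UU xa (uconv_const UU z0))); exact: filterE.
have [d d0 [B hB]] := Nb a az.
have B1 : 0 < `|B| + 1 by rewrite ltr_wpDl.
have [m hm] := half_pow_lt (divr_gt0 N0 B1).
have [k /= [h1 mk]] := filter_ex (filterI (xa d d0) (Uinf m)).
have h2 := hB _ h1; have [_ h3] := H k.
have : N z0 * 2 ^+ m <= N z0 * 2 ^+ k by rewrite ler_wpM2l ?(ltW N0)// ler_eXn2l ?ltr1n.
move: hm; rewrite ltr_pdivlMr// exprVn mulrC ltr_pdivrMr ?exprn_gt0//.
by have := ler_norm B; lra.
Qed.

End Rescaling.

(** * Entire functions and their quotients *)

Section EntireFunctions.
Context {R : realType}.
Implicit Types (f g u v G : R[i] -> R[i]) (w z x y h a b c : R[i]) (r S K A L : R).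

Definition entire f := forall z, exists d, cdiff f z d.

Lemma entire_chol f w r : entire f -> chol f w r.
Proof. by move=> fe z _; exact: fe. Qed.

Lemma deriv_eq0_cst f : entire f -> (forall z, cderiv f z = 0) -> forall x y, f x = f y.
Proof.
move=> fe f0 x y; apply/eqP; rewrite -subr_eq0 -nc_eq0 eq_le nc_ge0 andbT.
rewrite -(mul0r (nc (x - y))); apply: lip_segment => // t _.
by exists 0; [rewrite -(f0 (y + t%:C%C * (x - y))); exact: cdiff_deriv|rewrite nc0].
Qed.

Lemma liouville f S : entire f -> (forall z, nc (f z) <= S) -> forall z, cderiv f z = 0.
Proof.
move=> fe fS z; have S0 : 0 <= S := le_trans (nc_ge0 _) (fS z).
apply/eqP; rewrite -nc_eq0 eq_le nc_ge0 andbT.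
apply/ler_addgt0Pr => e e0; rewrite add0r.
have r0 : 0 < (4 * S + 1) / e by rewrite divr_gt0//; lra.
apply: le_trans (@cauchy_estimate _ f z _ S r0 _ _) _; [by move=> x _; exact: fe|by []|].
by rewrite ler_pdivrMr// [leRHS]mulrC divfK ?gt_eqF//; lra.
Qed.

Lemma ccont_near_neq0 f z : ccont f z -> f z != 0 ->
  exists2 r : R, 0 < r & forall y, nc (y - z) < r -> f y != 0.
Proof.
move=> fc fz; have f0 : 0 < nc (f z) by rewrite nc_gt0.
have [r r0 hr] := fc _ f0; exists r => // y /hr; rewrite (addrC z) subrK.
by apply: contraTneq => ->; rewrite sub0r ncN ltxx.
Qed.

Lemma small_point r : 0 < r -> exists2 h : R[i], h != 0 & nc h < r.
Proof.
move=> r0; exists (r / 2)%:C%C; last by rewrite nc_scalar; lra.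
by rewrite -nc_gt0 nc_scalar; lra.
Qed.

(** Both functions are a power of [z - z0] times a factor that does not vanish at [z0]. The
    domination of [u] by [v] forces the order of [u] to be at least that of [v], so the powers
    cancel to a nonnegative exponent. *)
Lemma local_quotient u v C z0 : entire u -> entire v ->
  (forall z, nc (u z) <= C * nc (v z)) ->
  (forall r, exists S, cbdd v z0 r S) -> (exists z, v z != 0) ->
  exists J r, [/\ 0 < r, chol J z0 r,
    (forall z, nc (z - z0) < r -> u z = J z * v z) &
    forall z, nc (z - z0) < r -> z != z0 -> v z != 0].
Proof.
move=> ue ve uv vb [z1 vz1].
have C0 : 0 <= C.
  have v0 : 0 < nc (v z1) by rewrite nc_gt0.
  by rewrite -(pmulr_lge0 _ v0); apply: le_trans (uv z1); exact: nc_ge0.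
(* The radius is so large that [r / 32] reaches [z1], where [v] does not vanish; this stands in for
   the identity theorem. *)
have r0 : 0 < 32 * (nc (z1 - z0) + 1) by have := nc_ge0 (z1 - z0); lra.
have [S vS] := vb (32 * (nc (z1 - z0) + 1)).
have [v0|[m [V [Vh V0 vE]]]] := zero_factor r0 (entire_chol (w := z0) (r := _) ve) vS.
  by move: vz1; rewrite v0 ?eqxx//; lra.
have zz r : 0 < r -> nc (z0 - z0) < r by rewrite subrr nc0.
have [d /cdiff_ccont Vc] := Vh z0 (zz _ r0).
have [rV rV0 hV] := ccont_near_neq0 Vc V0.
set r1 := 32 * _ in r0 vS vE Vh.
have vn z : nc (z - z0) < Num.min rV r1 -> z != z0 -> v z != 0.
  rewrite lt_min => /andP[z1' z2] zn; rewrite vE// mulf_neq0 ?hV// expf_neq0//.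
  by rewrite subr_eq0.
have [r2 [S2 [r20 _ uh uS]]] := chol_bounded (@ltr01 R) (entire_chol (w := z0) (r := _) ue).
have [u0|[p [W [Wh W0 uE]]]] := zero_factor r20 uh uS.
  exists (fun=> 0), (Num.min (r2 / 32) (Num.min rV r1)); split.
  - by rewrite !lt_min rV0 r0 !andbT; lra.
  - by move=> z _; exists 0; exact: cdiff_cst.
  - by move=> z; rewrite lt_min => /andP[/u0 -> _]; rewrite mul0r.
  - by move=> z; rewrite lt_min => /andP[_]; exact: vn.
have mp : (m <= p)%N.
  rewrite leqNgt; apply/negP => pm.
  have [d' /cdiff_ccont Wc] := Wh z0 (zz _ r20).
  have W0' : 0 < nc (W z0) / 2 by rewrite divr_gt0// nc_gt0.
  have [s1 s10 h1] := Wc _ W0'; have [s2 s20 h2] := Vc _ (@ltr01 R).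
  (* If [p < m], then at a point [h] of this size [nc (W z0) / 2 < nc (W (z0 + h)) <= k * nc h < nc
     (W z0) / 2]. *)
  pose k := C * (nc (V z0) + 1) + 1.
  have k1 : 1 <= k.
    by rewrite /k lerDr mulr_ge0//; have := nc_ge0 (V z0); lra.
  pose s := Num.min (Num.min s1 s2) (Num.min (Num.min r1 r2)
    (Num.min 1 (nc (W z0) / 2 / k))).
  have s0 : 0 < s.
    by rewrite !lt_min s10 s20 r0 r20 ltr01 divr_gt0//; lra.
  have [h hn] := small_point s0.
  rewrite !lt_min => /andP[/andP[/h1 hs1 /h2 hs2]] /andP[/andP[hr1 hr2] /andP[hh1 hk]].
  have := uv (z0 + h); rewrite uE ?vE ?[z0 + h]addrC ?addrK// ?(addrC h).
  rewrite !ncM !ncX -(subnKC (ltnW pm)) exprD.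
  have hn0 : 0 < nc h by rewrite nc_gt0.
  have hp0 : 0 < nc h ^+ p by rewrite exprn_gt0.
  rewrite -mulrA mulrCA ler_pM2l//.
  have mp0 : (0 < m - p)%N by rewrite subn_gt0.
  have q1 : nc h ^+ (m - p) <= nc h.
    by rewrite -[leRHS]expr1; apply: ler_wiXn2l => //; exact: ltW.
  have w1 : nc (W z0) / 2 < nc (W (z0 + h)).
    by have := nc_sub (W z0) (W (z0 + h)); rewrite ncB; lra.
  have v1 : nc (V (z0 + h)) <= nc (V z0) + 1.
    by have := nc_sub (V (z0 + h)) (V z0); lra.
  have q0 : 0 <= nc h ^+ (m - p) by rewrite exprn_ge0// ltW.
  have q2 : nc h ^+ (m - p) * nc (V (z0 + h)) <= nc h * (nc (V z0) + 1).
    by rewrite ler_pM// nc_ge0.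
  have q3 := ler_wpM2l C0 q2.
  move: hk; rewrite ltr_pdivlMr; last by lra.
  by rewrite /k; lra.
pose J z := (z - z0) ^+ (p - m) * (W z / V z).
exists J, (Num.min r2 (Num.min rV r1)); split.
- by rewrite !lt_min rV0 r0 r20.
- move=> z; rewrite !lt_min => /and3P[zr2 zrV zr1].
  have [d1 hd1] := Wh z zr2; have [d2 hd2] := Vh z zr1.
  eexists; apply: cdiffM.
    by apply: cdiffX; apply: cdiffB; [exact: cdiff_id|exact: cdiff_cst].
  by apply: cdiffM; [exact: hd1|apply: cdiffV hd2; exact: hV].
- move=> z; rewrite !lt_min => /and3P[zr2 zrV zr1].
  rewrite uE// vE// /J -[in LHS](subnK mp) exprD; field.
  exact: hV.
- by move=> z; rewrite lt_min => /andP[_]; exact: vn.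
Qed.

(** Away from its centre a local quotient is determined by [u] and [v], so the values of the local
    quotients at their own centres form one entire function [J]. It is bounded by [C] where [v] does
    not vanish, hence by continuity everywhere, and Liouville's theorem applies. *)
Lemma entire_quotient_cst u v C : entire u -> entire v ->
  (forall z, nc (u z) <= C * nc (v z)) ->
  (forall z r, exists S, cbdd v z r S) -> (exists z, v z != 0) ->
  exists k, forall z, u z = k * v z.
Proof.
move=> ue ve uv vb vn.
have [Jr hJr] : {Jr : R[i] -> (R[i] -> R[i]) * R & forall z0,
    [/\ 0 < (Jr z0).2, chol (Jr z0).1 z0 (Jr z0).2,
    (forall z, nc (z - z0) < (Jr z0).2 -> u z = (Jr z0).1 z * v z) &
    forall z, nc (z - z0) < (Jr z0).2 -> z != z0 -> v z != 0]}.
  apply: (@choice _ _ (fun z0 Jr => [/\ 0 < Jr.2, chol Jr.1 z0 Jr.2,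
    (forall z, nc (z - z0) < Jr.2 -> u z = Jr.1 z * v z) &
    forall z, nc (z - z0) < Jr.2 -> z != z0 -> v z != 0])) => z0.
  have [J [r H]] := local_quotient ue ve uv (vb z0) vn.
  by exists (J, r).
pose J z := (Jr z).1 z.
have uJ z : u z = J z * v z.
  by have [r0 _ h _] := hJr z; apply: h; rewrite subrr nc0.
have Je : entire J.
  move=> z; have [r0 h1 h2 h3] := hJr z.
  have [|d hd] := h1 z; first by rewrite subrr nc0.
  exists d; apply: cdiff_local hd; exists (Jr z).2 => // h hr.
  have zh : nc (z + h - z) < (Jr z).2 by rewrite (addrC z) addrK.
  have [->|hn] := eqVneq (z + h) z; first by [].
  apply: (mulIf (h3 _ zh hn)); by rewrite -h2// uJ.
have JC z : nc (J z) <= C.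
  have [|vz] := eqVneq (v z) 0; last first.
    have v0 : 0 < nc (v z) by rewrite nc_gt0.
    by rewrite -(ler_pM2r v0) -ncM -uJ.
  move=> _; have [r0 _ _ h3] := hJr z.
  apply/ler_addgt0Pr => e e0; have [d /cdiff_ccont Jc] := Je z.
  have [s s0 hs] := Jc e e0.
  have m0 : 0 < Num.min s (Jr z).2 by rewrite lt_min s0.
  have [h hn] := small_point m0; rewrite lt_min => /andP[/hs h1 h2].
  have vzh : v (z + h) != 0.
    by apply: h3; rewrite ?(addrC z) ?addrK// -subr_eq0 addrK.
  have v0 : 0 < nc (v (z + h)) by rewrite nc_gt0.
  have : nc (J (z + h)) <= C by rewrite -(ler_pM2r v0) -ncM -uJ.
  by have := nc_sub (J z) (J (z + h)); rewrite ncB; lra.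
exists (J 0) => z; rewrite uJ; congr (_ * _).
exact: deriv_eq0_cst Je (liouville Je JC) _ _.
Qed.

(** Apply [multiple_zeros_bound] with [eta = 0] to [1 / g], which has no zero on the disc because
    [g] stays away from 0 there. Its derivative [- g' / g ^+ 2] turns the estimate into one with the
    exponent 3. *)
Lemma far_deriv_bound : exists2 C : R, 0 < C & forall g z r A, 0 < r -> 0 <= A ->
  A * r <= 2 / 5 -> chol g z r -> sph_bdd g z r A -> 3 <= nc (g z) ->
  r ^+ 2 * nc (cderiv g z) ^+ 2 <= C * nc (g z) ^+ 3.
Proof.
have [C C0 hC] := @multiple_zeros_bound R.
exists C => // g z r A r0 A0 Ar gh gA gz.
have g1 y : nc (y - z) < r -> 1 <= nc (g y) by exact: sph_away Ar gh gA gz.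
have gn y : nc (y - z) < r -> g y != 0 by move=> /g1; rewrite -nc_gt0; lra.
pose G y := (g (z + r%:C%C * y))^-1.
have in1 y : nc y < 1 -> nc (z + r%:C%C * y - z) < r.
  by move=> y1; rewrite addrC addKr ncM nc_scalar// gtr_pMr.
have zz : nc (z - z) < r by rewrite subrr nc0.
have G'0 : cderiv G 0 = - (r%:C%C * cderiv g z) / g z ^+ 2.
  apply: cderivE; have := @cdiffV _ (fun y => g (z + r%:C%C * y)) 0 (r%:C%C * cderiv g z).
  rewrite mulr0 addr0; apply; first exact: gn.
  by apply: cdiff_affine; rewrite mulr0 addr0; exact: chol_cdiff gh zz.
have [] := hC 0 G (lexx _) _ _ _.
- by apply: (@rescale_chol _ (fun y => (g y)^-1)) => //; rewrite mulr1; exact: chol_inv.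
- by move=> y; rewrite subr0 => /in1/g1 h; rewrite ncV invf_le1//; lra.
- by move=> y /in1/gn h /eqP; rewrite invr_eq0 (negbTE h).
- rewrite G'0 /G mulr0 addr0 ncf ncN ncM nc_scalar// ncX ncV.
  have g0 : 0 < nc (g z) by lra.
  rewrite expr_div_n ler_pdivrMr ?exprn_gt0// exprMn.
  by congr (_ <= _); field; rewrite gt_eqF.
- rewrite G'0 mulr0 => h; have {}h : cderiv g z = 0.
    apply/eqP; have : nc (- (r%:C%C * cderiv g z) / g z ^+ 2) == 0 by rewrite eq_le h nc_ge0.
    rewrite nc_eq0 mulf_eq0 oppr_eq0 invr_eq0 expf_eq0 /= (negbTE (gn z zz)) orbF.
    have rC : r%:C%C != 0 :> R[i] by rewrite -nc_gt0 nc_scalar.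
    by rewrite mulf_eq0 (negbTE rC).
  by rewrite h nc0 expr0n mulr0 mulr_ge0 ?ltW// exprn_gt0//; lra.
Qed.

(** [multiple_zeros_bound] for [(g - a) / K], rescaled to the unit disc. The case [eta = 0] serves
    for limit functions, positive [eta] for the functions that approach them. *)
Lemma near_deriv_bound : exists2 C : R, 0 < C & forall g z r K eta a, 0 < r -> 0 < K ->
  0 <= eta -> chol g z r -> (forall y, nc (y - z) < r -> nc (g y - a) <= K) ->
  (forall y, nc (y - z) < r -> g y = a -> nc (cderiv g y) <= eta) ->
  r ^+ 2 * nc (cderiv g z) ^+ 2 <= C * K * nc (g z - a) \/ nc (cderiv g z) <= 2 * eta.
Proof.
have [C C0 hC] := @multiple_zeros_bound R.
exists C => // g z r K eta a r0 K0 eta0 gh gK ga.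
pose G y := (g (z + r%:C%C * y) - a) / K%:C%C.
have KC : K%:C%C != 0 :> R[i] by rewrite -nc_gt0 nc_scalar.
have in1 y : nc y < 1 -> nc (z + r%:C%C * y - z) < r.
  by move=> y1; rewrite addrC addKr ncM nc_scalar// gtr_pMr.
have Gd y : nc y < 1 -> cdiff G y (r%:C%C * cderiv g (z + r%:C%C * y) / K%:C%C).
  move=> /in1 yr; have -> : r%:C%C * cderiv g (z + r%:C%C * y) / K%:C%C =
    (r%:C%C * cderiv g (z + r%:C%C * y) - 0) * (K%:C%C)^-1 +
    (g (z + r%:C%C * y) - a) * 0 by ring.
  apply: cdiffM; last exact: cdiff_cst.
  by apply: cdiffB; [apply: cdiff_affine; exact: chol_cdiff gh yr|exact: cdiff_cst].
have n0 : nc (0 : R[i]) < 1 by rewrite nc0.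
have G'0 := cderivE (Gd 0 n0); rewrite mulr0 addr0 in G'0.
have [] := hC (r * eta / K) G _ _ _ _.
- by rewrite divr_ge0 ?mulr_ge0// ltW.
- by move=> y; rewrite subr0 => /Gd; exists (r%:C%C * cderiv g (z + r%:C%C * y) / K%:C%C).
- by move=> y; rewrite subr0 => /in1/gK h; rewrite ncf nc_scalar// ler_pdivrMr// mul1r.
- move=> y y1 /eqP; rewrite mulf_eq0 invr_eq0 (negbTE KC) orbF subr_eq0 => /eqP gy.
  rewrite (cderivE (Gd y y1)) ncf ncM !nc_scalar// ler_pM2r ?invr_gt0// ler_pM2l//.
  exact: ga (in1 _ y1) gy.
- rewrite G'0 /G mulr0 addr0 !ncf ncM !nc_scalar// => h; left.
  have K20 : 0 < K ^+ 2 by rewrite exprn_gt0.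
  move: h; rewrite expr_div_n ler_pdivrMr// exprMn; congr (_ <= _).
  by field; rewrite gt_eqF.
- rewrite G'0 ncf ncM !nc_scalar// => h; right; move: h.
  have -> : 2 * (r * eta / K) = r * (2 * eta) / K by ring.
  by rewrite ler_pM2r ?invr_gt0// ler_pM2l.
Qed.

End EntireFunctions.

(** * Functions with three ramified values *)

Section RamifiedValues.
Context {R : realType}.
Implicit Types (f g : R[i] -> R[i]) (w z x y h a b c : R[i]) (r S K A L : R).

Definition cubic a b c w : R[i] := (w - a) * (w - b) * (w - c).

Lemma cubic_large a b c w : 2 * (nc a + nc b + nc c) <= nc w ->
  nc w ^+ 3 <= 8 * nc (cubic a b c w).
Proof.
move=> wl; have w0 := nc_ge0 w; have a0 := nc_ge0 a.
have b0 := nc_ge0 b; have c0 := nc_ge0 c.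
have H x : 2 * nc x <= nc w -> nc w <= 2 * nc (w - x) by have := nc_sub w x; lra.
rewrite !ncM; have -> : 8 * (nc (w - a) * nc (w - b) * nc (w - c)) =
  (2 * nc (w - a)) * (2 * nc (w - b)) * (2 * nc (w - c)) by ring.
have -> : nc w ^+ 3 = nc w * nc w * nc w by ring.
by apply: ler_pM; rewrite ?mulr_ge0//; [apply: ler_pM|]; rewrite ?H//; lra.
Qed.

(** At most one of the three points is closer to [w] than [D / 2]; the other two factors are at
    least [D / 2]. *)
Lemma cubic_min a b c w (D q : R) : 0 < D -> D <= nc (a - b) -> D <= nc (a - c) ->
  D <= nc (b - c) -> q <= nc (w - a) -> q <= nc (w - b) -> q <= nc (w - c) ->
  q * (D / 2) ^+ 2 <= nc (cubic a b c w).
Proof.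
move=> D0 ab ac bc qa qb qc; rewrite !ncM expr2.
have D2 : 0 <= D / 2 by lra.
have far x y : D <= nc (x - y) -> nc (w - x) < D / 2 -> D / 2 <= nc (w - y).
  by move=> xy; have := nc_tri w x y; rewrite (ncB x w); lra.
have P x y z : q <= nc (w - x) -> D / 2 <= nc (w - y) -> D / 2 <= nc (w - z) ->
    q * (D / 2 * (D / 2)) <= nc (w - x) * (nc (w - y) * nc (w - z)).
  move=> h1 h2 h3; apply: (@le_trans _ _ (nc (w - x) * (D / 2 * (D / 2)))).
    by rewrite ler_wpM2r// mulr_ge0.
  by rewrite ler_wpM2l ?nc_ge0// ler_pM.
have [wa|wa] := ltP (nc (w - a)) (D / 2).
  by rewrite -[leRHS]mulrA; apply: P => //; apply: far wa.
have [wb|wb] := ltP (nc (w - b)) (D / 2).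
  rewrite (mulrC (nc (w - a))) -[leRHS]mulrA; apply: P => //.
  by apply: far wb.
by rewrite [leRHS]mulrC; apply: P.
Qed.

(** Where [g] is large, [far_deriv_bound] applies; the 3 in [L0] is its threshold and [2 * m] that
    of [cubic_large]. Elsewhere [spherical_schottky] bounds [g] on a disc of fixed radius, so
    [near_deriv_bound] compares [g'^2] with each of the three factors, and [cubic_min] with their
    product. *)
Lemma entire_cubic_bound g A a b c : 0 <= A -> entire g ->
  (forall z, nc (cderiv g z) <= A * (1 + nc (g z) ^+ 2)) ->
  a != b -> a != c -> b != c ->
  (forall z, [\/ g z = a, g z = b | g z = c] -> cderiv g z = 0) ->
  exists2 C, 0 < C & forall z, nc (cderiv g z) ^+ 2 <= C * nc (cubic a b c (g z)).
Proof.
move=> A0 ge gA ab ac bc gabc.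
have [C1 C10 far] := @far_deriv_bound R.
have [C2 C20 near] := @near_deriv_bound R.
have [s /andP[s0 s1] hs] := spherical_schottky A0.
pose m := nc a + nc b + nc c.
have a0 := nc_ge0 a; have b0 := nc_ge0 b; have c0 := nc_ge0 c.
pose L0 := 3 + 2 * m; have [L' hL'] := hs L0.
have A1 : 0 < A + 1 by lra.
pose r := 2 / 5 / (A + 1); have r0 : 0 < r by rewrite divr_gt0.
have rA : r * (A + 1) = 2 / 5 by rewrite divfK// gt_eqF.
pose K := `|L'| + m + 1; have K0 : 0 < K.
  by rewrite /K /m; have := normr_ge0 L'; lra.
pose D := Num.min (nc (a - b)) (Num.min (nc (a - c)) (nc (b - c))).
have D0 : 0 < D by rewrite !lt_min !nc_gt0 !subr_eq0 ab ac bc.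
have Dab : D <= nc (a - b) by rewrite ge_min lexx.
have Dac : D <= nc (a - c) by rewrite !ge_min lexx orbT.
have Dbc : D <= nc (b - c) by rewrite !ge_min lexx !orbT.
clearbody D.
pose E1 := 8 * C1 / r ^+ 2; pose E2 := C2 * K / s ^+ 2 / (D / 2) ^+ 2.
have E10 : 0 < E1 by rewrite divr_gt0 ?exprn_gt0// mulr_gt0.
have D20 : 0 < (D / 2) ^+ 2 by rewrite exprn_gt0// divr_gt0.
have E20 : 0 < E2 by rewrite !divr_gt0 ?mulr_gt0 ?exprn_gt0.
exists (E1 + E2) => [|z]; first by lra.
have P0 : 0 <= nc (cubic a b c (g z)) by exact: nc_ge0.
have p1 : 0 <= E1 * nc (cubic a b c (g z)) by rewrite mulr_ge0// ltW.
have p2 : 0 <= E2 * nc (cubic a b c (g z)) by rewrite mulr_ge0// ltW.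
rewrite mulrDl.
have [gz|gz] := leP L0 (nc (g z)).
  have gz3 : 3 <= nc (g z) by move: gz; rewrite /L0 /m; lra.
  have Ar : A * r <= 2 / 5 by lra.
  have h1 := far g z r A r0 A0 Ar (entire_chol ge) (fun y _ => gA y) gz3.
  have h2 : nc (g z) ^+ 3 <= 8 * nc (cubic a b c (g z)).
    by apply: cubic_large; move: gz; rewrite /L0 -/m; lra.
  suff : nc (cderiv g z) ^+ 2 <= E1 * nc (cubic a b c (g z)) by lra.
  rewrite /E1 mulrAC ler_pdivlMr ?exprn_gt0// mulrC; apply: le_trans h1 _.
  by rewrite (mulrC 8) -!mulrA ler_pM2l.
have gL : cbdd g z s L' := hL' g z (entire_chol ge) (fun y _ => gA y) (ltW gz).
have N x : nc x <= m -> (forall z, g z = x -> cderiv g z = 0) ->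
    nc (cderiv g z) ^+ 2 / (C2 * K / s ^+ 2) <= nc (g z - x).
  move=> xm gx; rewrite ler_pdivrMr; last by rewrite !divr_gt0 ?mulr_gt0 ?exprn_gt0.
  have [] := near g z s K 0 x s0 K0 (lexx _) (entire_chol ge).
  - move=> y /gL h; apply: le_trans (ncBD _ _) _; rewrite /K.
    by have := ler_norm L'; lra.
  - by move=> y _ /gx ->; rewrite nc0.
  - move=> h; rewrite mulrC mulrAC ler_pdivlMr ?exprn_gt0//.
    by rewrite mulrC.
  - rewrite mulr0 => h; have -> : nc (cderiv g z) = 0.
      by apply/eqP; rewrite eq_le h nc_ge0.
    by rewrite expr0n mulr_ge0 ?nc_ge0// ltW// !divr_gt0 ?mulr_gt0 ?exprn_gt0.
have Na : nc (cderiv g z) ^+ 2 / (C2 * K / s ^+ 2) <= nc (g z - a).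
  by apply: N => [|y gy]; [rewrite /m; lra|apply: gabc; exact: Or31].
have Nb : nc (cderiv g z) ^+ 2 / (C2 * K / s ^+ 2) <= nc (g z - b).
  by apply: N => [|y gy]; [rewrite /m; lra|apply: gabc; exact: Or32].
have Nc : nc (cderiv g z) ^+ 2 / (C2 * K / s ^+ 2) <= nc (g z - c).
  by apply: N => [|y gy]; [rewrite /m; lra|apply: gabc; exact: Or33].
have := cubic_min D0 Dab Dac Dbc Na Nb Nc.
set q := C2 * K / s ^+ 2 in E2 E20 p2 *.
have q0 : 0 < q by rewrite !divr_gt0 ?mulr_gt0 ?exprn_gt0.
have -> : nc (cderiv g z) ^+ 2 / q * (D / 2) ^+ 2 = nc (cderiv g z) ^+ 2 / E2.
  by rewrite /E2; field; rewrite !gt_eqF//; lra.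
rewrite ler_pdivrMr// mulrC; lra.
Qed.

(** An equation g'^2 = k (g - a) (g - b) (g - c) with [k != 0] makes [g] blow up at a distance of
    order |g|^(-1/2) from any point where it is large, which an entire function cannot do. *)
Lemma entire_ramified g A a b c : 0 <= A -> entire g ->
  (forall z r, exists S, cbdd g z r S) ->
  (forall z, nc (cderiv g z) <= A * (1 + nc (g z) ^+ 2)) ->
  a != b -> a != c -> b != c ->
  (forall z, [\/ g z = a, g z = b | g z = c] -> cderiv g z = 0) ->
  forall z, cderiv g z = 0.
Proof.
move=> A0 ge gb gA ab ac bc gabc z1; apply: contrapT => /eqP gz1.
have [C C0 hC] := entire_cubic_bound A0 ge gA ab ac bc gabc.
have ve : entire (fun z => cubic a b c (g z)).
  move=> z; have [d hd] := ge z.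
  have sub x := cdiffB hd (cdiff_cst x z).
  by eexists; apply: cdiffM; [apply: cdiffM|]; exact: sub.
have g'e : entire (cderiv g).
  by move=> z; apply: (@chol_deriv _ g z 1 (entire_chol ge)); rewrite subrr nc0.
have ue : entire (fun z => cderiv g z ^+ 2).
  by move=> z; have [d hd] := g'e z; eexists; apply: cdiffX; exact: hd.
have a0 := nc_ge0 a; have b0 := nc_ge0 b; have c0 := nc_ge0 c.
have vb z r : exists S, cbdd (fun z => cubic a b c (g z)) z r S.
  have [S gS] := gb z r.
  exists ((S + nc a) * (S + nc b) * (S + nc c)) => y yr; rewrite !ncM.
  have B x : nc (g y - x) <= S + nc x.
    by apply: le_trans (ncBD _ _) _; rewrite lerD2r; exact: gS.
  by rewrite ler_pM ?mulr_ge0 ?nc_ge0 ?B// ler_pM ?nc_ge0 ?B.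
have [||k hk] := @entire_quotient_cst _ _ _ C ue ve _ vb.
- by move=> z; rewrite ncX; exact: hC.
- exists z1; apply/eqP => v0; have := hC z1; rewrite v0 nc0 mulr0.
  by rewrite leNgt exprn_gt0 ?nc_gt0.
have k0 : 0 < nc k.
  rewrite nc_gt0; apply/eqP => k0; have := hk z1; rewrite k0 mul0r => /eqP.
  by rewrite expf_eq0 /= (negbTE gz1).
pose m := nc a + nc b + nc c.
have lower z : 2 * m <= nc (g z) -> nc k / 8 * nc (g z) ^+ 3 <= nc (cderiv g z) ^+ 2.
  move=> /cubic_large h; rewrite -(ncX (cderiv g z)) hk ncM -mulrA ler_pM2l//; lra.
have bdd z : nc (g z) <= 2 * m + 1.
  rewrite leNgt; apply/negP => gz.
  have m0 : 0 <= m by rewrite /m; lra.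
  (* The square root turns the blow-up distance into the length [rho / N] of [doubling]. *)
  pose N z := Num.sqrt (nc (g z)).
  have N2 y : N y ^+ 2 = nc (g y) by rewrite sqr_sqrtr ?nc_ge0.
  have N0 y : 0 <= N y by exact: sqrtr_ge0.
  (* Doubling [N] quadruples [nc (g y)]; with the 4 of [cauchy_estimate] and the radius
     [16 * q / N y] this gives [nc (cderiv g y) <= N y ^+ 3 / q]. Since [q ^+ 2 > 8 / nc k], it
     contradicts [lower]. *)
  pose q := 8 / nc k + 1.
  have q1 : 1 <= q by rewrite /q lerDr divr_ge0// ltW.
  have rho0 : 0 < 16 * q by lra.
  have Nz0 : 0 < N z by rewrite sqrtr_gt0; lra.
  have [|y [_ zy hy]] := doubling rho0 Nz0.
    move=> y _; have [S gS] := gb y 1; exists 1 => //; exists (Num.sqrt S) => y' /gS.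
    by move=> h; rewrite ler_wsqrtr.
  have gzy : nc (g z) <= nc (g y).
    by rewrite -!N2 ler_pXn2r ?nnegrE.
  have Ny0 : 0 < N y by apply: lt_le_trans zy.
  have r0 : 0 < 16 * q / N y by rewrite divr_gt0.
  have := @cauchy_estimate _ g y _ (4 * nc (g y)) r0 (fun x _ => ge x).
  have -> : 4 * (4 * nc (g y)) / (16 * q / N y) = N y ^+ 3 / q.
    by rewrite -N2; field; rewrite !gt_eqF//; lra.
  move=> H; have {}H : nc (cderiv g y) <= N y ^+ 3 / q.
    apply: H => x /hy h; rewrite -!N2.
    have : N x ^+ 2 <= (2 * N y) ^+ 2 by rewrite lerXn2r ?nnegrE ?mulr_ge0.
    by rewrite exprMn; lra.
  have l1 : 2 * m <= nc (g y) by lra.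
  have := lower y l1.
  have H2 : nc (cderiv g y) ^+ 2 <= (N y ^+ 3 / q) ^+ 2.
    by rewrite lerXn2r ?nnegrE ?nc_ge0// divr_ge0 ?exprn_ge0//; lra.
  move=> H3; have := le_trans H3 H2.
  have -> : (N y ^+ 3 / q) ^+ 2 = nc (g y) ^+ 3 / q ^+ 2.
    by rewrite -N2; field; rewrite gt_eqF//; lra.
  have G0 : 0 < nc (g y) ^+ 3 by rewrite exprn_gt0//; lra.
  rewrite mulrC ler_pM2l// leNgt => /negP; apply.
  have q0 : 0 < q by lra.
  rewrite -[ltLHS]mul1r ltr_pdivrMr ?exprn_gt0//.
  have h8 : nc k / 8 * q = 1 + nc k / 8 by rewrite /q; field; rewrite gt_eqF.
  rewrite expr2 mulrA h8 mulrDl mul1r.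
  have : 0 < nc k / 8 * q by rewrite mulr_gt0// divr_gt0.
  by lra.
by move: gz1; rewrite (liouville ge bdd) eqxx.
Qed.

End RamifiedValues.

(** * Bound on the spherical derivative and Schottky theorem *)

Section MartyBound.
Context {R : realType}.
Implicit Types (f g : R[i] -> R[i]) (w z x y h a b c : R[i]) (r S K A L M : R).

Definition abc_bdd a b c f w r M := forall z, nc (z - w) < r ->
  [\/ f z = a, f z = b | f z = c] -> nc (cderiv f z) <= M.

(** [doubling] for the spherical derivative [N], with [rho = N 0 / 4] to keep the points within
    distance 1/2 of 0. Rescaling by [s = (N z)^-1] normalises the derivative at 0, the doubling
    leaves the 2, and [s <= k^-1] shrinks the bound [M] at the three values to [M / k]. *)
Lemma zalcman_rescaling a b c M k f : 0 <= M -> 0 < k -> chol f 0 1 ->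
  abc_bdd a b c f 0 1 M -> k * (1 + nc (f 0) ^+ 2) < nc (cderiv f 0) ->
  exists g, [/\ chol g 0 (k / 4), sph_bdd g 0 (k / 4) 2,
    nc (cderiv g 0) = 1 + nc (g 0) ^+ 2 & abc_bdd a b c g 0 (k / 4) (M / k)].
Proof.
move=> M0 k0 fh fabc fk.
pose N z := nc (cderiv f z) * sph f z.
have q0 z : 0 < 1 + nc (f z) ^+ 2 by rewrite ltr_wpDr ?sqr_ge0.
have Nk : k < N 0 by rewrite ltr_pdivlMr.
have N00 : 0 < N 0 by lra.
have rho0 : 0 < N 0 / 4 by lra.
have cE : 2 * (N 0 / 4) / N 0 = 2^-1 by field; rewrite gt_eqF.
have [|z] := doubling rho0 N00.
  rewrite cE => z z2.
  have [|r [S [r0 _ h1 h2]]] := @chol_bounded _ f z 2^-1 ltac:(by rewrite invr_gt0).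
    by apply: chol_sub fh; lra.
  exists (r / 2); first by lra.
  exists (16 * S / r) => y yz; rewrite /N.
  have d1 : nc (cderiv f y) <= 16 * S / r by apply: deriv_bdd h1 h2 (ltW yz).
  apply: le_trans d1; rewrite ler_piMr ?nc_ge0// invf_le1//.
  by rewrite lerDl sqr_ge0.
rewrite cE subr0 => -[z2 Nz hz].
have m0 : 0 < N z by lra.
pose s := (N z)^-1; have s0 : 0 < s by rewrite invr_gt0.
have sN : s * N z = 1 by rewrite mulVf// gt_eqF.
have sk : s * k <= 1 by rewrite -sN ler_wpM2l ?(ltW s0)//; lra.
have in1 u : nc (u - 0) < k / 4 ->
    nc (z + s%:C%C * u - 0) < 1 /\ nc (z + s%:C%C * u - z) <= N 0 / 4 / N z.
  rewrite !subr0 => uk; have su : nc (s%:C%C * u) < s * (k / 4).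
    by rewrite ncM nc_scalar// ltr_pM2l.
  split; first by apply: le_lt_trans (ncD _ _) _; lra.
  rewrite addrC addKr; apply: le_trans (ltW su) _; rewrite mulrC.
  by rewrite ler_wpM2r ?(ltW s0)//; lra.
have fd u : nc (u - 0) < k / 4 -> exists d, cdiff f (z + s%:C%C * u) d.
  by move=> /in1[h _]; exact: fh.
pose g u := f (z + s%:C%C * u).
have g' u : nc (u - 0) < k / 4 -> nc (cderiv g u) = s * nc (cderiv f (z + s%:C%C * u)).
  by move=> /fd h; rewrite rescale_deriv// ncM nc_scalar.
have fN y : nc (cderiv f y) = N y * (1 + nc (f y) ^+ 2).
  by rewrite /N /sph divfK// gt_eqF.
exists g; split.
- move=> u uk; have [d hd] := fd u uk.
  by exists (s%:C%C * d); exact: cdiff_affine.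
- move=> u uk; rewrite g'// fN mulrA ler_wpM2r ?(ltW (q0 _))//.
  have [_ /hz h] := in1 u uk.
  have : s * N (z + s%:C%C * u) <= s * (2 * N z) by rewrite ler_wpM2l// ltW.
  by lra.
- rewrite g'; last by rewrite subrr nc0; lra.
  by rewrite fN mulrA /g mulr0 addr0 sN mul1r.
- move=> u uk guabc; rewrite g'//; have [h1 _] := in1 u uk.
  have h2 := fabc _ h1 guabc.
  rewrite ler_pdivlMr// mulrAC; apply: le_trans (ler_wpM2l (mulr_ge0 (ltW s0) (ltW k0)) h2) _.
  by rewrite ler_piMl.
Qed.

(** Steps of length [r] along a ray from 0; they allow a local bound with fixed radius to be
    iterated. *)
Lemma nc_step z n r : 0 <= r -> nc z <= n.+1%:R * r ->
  exists y, nc y <= n%:R * r /\ nc (z - y) <= r.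
Proof.
move=> r0 zr; have n0 : (0 : R) < n.+1%:R by rewrite ltr0n.
exists ((n%:R / n.+1%:R)%:C%C * z).
have q0 : (0 : R) <= n%:R / n.+1%:R by rewrite divr_ge0 ?ler0n.
have e1 : z - (n%:R / n.+1%:R)%:C%C * z = (n.+1%:R^-1)%:C%C * z.
  have -> : (n.+1%:R^-1)%:C%C = 1 - (n%:R / n.+1%:R)%:C%C :> R[i].
    have -> : (1 : R[i]) = (1 : R)%:C%C by [].
    by rewrite -raddfB; congr (_%:C%C); field; rewrite gt_eqF.
  by ring.
rewrite e1 !ncM !nc_real !ger0_norm// ?invr_ge0 ?(ltW n0)//; split.
  by rewrite -mulrA ler_wpM2l ?ler0n// mulrC ler_pdivrMr// mulrC.
by rewrite mulrC ler_pdivrMr// mulrC.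
Qed.

(** No point where [G k] equals [a] has to be found: by [near_deriv_bound] the derivative at [z]
    itself is controlled either by [G k z - a] or by [eta k], and both tend to 0. *)
Lemma ramified_limit (T : Type) (U : set_system T) (G : T -> R[i] -> R[i]) z a (d : R[i])
  S (eta : T -> R) : UltraFilter U ->
  U [set k | chol (G k) z 1] -> U [set k | cbdd (G k) z 1 S] ->
  uconv U (G^~ z) a -> uconv U (fun k => cderiv (G k) z) d ->
  (forall k, 0 <= eta k) ->
  U [set k | forall y, nc (y - z) < 1 -> G k y = a -> nc (cderiv (G k) y) <= eta k] ->
  (forall e : R, 0 < e -> U [set k | eta k < e]) -> d = 0.
Proof.
move=> UU Gh GS Ga Gd eta0 Geta etae; have UF : ProperFilter U := ultra_proper.
have [C C0 near] := @near_deriv_bound R.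
have a0 := nc_ge0 a; have S0 := normr_ge0 S.
pose K := `|S| + nc a + 1; have K0 : 0 < K by rewrite /K; lra.
apply/eqP; rewrite -nc_eq0 eq_le nc_ge0 andbT; apply/ler_addgt0Pr => e e0.
rewrite add0r; have e20 : 0 < e / 2 by lra.
have e40 : 0 < e / 4 by lra.
have CK0 : 0 < C * K by rewrite mulr_gt0.
have d0 : 0 < (e / 2) ^+ 2 / (C * K) by rewrite divr_gt0// exprn_gt0.
have [k /= [[h1 h2] [[h3 h4] [h5 h6]]]] := filter_ex (filterI
  (filterI (Gd _ e20) (Ga _ d0))
  (filterI (filterI GS Gh) (filterI Geta (etae _ e40)))).
have := nc_sub d (cderiv (G k) z); rewrite ncB => h8.
suff : nc (cderiv (G k) z) <= e / 2 by lra.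
have [] := near (G k) z 1 K (eta k) a ltr01 K0 (eta0 k) h4 _ h5.
- move=> y /h3 h; apply: le_trans (ncBD _ _) _; rewrite /K.
  by have := ler_norm S; lra.
- rewrite expr1n mul1r => h9; rewrite -(@ler_pXn2r _ 2) ?nnegrE ?nc_ge0 ?(ltW e20)//.
  apply: le_trans h9 _.
  have : nc (G k z - a) * (C * K) <= (e / 2) ^+ 2 by rewrite -ler_pdivlMr// ltW.
  by rewrite mulrC.
- by lra.
Qed.

Lemma marty_bound a b c M : 0 <= M -> a != b -> a != c -> b != c ->
  exists2 A, 0 <= A & forall f, chol f 0 1 -> abc_bdd a b c f 0 1 M ->
    nc (cderiv f 0) <= A * (1 + nc (f 0) ^+ 2).
Proof.
move=> M0 ab ac bc; apply: contrapT => nA.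
have [G hG] : {G : nat -> R[i] -> R[i] & forall k,
    [/\ chol (G k) 0 (k.+1%:R / 4), sph_bdd (G k) 0 (k.+1%:R / 4) 2,
      nc (cderiv (G k) 0) = 1 + nc (G k 0) ^+ 2 &
      abc_bdd a b c (G k) 0 (k.+1%:R / 4) (M / k.+1%:R)]}.
  apply: (@choice _ _ (fun k g => [/\ chol g 0 (k.+1%:R / 4),
    sph_bdd g 0 (k.+1%:R / 4) 2, nc (cderiv g 0) = 1 + nc (g 0) ^+ 2 &
    abc_bdd a b c g 0 (k.+1%:R / 4) (M / k.+1%:R)])) => k.
  have k0 : (0 : R) < k.+1%:R by rewrite ltr0n.
  have [f [fh fabc fk]] : exists f, [/\ chol f 0 1, abc_bdd a b c f 0 1 M &
      k.+1%:R * (1 + nc (f 0) ^+ 2) < nc (cderiv f 0)].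
    apply: contrapT => nf; apply: nA; exists k.+1%:R => // f fh fabc.
    by rewrite leNgt; apply/negP => h; apply: nf; exists f.
  exact: zalcman_rescaling M0 k0 fh fabc fk.
have [U [UU Uinf]] := @nat_ultra; have UF : ProperFilter U := ultra_proper.
have big r : U [set k | r <= k.+1%:R / 4].
  have p : 0 < `|r| * 4 + 1 by have := normr_ge0 r; lra.
  have r4 : 0 < (`|r| * 4 + 1)^-1 by rewrite invr_gt0.
  have [n hn] := natr_inv_lt r4; apply: filterS (Uinf n) => k /= /hn.
  rewrite ltf_pV2 ?posrE ?ltr0n//.
  by have := ler_norm r; lra.
have [C1 C10 far] := @far_deriv_bound R.
have [s /andP[s0 s1] hs] := @spherical_schottky R 2 ltac:(by []).
(* This keeps the limit from being oo at 0. With [A = 2] the radius 1/5 is admissible in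
   [far_deriv_bound], and the normalisation at 0 gives [nc (G k 0) ^+ 4 <= 25 * C1 * nc (G k 0) ^+
   3]. *)
have G0b : U [set k | nc (G k 0) <= 3 + 25 * C1].
  apply: filterS (big 1) => k /= k1; have [h1 h2 h3 _] := hG k.
  have [g3|g3] := leP 3 (nc (G k 0)); last by lra.
  have r50 : (0 : R) < 5^-1 by rewrite invr_gt0.
  have sub : nc (0 - 0 : R[i]) + 5^-1 <= k.+1%:R / 4 by rewrite subrr nc0; lra.
  have := far (G k) 0 5^-1 2 r50 ltac:(by []) ltac:(lra) (chol_sub sub h1) _ g3.
  move=> H; have {}H := H (fun y yr => h2 y ltac:(rewrite subrr nc0 in sub; lra)).
  have g0 : 0 < nc (G k 0) by lra.
  suff : nc (G k 0) <= 25 * C1 by lra.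
  rewrite -(ler_pM2r (exprn_gt0 3 g0)) -mulrA.
  apply: le_trans (ler_wpM2l (ler0n _ 25) H).
  have -> : 25 * (5^-1 ^+ 2 * nc (cderiv (G k) 0) ^+ 2) = nc (cderiv (G k) 0) ^+ 2.
    by field.
  have -> : nc (G k 0) * nc (G k 0) ^+ 3 = (nc (G k 0) ^+ 2) ^+ 2 by ring.
  by rewrite h3 lerXn2r ?nnegrE ?addr_ge0 ?sqr_ge0// lerDr.
have s20 : 0 <= s / 2 by lra.
(* Chaining [spherical_schottky] from 0 bounds the [G k] on every disc, so the limit is entire and
   not merely meromorphic. *)
have Gb n : exists L, U [set k | forall z, nc z <= n%:R * (s / 2) -> nc (G k z) <= L].
  elim: n => [|n [L hL]].
    exists (3 + 25 * C1); apply: filterS G0b => k /= h z.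
    by rewrite mul0r => z0; have /eqP -> : z == 0 by rewrite -nc_eq0 eq_le z0 nc_ge0.
  have [L' hL'] := hs L; exists L'.
  apply: filterS (filterI hL (big (n%:R * (s / 2) + 1))) => k /= [h1 h2] z zn.
  have [y [yn zy]] := nc_step s20 zn.
  have [g1 g2 _ _] := hG k.
  apply: (hL' (G k) y); last by lra.
  - by apply: chol_sub g1; rewrite subr0; lra.
  - move=> x xy; apply: g2; rewrite subr0; have := ncD (x - y) y; rewrite subrK; lra.
  - exact: h1.
have Gb' z r : exists S, U [set k | cbdd (G k) z r S].
  have p : 0 < `|nc z + r| + 1 by have := normr_ge0 (nc z + r); lra.
  have r2 : 0 < (s / 2) / (`|nc z + r| + 1) by rewrite divr_gt0//; lra.
  have [n hn] := natr_inv_lt r2; have [L hL] := Gb n.+1; exists L.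
  apply: filterS hL => k /= h y yr; apply: h.
  have := hn n (leqnn n); rewrite ltr_pdivlMr// mulrC ltr_pdivrMr ?ltr0n//.
  have := ler_norm (nc z + r); have := ncD (y - z) z; rewrite subrK; lra.
have Gh z r : U [set k | chol (G k) z r].
  apply: filterS (big (nc z + r)) => k /= kr; have [g1 _ _ _] := hG k.
  by apply: chol_sub g1; rewrite subr0.
have [g Gg] : {g : R[i] -> R[i] & forall z, uconv U (G^~ z) (g z)}.
  apply: (@choice _ _ (fun z l => uconv U (G^~ z) l)) => z.
  have [S hS] := Gb' z 1; apply: (@ulim_ex _ _ U UU _ S).
  by apply: filterS hS => k /=; apply; rewrite subrr nc0.
have Gg' z : exists2 d, cdiff g z d & uconv U (fun k => cderiv (G k) z) d.
  have [S hS] := Gb' z 1.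
  exact: (ulim_cdiff UU ltr01 (Gh z 1) hS (fun y _ => Gg y)).
have ge : entire g by move=> z; have [d hd _] := Gg' z; exists d.
have Gd z : uconv U (fun k => cderiv (G k) z) (cderiv g z).
  by have [d hd hd'] := Gg' z; rewrite (cderivE hd).
have gb z r : exists S, cbdd g z r S.
  have [S hS] := Gb' z r; exists S => y yr.
  by apply: (uconv_le UU (Gg y)); apply: filterS hS => k /=; apply.
have gA z : nc (cderiv g z) <= 2 * (1 + nc (g z) ^+ 2).
  have h2 := uconvM UU (Gg z) (Gg z); rewrite -!expr2 in h2.
  apply/ler_addgt0Pr => e e0; have e40 : 0 < e / 4 by lra.
  have [k /= [[h3 h4] h5]] := filter_ex (filterI (filterI (Gd z _ e40) (h2 _ e40))
    (big (nc z + 1))).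
  have [_ g2 _ _] := hG k; have := g2 z; rewrite subr0 => /(_ ltac:(lra)).
  have := nc_sub (G k z * G k z) (g z ^+ 2); have := nc_sub (cderiv g z) (cderiv (G k) z).
  by rewrite ncB -expr2 !ncX; rewrite -expr2 in h4; lra.
have g0 : 1 <= nc (cderiv g 0).
  apply/ler_addgt0Pr => e e0.
  have [k /= h3] := filter_ex (Gd 0 e e0); have [_ _ h _] := hG k.
  have := sqr_ge0 (nc (G k 0)); have := nc_sub (cderiv (G k) 0) (cderiv g 0); lra.
have Meta (e : R) : 0 < e -> U [set k | M / k.+1%:R < e].
  move=> e0; have M1 : 0 < M + 1 by lra.
  have [n hn] := natr_inv_lt (divr_gt0 e0 M1); apply: filterS (Uinf n) => k /= /hn.
  rewrite ltr_pdivlMr// mulrC; apply: le_lt_trans.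
  by rewrite ler_wpM2r ?invr_ge0 ?ler0n// lerDl.
have gabc z : [\/ g z = a, g z = b | g z = c] -> cderiv g z = 0.
  move=> habc; have [S hS] := Gb' z 1.
  apply: (ramified_limit UU (Gh z 1) hS (Gg z) (Gd z) _ _ Meta).
    by move=> k; rewrite divr_ge0.
  apply: filterS (big (nc z + 1)) => k /= kz y yz gy; have [_ _ _ g4] := hG k.
  apply: g4; last by rewrite gy.
  by rewrite subr0; have := ncD (y - z) z; rewrite subrK; lra.
have := entire_ramified (ler0n R 2) ge gb gA ab ac bc gabc 0 => g'0.
by move: g0; rewrite g'0 nc0; lra.
Qed.

(** [marty_bound] speaks of centres only; applied to [f] on discs of radius 1/2 around the points of
    the half disc, it gives the hypothesis of [spherical_schottky] for the rescaled function [g]. *)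
Lemma abc_schottky a b c M : 0 <= M -> a != b -> a != c -> b != c ->
  exists2 s : R, 0 < s & forall L, exists L', forall f, chol f 0 1 ->
    abc_bdd a b c f 0 1 M -> nc (f 0) <= L -> cbdd f 0 s L'.
Proof.
move=> M0 ab ac bc; have [A A0 hA] := marty_bound M0 ab ac bc.
have [s /andP[s0 s1] hs] := @spherical_schottky R A A0.
exists (s / 2) => [|L]; first by lra.
have [L' hL'] := hs L; exists L' => f fh fabc f0.
pose g u := f (0 + (2^-1 : R)%:C%C * u).
have h0 : (0 : R) < 2^-1 by rewrite invr_gt0.
have gh : chol g 0 1 by apply: rescale_chol => //; apply: chol_sub fh; rewrite subrr nc0; lra.
have g1 : sph_bdd g 0 1 A.
  move=> u; rewrite subr0 => u1.
  have z2 : nc (0 + (2^-1 : R)%:C%C * u - 0) < 2^-1.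
    by rewrite add0r subr0 ncM nc_scalar//; lra.
  have sub : nc (0 + (2^-1 : R)%:C%C * u - 0) + 2^-1 * 1 <= 1 by lra.
  pose k v := f (0 + (2^-1 : R)%:C%C * u + (2^-1 : R)%:C%C * v).
  have in1 v : nc (v - 0) < 1 -> nc (0 + (2^-1 : R)%:C%C * u + (2^-1 : R)%:C%C * v - 0) < 1.
    rewrite subr0 => v1.
    have -> : 0 + (2^-1 : R)%:C%C * u + (2^-1 : R)%:C%C * v - 0 =
      (0 + (2^-1 : R)%:C%C * u - 0) + (2^-1 : R)%:C%C * v by ring.
    by apply: le_lt_trans (ncD _ _) _; rewrite [nc (_ * v)]ncM nc_scalar//; lra.
  have := hA k (rescale_chol h0 (chol_sub sub fh)).
  rewrite /k !rescale_deriv ?mulr0 ?addr0; last 2 first.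
  - by apply: fh; lra.
  - by apply: fh; rewrite ?mulr0 ?addr0; lra.
  apply=> v v1 vabc; have vin := in1 v v1.
  rewrite rescale_deriv; last exact: fh.
  rewrite ncM nc_scalar//; apply: le_trans (fabc _ vin vabc).
  by rewrite ler_piMl ?nc_ge0//; lra.
move=> z; rewrite subr0 => zs.
have := hL' g 0 gh g1; rewrite {1}/g mulr0 add0r => /(_ f0 ((2 : R)%:C%C * z)).
rewrite /g subr0 add0r mulrA -rmorphM mulVf// rmorph1 mul1r; apply.
by rewrite ncM nc_scalar//; lra.
Qed.

End MartyBound.

(** * Several variables *)

Section Polydiscs.
Context {R : realType} {n : nat}.
Local Notation V := 'rV[R[i]]_n.
Implicit Types (f g : V -> R[i]) (x y z v : V) (r S : R).

(** An open polydisc with real radius; the radii of [ball] lie in [R[i]] here. *)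
Definition vball z r x := forall j, nc ((x - z) ord0 j) < r.

Lemma normE (c : R[i]) : `|c| = (nc c)%:C%C.
Proof. by []. Qed.

Lemma vnorm_real v : (Re `|v|)%:C%C = `|v|.
Proof. by apply/eqP; rewrite eq_complex /=; have := ger0_Im (normr_ge0 v) => ->; rewrite !eqxx. Qed.

Definition vn v : R := Re `|v|.

Lemma vn_ge0 v : 0 <= vn v.
Proof. by have := normr_ge0 v; rewrite lecE => /andP[]. Qed.

Lemma nc_le_vn v j : nc (v ord0 j) <= vn v.
Proof.
rewrite -lecR -normE vnorm_real [leRHS]mx_normE -[leLHS]nngE num_le.
exact: (le_bigmax _ (fun i : 'I_1 * 'I_n => `|v i.1 i.2|%:nng) (ord0, j)).
Qed.

(** For [n = 0] there is no coordinate, and [0 < r] gives the conclusion. *)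
Lemma vn_lt v r : 0 < r -> (forall j, nc (v ord0 j) < r) -> vn v < r.
Proof.
move=> r0 vr; rewrite -ltcR vnorm_real.
have := @mx_norm_ball R[i] 1 n => /(congr1 (fun b => b 0 r%:C%C v)).
rewrite /ball_ /= sub0r normrN => <-.
split; first by rewrite ltcR.
move=> i j; rewrite -ball_normE /= mxE sub0r normrN normE ltcR ord1; exact: vr.
Qed.

Lemma nbhs_vball z (A : set V) : nbhs z A <-> exists2 r, 0 < r & vball z r `<=` A.
Proof.
split.
  move=> /nbhs_ballP[e /= e0 eA].
  have e1 : e = (Re e)%:C%C.
    by apply/eqP; rewrite eq_complex /= (ger0_Im (ltW e0)) !eqxx.
  have r0 : 0 < Re e by rewrite -ltcR -e1.
  exists (Re e) => // x xz; apply: eA; split=> // i j.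
  rewrite -ball_normE /= e1 normE ltcR ord1 ncB.
  by have := xz j; rewrite !mxE.
move=> [r r0 rA]; apply/nbhs_ballP; exists r%:C%C; first by rewrite /= ltcR.
move=> x [_ h]; apply: rA => j.
have := h ord0 j; rewrite -ball_normE /= normE ltcR ncB; by rewrite !mxE.
Qed.

Lemma cgradientE f x v : differentiable f x ->
  'd f x v = \sum_j v ord0 j * cgradient f x ord0 j.
Proof.
move=> fx; rewrite {1}(row_sum_delta v) linear_sum; apply: eq_bigr => j _.
by rewrite linearZ /cgradient mxE deriveE.
Qed.

Lemma line_cdiff f x v (t : R[i]) : differentiable f (x + t *: v) ->
  cdiff (fun s => f (x + s *: v)) t
    (\sum_j v ord0 j * cgradient f (x + t *: v) ord0 j).
Proof.
move=> fx e e0; have := diff_locallyxC fx => H.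
have : (fun h => f (x + t *: v + h)) = (fun h => f (x + t *: v) + 'd f (x + t *: v) h)
    +o_ (0 : V) id by apply: funext => h; exact: H.
move=> /eqaddoP /(_ (e / (vn v + 1))%:C%C).
have v1 : 0 < vn v + 1 by have := vn_ge0 v; lra.
rewrite ltcR divr_gt0// => /(_ isT) /nbhs_vball[r r0 hr].
exists (r / (vn v + 1)) => [|h]; first by rewrite divr_gt0.
rewrite ltr_pdivlMr// => hh.
have : vball 0 r (h *: v).
  move=> j; rewrite subr0 mxE ncM; apply: le_lt_trans hh.
  rewrite ler_wpM2l ?nc_ge0//; have := nc_le_vn v j; lra.
move=> /hr /=; rewrite normrZ -(vnorm_real v) -/(vn v) normE -!rmorphM lecR.
rewrite -cgradientE// => H1; rewrite scalerDl addrA.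
have -> : f (x + t *: v + h *: v) - f (x + t *: v) - 'd f (x + t *: v) v * h =
  f (x + t *: v + h *: v) - (f (x + t *: v) + 'd f (x + t *: v) (h *: v)).
  rewrite (_ : 'd f (x + t *: v) (h *: v) = h * 'd f (x + t *: v) v); [ring|exact: linearZ].
apply: le_trans H1 _; rewrite mulrCA mulrC ler_wpM2r ?nc_ge0//.
rewrite mulrAC ler_pdivrMr// ler_wpM2l ?(ltW e0)//; lra.
Qed.

(** After subtraction of the linear form the candidate differential is 0, whose continuity is
    immediate. *)
Lemma differentiable_quadratic g z (l : 'I_n -> R[i]) r (K : R) : 0 < r ->
  (forall h : V, vn h < r ->
    nc (g (z + h) - g z - \sum_j l j * h ord0 j) <= K * vn h ^+ 2) ->
  differentiable g z.
Proof.
move=> r0 hg.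
pose lf (y : V) : R[i] := \sum_j l j *: (y ord0 j : R[i]).
have lfd : differentiable lf z.
  rewrite (_ : lf = \sum_j (fun y : V => l j *: (y ord0 j : R[i]))).
    apply: differentiable_sum => j; apply: differentiableZ; exact: differentiable_coord.
  by apply: funext => y; rewrite fct_sumE.
pose rho y := g y - lf y.
suff rd : differentiable rho z.
  rewrite (_ : g = rho + lf); first exact: differentiableD.
  by apply: funext => y; rewrite /rho /= [RHS]subrK.
have c0 : continuous (0 : V -> R[i]) by exact: cst_continuous.
have H : rho \o shift z = cst (rho z) + (0 : V -> R[i]) +o_ (0 : V) id.
  apply/eqaddoP => e e0.
  have e1 : e = (Re e)%:C%C.
    by apply/eqP; rewrite eq_complex /= (ger0_Im (ltW e0)) !eqxx.
  have d0 : 0 < Re e by rewrite -ltcR -e1.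
  have k0 : 0 < `|K| + 1 by have := normr_ge0 K; lra.
  apply/nbhs_vball; exists (Num.min r (Re e / (`|K| + 1))).
    by rewrite lt_min r0 divr_gt0.
  move=> h hr; have m0 : 0 < Num.min r (Re e / (`|K| + 1)) by rewrite lt_min r0 divr_gt0.
  have : vn h < Num.min r (Re e / (`|K| + 1)).
    by apply: vn_lt => // j; have := hr j; rewrite subr0.
  rewrite lt_min => /andP[/hg h1]; rewrite ltr_pdivlMr// => h2.
  rewrite e1 -(vnorm_real h) -/(vn h) normE -rmorphM lecR /=.
  have -> : (rho \o shift z - (cst (rho z) + (0 : V -> R[i]))) h =
    g (z + h) - g z - \sum_j l j * h ord0 j.
    rewrite -[LHS]/(rho (h + z) - (rho z + 0)) addr0 /rho.
    have -> : lf (h + z) = lf h + lf z.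
      by rewrite /lf -big_split; apply: eq_bigr => j _; rewrite mxE scalerDr.
    rewrite (addrC h z) (_ : \sum_j l j * h ord0 j = lf h)//; ring.
  apply: le_trans h1 _; rewrite expr2 mulrA ler_wpM2r ?vn_ge0//.
  have := ler_wpM2r (vn_ge0 h) (ler_norm K); have := vn_ge0 h; lra.
have d0 : 'd rho z = (0 : V -> R[i]) :> (V -> R[i]).
  by apply/diff_unique; [exact: c0|exact: H].
by apply/diff_locallyP; rewrite d0.
Qed.

End Polydiscs.

Section SeveralVariables.
Context {R : realType} {n : nat}.
Local Notation V := 'rV[R[i]]_n.
Implicit Types (f g : V -> R[i]) (x y z v : V) (r S L : R) (D : set V).

Lemma nc_sum (I : finType) (c : I -> R[i]) : nc (\sum_i c i) <= \sum_i nc (c i).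
Proof.
elim/big_ind2 : _ => [|a b c' d ab cd|//]; first by rewrite nc0.
by apply: le_trans (ncD _ _) _; exact: lerD.
Qed.

Lemma nc_le_euclidean_norm (v : V) j : nc (v ord0 j) <= euclidean_norm v.
Proof.
rewrite /euclidean_norm -[leLHS]ger0_norm ?nc_ge0// -sqrtr_sqr ler_wsqrtr//.
by rewrite (bigD1 j)//= lerDl sumr_ge0// => i _; exact: sqr_ge0.
Qed.

Lemma compact_disc (c : R[i]) r : compact [set a : R[i] | nc (a - c) <= r].
Proof.
rewrite compact_ultra => F UF FA.
have [|l hl] := @ulim_ex R R[i] F UF id (r + nc c).
  by apply: filterS FA => a /=; have := nc_sub a c; lra.
exists l; split.
  rewrite /=; apply: (uconv_le UF (uconvB UF hl (uconv_const UF c))).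
  by apply: filterS FA.
move=> A /nbhs_ballP[e /= e0 eA].
have e1 : e = (Re e)%:C%C.
  by apply/eqP; rewrite eq_complex /= (ger0_Im (ltW e0)) !eqxx.
have d0 : 0 < Re e by rewrite -ltcR -e1.
apply: filterS (hl _ d0) => a /= ha; apply: eA.
by rewrite -ball_normE /= e1 normE ltcR ncB.
Qed.

Lemma compact_polydisc z r : compact [set x : V | forall j, nc ((x - z) ord0 j) <= r].
Proof.
rewrite (_ : [set x | _] = [set x : V | forall j, [set a | nc (a - z ord0 j) <= r] (x ord0 j)]).
  by apply: (@rV_compact R[i] n (fun j => [set a | nc (a - z ord0 j) <= r])) => j;
    exact: compact_disc.
by apply/seteqP; split=> x /= h j; have := h j; rewrite !mxE.
Qed.

Definition three_value_property (D : set V) (F : set (V -> R[i])) :=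
  forall K : set V, compact K -> K `<=` D ->
    exists h : riemann_sphere R -> \bar R,
      [/\ forall w, (0 <= h w)%E,
          exists a b c : R[i], [/\ a != b, a != c & b != c] /\
            [/\ h (Some a) \is a fin_num, h (Some b) \is a fin_num
              & h (Some c) \is a fin_num]
        & forall f z, F f -> K z ->
            ((euclidean_norm (cgradient f z))%:E <= h (Some (f z)))%E].

Lemma vball_line z x v r s (t : R[i]) : 0 <= s -> vball z r x ->
  (forall j, nc (v ord0 j) <= s) -> nc t < 1 -> vball z (r + s) (x + t *: v).
Proof.
move=> s0 xz vs t1 j; have -> : (x + t *: v - z) ord0 j = (x - z) ord0 j + t * v ord0 j.
  by rewrite !mxE; ring.
apply: le_lt_trans (ncD _ _) _; rewrite ncM.
have := xz j; have : nc t * nc (v ord0 j) <= 1 * s.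
  by rewrite ler_pM ?nc_ge0// ltW.
by lra.
Qed.

(** Two points of the small polydisc lie on a complex line, parametrised with [x] at 0 and [y] at
    [t = s / 2], inside the disc of [abc_schottky]. The statement is symmetric in [x] and [y], so
    boundedness propagates both towards and away from [z]. *)
Lemma local_schottky D F z : open D -> (forall f, F f -> holomorphic D f) ->
  three_value_property D F -> D z ->
  exists2 r, 0 < r & vball z r `<=` D /\ forall L, exists L', forall f, F f ->
    forall x y, vball z r x -> vball z r y -> nc (f x) <= L -> nc (f y) <= L'.
Proof.
move=> oD Fh FK Dz.
have /nbhs_vball[r0 r00 hr0] : nbhs z D by exact: open_nbhs_nbhs.
pose r := r0 / 3; have rr : 0 < r by rewrite /r; lra.
pose K := [set x : V | forall j, nc ((x - z) ord0 j) <= r + r].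
have KD : K `<=` D by move=> x xK; apply: hr0 => j; have := xK j; rewrite /r; lra.
have [h [h0 [a [b [c [[ab ac bc] [ha hb hc]]]]] hF]] := FK K (@compact_polydisc z _) KD.
pose M1 := fine (h (Some a)) + fine (h (Some b)) + fine (h (Some c)).
have fa : 0 <= fine (h (Some a)) by rewrite fine_ge0.
have fb : 0 <= fine (h (Some b)) by rewrite fine_ge0.
have fc : 0 <= fine (h (Some c)) by rewrite fine_ge0.
have M10 : 0 <= M1 by rewrite !addr_ge0.
have bound f x : F f -> K x -> [\/ f x = a, f x = b | f x = c] ->
    euclidean_norm (cgradient f x) <= M1.
  move=> Ff Kx fx; have := hF f x Ff Kx; case: fx => ->.
  - by rewrite -(fineK ha) lee_fin /M1; lra.
  - by rewrite -(fineK hb) lee_fin /M1; lra.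
  - by rewrite -(fineK hc) lee_fin /M1; lra.
(* By the chain rule: the direction [v] has coordinates at most [r], and each partial derivative is
   at most [M1] at the three values. *)
pose M := \sum_(j < n) r * M1.
have M0 : 0 <= M by rewrite sumr_ge0// => j _; rewrite mulr_ge0// ltW.
have [s s0 hs] := abc_schottky M0 ab ac bc.
(* Coordinates of [y - x] are at most [2 * q], so those of [v] are at most [4 * q / s <= r], and the
   unit disc of the line stays in [K]. *)
pose q := Num.min r (r * s / 4).
have q0 : 0 < q by rewrite lt_min rr divr_gt0// mulr_gt0.
have qr : q <= r by rewrite ge_min lexx.
have qs : q <= r * s / 4 by rewrite ge_min lexx orbT.
clearbody q; exists q => //; split.
  by move=> x xz; apply: KD => j; have := xz j; lra.
move=> L; have [L' hL'] := hs L; exists L' => f Ff x y xz yz fx.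
have s20 : 0 < s / 2 by lra.
pose t : R[i] := (s / 2)%:C%C; have tn : nc t = s / 2 by rewrite nc_scalar.
have t0 : t != 0 by rewrite -nc_gt0 tn.
pose v : V := t^-1 *: (y - x).
have vr j : nc (v ord0 j) <= r.
  rewrite mxE ncM ncV tn mulrC ler_pdivrMr//.
  have -> : (y - x) ord0 j = (y - z) ord0 j - (x - z) ord0 j by rewrite !mxE; ring.
  by apply: le_trans (ncBD _ _) _; have := xz j; have := yz j; lra.
have xr : vball z r x by move=> j; apply: lt_le_trans (xz j) qr.
have inK u : nc u < 1 -> K (x + u *: v).
  by move=> u1 j; apply: ltW; exact: vball_line (ltW rr) xr vr u1 j.
pose phi u := f (x + u *: v).
have pd u : nc u < 1 -> cdiff phi u (\sum_j v ord0 j * cgradient f (x + u *: v) ord0 j).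
  by move=> /inK/KD Du; apply: line_cdiff; exact: Fh.
have ph : chol phi 0 1.
  by move=> u; rewrite subr0 => /pd hd; eexists; exact: hd.
have pabc : abc_bdd a b c phi 0 1 M.
  move=> u; rewrite subr0 => u1 pu; rewrite (cderivE (pd u u1)).
  apply: le_trans (nc_sum _) _; apply: ler_sum => j _; rewrite ncM.
  rewrite ler_pM ?nc_ge0//; apply: le_trans (nc_le_euclidean_norm _ _) _.
  exact: bound Ff (inK u u1) pu.
have p0 : nc (phi 0) <= L by rewrite /phi scale0r addr0.
have := hL' phi ph pabc p0 t; rewrite subr0 tn /phi /v scalerA divff// scale1r.
by rewrite addrC subrK; apply; lra.
Qed.

(** The local equivalence makes both [S] and its complement in [D] open. *)
Lemma locally_invariant_all D (S : set V) : open D -> connected D -> S `<=` D ->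
  (forall z, D z -> exists2 r, 0 < r & vball z r `<=` D /\
    forall x, vball z r x -> (S x <-> S z)) ->
  S !=set0 -> S = D.
Proof.
move=> oD cD SD Sloc S0; apply: cD => //.
- exists S; last by apply/seteqP; split=> x //; [move=> Sx; split=> //; exact: SD|case].
  rewrite openE => z Sz; have [r r0 [_ h]] := Sloc z (SD z Sz).
  by apply/nbhs_vball; exists r => // x /h; tauto.
- exists (~` (D `\` S)).
    apply: open_closedC; rewrite openE => z [Dz nSz].
    have [r r0 [rD h]] := Sloc z Dz.
    apply/nbhs_vball; exists r => // x xz; split; first exact: rD.
    by have := h x xz; tauto.
  apply/seteqP; split=> x.
    by move=> Sx; split; [exact: SD|move=> [_]; apply].
  by move=> [Dx nx]; apply: contrapT => nSx; apply: nx.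
Qed.

Lemma rat_vector_near z (e : R) : 0 < e -> exists q : 'rV[(rat * rat)%type]_n,
  vball z e (\row_j Complex (ratr (q ord0 j).1) (ratr (q ord0 j).2)).
Proof.
move=> e0.
have ratnear (a : R) : exists q : rat, `|ratr q - a| < e / 2.
  have [|q] := @rat_in_itvoo R (a - e / 2) (a + e / 2); first by lra.
  rewrite in_itv /= => /andP[h1 h2]; exists q; rewrite ltr_norml; apply/andP; split; lra.
have [f hf] := choice ratnear.
exists (\row_j (f (Re (z ord0 j)), f (Im (z ord0 j)))) => j.
rewrite !mxE /=; apply: le_lt_trans (nc_ReIm _) _; rewrite ReB ImB /=.
by have := hf (Re (z ord0 j)); have := hf (Im (z ord0 j)); lra.
Qed.

(* [phi m] is chosen good for the first [m] balls with rational centre and radius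
   [1 / (i + 1)] on which [Q] holds along [U]. *)
Lemma ultra_extraction (U : set_system nat) (D : set V) (Q : set V -> nat -> nat -> Prop) :
  UltraFilter U -> (forall N, U [set k | (N <= k)%N]) ->
  (forall A B m p k, A `<=` B -> (m <= p)%N -> Q B p k -> Q A m k) ->
  (forall z, D z -> exists2 r, 0 < r & forall m, U (Q (vball z r) m)) ->
  exists phi : nat -> nat, {homo phi : i j / (i < j)%N} /\
    forall z, D z -> exists2 r, 0 < r & forall m, exists N, forall k, (N <= k)%N ->
      Q (vball z r) m (phi k).
Proof.
move=> UU Uinf Qmono Qloc; have UF : ProperFilter U := ultra_proper.
pose T := ('rV[(rat * rat)%type]_n * nat)%type.
pose ball (p : T) : set V :=
  vball (\row_j Complex (ratr (p.1 ord0 j).1) (ratr (p.1 ord0 j).2)) p.2.+1%:R^-1.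
(* Only balls on which [Q] holds along [U] at all levels impose a condition, and only finitely many
   codes occur, so [E m] belongs to [U]. *)
pose E m := [set k | forall j, (j <= m)%N -> forall p : T, unpickle j = Some p ->
  (forall m', U (Q (ball p) m')) -> Q (ball p) m k].
have EU m : U (E m).
  have H j : U [set k | forall p : T, unpickle j = Some p ->
      (forall m', U (Q (ball p) m')) -> Q (ball p) m k].
    case: (unpickle j) => [p|]; last by apply: filterE.
    have [h|nh] := EM (forall m', U (Q (ball p) m')).
      by apply: filterS (h m) => k hk _ [<-] _.
    by apply: filterE => k _ [<-] /nh.
  suff Hi i : U [set k | forall j, (j <= i)%N -> forall p : T, unpickle j = Some p ->
    (forall m', U (Q (ball p) m')) -> Q (ball p) m k] by exact: Hi.
  elim: i => [|i IH].
    by apply: filterS (H 0%N) => k hk j; rewrite leqn0 => /eqP ->.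
  apply: filterS (filterI IH (H i.+1)) => k /= [h1 h2] j.
  by rewrite leq_eqVlt => /orP[/eqP ->|ji]; [exact: h2|exact: h1].
have [f hf] : {f : nat * nat -> nat & forall mN, E mN.1 (f mN) /\ (mN.2 <= f mN)%N}.
  apply: (@choice _ _ (fun mN k => E mN.1 k /\ (mN.2 <= k)%N)) => -[m N].
  by have [k [h1 h2]] := filter_ex (filterI (EU m) (Uinf N)); exists k.
pose phi := fix phi m := match m with 0%N => f (0, 0)%N | m'.+1 => f (m'.+1, (phi m').+1) end.
exists phi; split.
  by apply: homo_ltn => [a b c|i]; [exact: ltn_trans|have [] := hf (i.+1, (phi i).+1)].
have phiE m : E m (phi m).
  by case: m => [|m]; [have [] := hf (0, 0)%N|have [] := hf (m.+1, (phi m).+1)].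
move=> z Dz; have [r r0 hr] := Qloc z Dz.
have r20 : 0 < r / 2 by lra.
(* The rational centre is within half the radius [i.+1%:R^-1] of [z], so that the rational ball lies
   in [vball z r] and contains a polydisc around [z] itself. *)
have [i hi] := natr_inv_lt r20; have {}hi := hi i (leqnn i).
have i0 : (0 : R) < i.+1%:R^-1 by rewrite invr_gt0.
have i20 : (0 : R) < i.+1%:R^-1 / 2 by rewrite divr_gt0.
have [q hq] := rat_vector_near z i20.
pose p : T := (q, i).
have sub1 : ball p `<=` vball z r.
  move=> x xp j; set w := \row_j _ in hq; have := xp j; have := hq j; rewrite /= -/w => h1 h2.
  have -> : (x - z) ord0 j = (x - w) ord0 j + (w - z) ord0 j by rewrite !mxE; ring.
  apply: le_lt_trans (ncD _ _) _.
  by move: hi h1 h2; move: (i.+1%:R^-1) => d hi h1 h2; lra.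
have sub2 : vball z (i.+1%:R^-1 / 2) `<=` ball p.
  move=> x xz j; set w := \row_j _ in hq; rewrite /= -/w.
  have := xz j; have := hq j => h1 h2.
  have -> : (x - w) ord0 j = (x - z) ord0 j - (w - z) ord0 j by rewrite !mxE; ring.
  apply: le_lt_trans (ncBD _ _) _.
  by move: h1 h2; move: (i.+1%:R^-1) => d h1 h2; lra.
have good m : U (Q (ball p) m) by apply: filterS (hr m) => k; exact: Qmono.
exists (i.+1%:R^-1 / 2) => // m; exists (maxn m (pickle p)) => k.
rewrite geq_max => /andP[mk pk].
apply: (Qmono _ _ _ _ _ sub2 mk).
by apply: (phiE k (pickle p) pk p) => //; exact: pickleK.
Qed.

End SeveralVariables.

(** * Limits of holomorphic functions of several variables, and the theorem *)

Section NormalFamilies.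
Context {R : realType} {n : nat}.
Local Notation V := 'rV[R[i]]_n.
Implicit Types (f g : V -> R[i]) (x y z v h : V) (r S L t : R) (D : set V).

Definition vhol f z r := forall x, vball z r x -> differentiable f x.

Definition vbdd f z r S := forall x, vball z r x -> nc (f x) <= S.

Lemma vball_line_scaled z y v r s t (u : R[i]) : 0 < t -> vball z (r - s) y ->
  (forall j, nc (v ord0 j) <= t) -> nc u < s / t -> vball z r (y + u *: v).
Proof.
move=> t0 yz vt; rewrite ltr_pdivlMr// => ut j.
have -> : (y + u *: v - z) ord0 j = (y - z) ord0 j + u * v ord0 j by rewrite !mxE; ring.
apply: le_lt_trans (ncD _ _) _; rewrite ncM.
have := yz j; have : nc u * nc (v ord0 j) <= nc u * t by rewrite ler_wpM2l ?nc_ge0.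
by lra.
Qed.

Lemma vline_chol f z y v r s t : 0 < t -> vhol f z r -> vball z (r - s) y ->
  (forall j, nc (v ord0 j) <= t) -> chol (fun u => f (y + u *: v)) 0 (s / t).
Proof.
move=> t0 fh yz vt u; rewrite subr0 => us; eexists.
by apply: line_cdiff; apply: fh; exact: vball_line_scaled t0 yz vt us.
Qed.

Lemma vline_cbdd f z y v r s t S : 0 < t -> vbdd f z r S -> vball z (r - s) y ->
  (forall j, nc (v ord0 j) <= t) -> cbdd (fun u => f (y + u *: v)) 0 (s / t) S.
Proof.
move=> t0 fS yz vt u; rewrite subr0 => us.
by apply: fS; exact: vball_line_scaled t0 yz vt us.
Qed.

Lemma vball_center z r : 0 < r -> vball z r z.
Proof. by move=> r0 j; rewrite subrr mxE nc0. Qed.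

Lemma vball_sub z r s : r <= s -> vball z r `<=` vball z s.
Proof. by move=> rs x xz j; exact: lt_le_trans (xz j) rs. Qed.

(** The one-variable estimate on the line through [y] and [x], between the parameters 0 and 1. The
    smaller [t], the larger the disc of radius [r / 2 / t] on that line, which is where the factor
    [t] comes from. *)
Lemma vlip f z r S x y t : 0 < t -> t < r / 4 -> vhol f z r -> vbdd f z r S ->
  vball z (r / 2) y -> (forall j, nc ((x - y) ord0 j) <= t) ->
  nc (f x - f y) <= 32 * S / r * t.
Proof.
move=> t0 tr fh fS yz xy; have r0 : 0 < r by lra.
have yz' : vball z (r - r / 2) y by apply: vball_sub yz; lra.
have rt : 0 < r / 2 / t by rewrite !divr_gt0.
have rt2 : 2 < r / 2 / t by rewrite ltr_pdivlMr//; lra.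
have := @lip_bdd _ _ 0 _ S 1 0 rt (vline_chol t0 fh yz' xy) (vline_cbdd t0 fS yz' xy).
rewrite !subr0 nc0 nc1 scale1r scale0r addr0 (addrC y) subrK mulr1.
move=> H; apply: le_trans (H _ _) _; try lra.
Qed.

Lemma vtaylor f z r S h t : 0 < t -> t < r / 8 -> vhol f z r -> vbdd f z r S ->
  (forall j, nc (h ord0 j) <= t) ->
  nc (f (z + h) - f z - \sum_j h ord0 j * cgradient f z ord0 j) <=
  16 * 32 * S / (r / 2) ^+ 2 * t ^+ 2.
Proof.
move=> t0 tr fh fS ht; have r0 : 0 < r by lra.
have zz : vball z (r - r / 2) z by apply: vball_center; lra.
have rt : 0 < r / 2 / t by rewrite !divr_gt0.
have rt2 : 4 < r / 2 / t by rewrite ltr_pdivlMr//; lra.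
have := @taylor1 _ _ 0 _ S 0 1 rt (vline_chol t0 fh zz ht) (vline_cbdd t0 fS zz ht).
have D0 : differentiable f (z + (0 : R[i]) *: h).
  by rewrite scale0r addr0; apply: fh; exact: vball_center.
rewrite (cderivE (line_cdiff D0)) !subr0 add0r nc0 nc1 scale1r scale0r !addr0 expr1n !mulr1.
move=> H; apply: le_trans (H _ _) _; try lra.
Qed.

Lemma partial_bound f z r S j : 0 < r -> vhol f z r -> vbdd f z r S ->
  nc (cgradient f z ord0 j) <= 16 * S / (r / 2).
Proof.
move=> r0 fh fS.
have zz : vball z (r - r / 2) z by apply: vball_center; lra.
have ej i : nc ((delta_mx 0 j : V) ord0 i) <= 1.
  by rewrite mxE /=; case: eqP => _; rewrite ?nc1 ?nc0.
have r1 : 0 < r / 2 / 1 by rewrite divr1; lra.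
have := @deriv_bdd _ _ 0 _ S 0 r1 (vline_chol ltr01 fh zz ej) (vline_cbdd ltr01 fS zz ej).
have D0 : differentiable f (z + (0 : R[i]) *: (delta_mx 0 j : V)).
  by rewrite scale0r addr0; apply: fh; exact: vball_center.
rewrite (cderivE (line_cdiff D0)) subrr nc0 scale0r addr0 divr1.
rewrite (bigD1 j)//= big1 => [|i ij]; last by rewrite mxE (negbTE ij) andbF mul0r.
by rewrite mxE !eqxx mul1r addr0; apply; lra.
Qed.

Lemma uconv_sum (T I : Type) (U : set_system T) (UU : UltraFilter U) (s : seq I)
  (x : I -> T -> R[i]) (a : I -> R[i]) : (forall i, uconv U (x i) (a i)) ->
  uconv U (fun p => \sum_(i <- s) x i p) (\sum_(i <- s) a i).
Proof.
move=> xa; elim: s => [|i s IH].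
  rewrite big_nil; apply: (uconv_ext UU _ (uconv_const UU 0)).
  by apply: filterE => p /=; rewrite big_nil.
rewrite big_cons; apply: (uconv_ext UU _ (uconvD UU (xa i) IH)).
by apply: filterE => p /=; rewrite big_cons.
Qed.

(** As in one variable: the partial derivatives are bounded and converge along [U], and the uniform
    Taylor remainder passes to the limit. *)
Lemma ulim_differentiable (U : set_system nat) (u : nat -> V -> R[i]) g z r S :
  UltraFilter U -> 0 < r -> (forall k, vhol (u k) z r) ->
  U [set k | vbdd (u k) z r S] -> (forall x, vball z r x -> uconv U (u^~ x) (g x)) ->
  differentiable g z.
Proof.
move=> UU r0 uh uS ug; have UF : ProperFilter U := ultra_proper.
have [l hl] : {l : 'I_n -> R[i] & forall j, uconv U (fun k => cgradient (u k) z ord0 j) (l j)}.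
  apply: (@choice _ _ (fun j l => uconv U (fun k => cgradient (u k) z ord0 j) l)) => j.
  apply: (@ulim_ex _ _ U UU _ (16 * S / (r / 2))).
  by apply: filterS uS => k /= h; exact: partial_bound.
have r80 : 0 < r / 8 by lra.
apply: (differentiable_quadratic (l := l) r80 (K := 16 * 32 * S / (r / 2) ^+ 2)) => h hr.
have [h0|hn] := eqVneq (vn h) 0.
  have -> : h = 0.
    apply/rowP => j; rewrite mxE; apply/eqP; rewrite -nc_eq0 eq_le nc_ge0 andbT -h0.
    exact: nc_le_vn.
  rewrite addr0 subrr big1 => [|j _]; last by rewrite mxE mulr0.
  by rewrite subrr nc0 (_ : vn 0 = 0) ?expr0n ?mulr0// /vn normr0.
have h0 : 0 < vn h by rewrite lt_neqAle eq_sym hn vn_ge0.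
have zh : vball z r (z + h).
  move=> j; rewrite (addrC z) addrK; apply: le_lt_trans (nc_le_vn _ _) _; lra.
apply: (@uconv_le _ _ U UU (fun k => u k (z + h) - u k z -
  \sum_j cgradient (u k) z ord0 j * h ord0 j)).
  apply: uconvB; first by apply: uconvB; apply: ug => //; exact: vball_center.
  apply: uconv_sum => j; apply: uconvM => //; exact: uconv_const.
apply: filterS uS => k /= kS.
under eq_bigr do rewrite mulrC.
by apply: vtaylor h0 hr (uh k) kS _ => j; exact: nc_le_vn.
Qed.

(** Otherwise points [x k] where the estimate fails converge along [U] to some [y]. The common
    Lipschitz bound moves both [u k] and [g] from [x k] to [y] at a cost of [e / 4] each, and
    convergence at [y] costs a third [e / 4]. *)
Lemma ulim_uniform (U : set_system nat) (u : nat -> V -> R[i]) g z r S e :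
  UltraFilter U -> 0 < r -> (forall k, vhol (u k) z r) ->
  U [set k | vbdd (u k) z r S] -> (forall x, vball z r x -> uconv U (u^~ x) (g x)) ->
  0 < e -> U [set k | forall x, vball z (r / 8) x -> nc (u k x - g x) < e].
Proof.
move=> UU r0 uh uS ug e0; have UF : ProperFilter U := ultra_proper.
have [//|nU] := ultraVC UU [set k | forall x, vball z (r / 8) x -> nc (u k x - g x) < e].
have [k0 kS0] := filter_ex uS.
have S0 : 0 <= S by apply: le_trans (nc_ge0 _) (kS0 z (vball_center z r0)).
have [x hx] : {x : nat -> V & forall k, vball z (r / 8) (x k) /\
    ((~ forall y, vball z (r / 8) y -> nc (u k y - g y) < e) -> e <= nc (u k (x k) - g (x k)))}.
  apply: (@choice _ _ (fun k x => vball z (r / 8) x /\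
    ((~ forall y, vball z (r / 8) y -> nc (u k y - g y) < e) -> e <= nc (u k x - g x)))) => k.
  have [h|nh] := EM (forall y, vball z (r / 8) y -> nc (u k y - g y) < e).
    by exists z; split=> //; apply: vball_center; lra.
  apply: contrapT => /forallNP nx; apply: nh => y yz; rewrite ltNge; apply/negP => ye.
  by apply: (nx y).
have [a ha] : {a : 'I_n -> R[i] & forall j, uconv U (fun k => (x k - z) ord0 j) (a j)}.
  apply: (@choice _ _ (fun j l => uconv U (fun k => (x k - z) ord0 j) l)) => j.
  apply: (@ulim_ex _ _ U UU _ (r / 8)); apply: filterE => k /=.
  by have [h _] := hx k; exact: ltW.
pose y : V := z + \row_j a j.
have yz j : (y - z) ord0 j = a j by rewrite !mxE; ring.
have yr : vball z (r / 4) y.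
  move=> j; rewrite yz; apply: (@le_lt_trans _ _ (r / 8)); last by lra.
  by apply: (uconv_le UU (ha j)); apply: filterE => k /=; have [h _] := hx k; exact: ltW.
have y2 : vball z (r / 2) y by apply: vball_sub yr; lra.
pose K := 32 * S / r; have K0 : 0 <= K by rewrite divr_ge0 ?mulr_ge0// ltW.
pose t := Num.min (r / 8) (e / 4 / (K + 1)).
have t0 : 0 < t by rewrite lt_min !divr_gt0//; lra.
have t8 : t <= r / 8 by rewrite ge_min lexx.
have tK : K * t <= e / 4.
  have : t <= e / 4 / (K + 1) by rewrite ge_min lexx orbT.
  by rewrite ler_pdivlMr; lra.
have tr : t < r / 4 by lra.
have near : U [set k | forall j, nc ((x k - y) ord0 j) <= t].
  have : U [set k | forall j : 'I_n, nc ((x k - z) ord0 j - a j) < t].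
    by apply: filter_forall => j; exact: (ha j t t0).
  apply: filterS => k /= h j; have := h j.
  by rewrite (_ : _ - a j = (x k - y) ord0 j); [exact: ltW|rewrite !mxE; ring].
have vb q : q <= r -> vball z q `<=` vball z r by exact: vball_sub.
have gK k : (forall j, nc ((x k - y) ord0 j) <= t) -> nc (g (x k) - g y) <= K * t.
  move=> h; have [xr _] := hx k.
  apply: (@uconv_le _ _ U UU (fun i => u i (x k) - u i y)).
    by apply: uconvB; apply: ug; [apply: vb xr; lra|apply: vb yr; lra].
  by apply: filterS uS => i /= iS; exact: vlip t0 tr (uh i) iS y2 h.
have e40 : 0 < e / 4 by lra.
have uy : uconv U (u^~ y) (g y) by apply: ug; apply: vb yr; lra.
have [k /= [[h1 h2] [h3 h4]]] := filter_ex (filterI (filterI nU near) (filterI uS (uy _ e40))).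
have [_ /(_ h1) h5] := hx k.
have h6 := vlip t0 tr (uh k) h3 y2 h2; rewrite -/K in h6.
have := gK k h2; have := nc_tri (u k y) (u k (x k)) (g (x k)).
have := nc_tri (g y) (u k y) (g (x k)); rewrite (ncB (g y)); lra.
Qed.

End NormalFamilies.

Theorem theorem2p5 (R : realType) (n : nat) (D : set 'rV[R[i]]_n)
    (F : set ('rV[R[i]]_n -> R[i])) :
  domain D ->
  (forall f, F f -> holomorphic D f) ->
  (forall K : set 'rV[R[i]]_n, compact K -> K `<=` D ->
    exists h : riemann_sphere R -> \bar R,
      [/\ forall w, (0 <= h w)%E,
          exists a b c : R[i], [/\ a != b, a != c & b != c] /\
            [/\ h (Some a) \is a fin_num, h (Some b) \is a fin_num
              & h (Some c) \is a fin_num]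
        & forall f z, F f -> K z ->
            ((euclidean_norm (cgradient f z))%:E <= h (Some (f z)))%E]) ->
  normal_family D F.
Proof.
move=> [_ oD cD] Fh FK u uF.
have loc z : D z -> _ := @local_schottky _ _ D F z oD Fh FK.
have [U [UU Uinf]] := @nat_ultra; have UF : ProperFilter U := ultra_proper.
pose S := [set z | D z /\ exists L, U [set k | nc (u k z) <= L]].
have SD : S `<=` D by move=> z [].
have Sloc z : D z -> exists2 r, 0 < r & vball z r `<=` D /\
    forall x, vball z r x -> (S x <-> S z).
  move=> Dz; have [r r0 [rD h]] := loc z Dz; exists r => //; split=> // x xz.
  have zz : vball z r z by exact: vball_center.
  have step x1 x2 : vball z r x1 -> vball z r x2 -> S x1 -> S x2.
    move=> h1 h2 [_ [L hL]]; have [L' hL'] := h L.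
    split; first exact: rD.
    exists L'; apply: filterS hL => k /=; exact: hL' (uF k) x1 x2 h1 h2.
  by split; exact: step.
have [S0|S0] := EM (S !=set0); last first.
  have big z : D z -> exists2 r, 0 < r & forall M : nat,
      U [set k | forall x, vball z r x -> M%:R < nc (u k x)].
    move=> Dz; have [r r0 [rD h]] := loc z Dz; exists r => // M.
    have [L' hL'] := h M%:R.
    (* A point [x] of the polydisc with [nc (u k x) <= M%:R] would force [nc (u k z) <= L'], which
       fails for all [k] in a set of [U] since [z] is not in [S]. *)
    have : ~ U [set k | nc (u k z) <= L'].
      by move=> hU; apply: S0; exists z; split=> //; exists L'.
    have [//|hU _] := ultraVC UU [set k | nc (u k z) <= L'].
    apply: filterS hU => k /= kL x xz; rewrite ltNge; apply/negP => xM; apply: kL.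
    exact: hL' (uF k) x z xz (vball_center z r0) xM.
  pose Q (A : set 'rV[R[i]]_n) (m k : nat) := forall x, A x -> m%:R < nc (u k x).
  have Qmono A B m p k : A `<=` B -> (m <= p)%N -> Q B p k -> Q A m k.
    by move=> AB mp h x /AB/h; apply: le_lt_trans; rewrite ler_nat.
  have [phi [phi1 phi2]] := ultra_extraction UU Uinf Qmono big.
  exists phi; split=> //; right => z /phi2[r r0 h].
  exists (vball z r); first by apply/nbhs_vball; exists r.
  move=> M; have [N hN] := h (Num.bound `|M|).
  exists N => // k /= Nk w [wz _]; apply: lt_trans (hN k Nk w wz).
  exact: le_lt_trans (ler_norm M) (archi_boundP (normr_ge0 M)).
have SE : S = D := locally_invariant_all oD cD SD Sloc S0.
have [g ug] : {g : 'rV[R[i]]_n -> R[i] & forall z, D z -> uconv U (u^~ z) (g z)}.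
  apply: (@choice _ _ (fun z l => D z -> uconv U (u^~ z) l)) => z.
  have [Dz|nDz] := EM (D z); last by exists 0.
  have [_ [L hL]] : S z by rewrite SE.
  by have [l hl] := ulim_ex UU hL; exists l.
have bdd z : D z -> exists r L, [/\ 0 < r, vball z r `<=` D,
    forall k, vhol (u k) z r & U [set k | vbdd (u k) z r L]].
  move=> Dz; have [r r0 [rD h]] := loc z Dz.
  have [_ [L hL]] : S z by rewrite SE.
  have [L' hL'] := h L; exists r, L'; split=> //.
    by move=> k x /rD; exact: Fh.
  apply: filterS hL => k /= kL x xz.
  exact: hL' (uF k) z x (vball_center z r0) xz kL.
have unif z : D z -> exists2 r, 0 < r & forall m : nat,
    U [set k | forall x, vball z r x -> nc (u k x - g x) < m.+1%:R^-1].
  move=> Dz; have [r [L [r0 rD uh uL]]] := bdd z Dz.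
  exists (r / 8) => [|m]; first by rewrite divr_gt0.
  have m0 : (0 : R) < m.+1%:R^-1 by rewrite invr_gt0.
  by apply: (ulim_uniform UU r0 uh uL) m0 => x /rD; exact: ug.
pose Q (A : set 'rV[R[i]]_n) (m k : nat) :=
  forall x, A x -> nc (u k x - g x) < m.+1%:R^-1.
have Qmono A B m p k : A `<=` B -> (m <= p)%N -> Q B p k -> Q A m k.
  move=> AB mp h x /AB/h /lt_le_trans; apply.
  by rewrite lef_pV2 ?posrE ?ltr0n// ler_nat.
have [phi [phi1 phi2]] := ultra_extraction UU Uinf Qmono unif.
exists phi; split=> //; left; exists g; split.
  move=> z Dz; have [r [L [r0 rD uh uL]]] := bdd z Dz.
  by apply: (ulim_differentiable UU r0 uh uL) => x /rD; exact: ug.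
move=> z /phi2[r r0 h].
exists (vball z r); first by apply/nbhs_vball; exists r.
move=> P /uniform_nbhs[E [entE EP]].
move: entE; rewrite -entourage_ballE => -[e /= e0 eE].
have e1 : e = (Re e)%:C%C.
  by apply/eqP; rewrite eq_complex /= (ger0_Im (ltW e0)) !eqxx.
have d0 : 0 < Re e by rewrite -ltcR -e1.
have [m hm] := natr_inv_lt d0; have {}hm := hm m (leqnn m).
have [N hN] := h m; exists N => // k /= Nk; apply: EP => y [yz _].
apply: (eE (_, _)); rewrite /= -ball_normE /= e1 normE ltcR ncB.
exact: lt_trans (hN k Nk y yz) hm.
Qed.
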